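(* Let $\nu$ be a partition and let $n\geq 1$. Then \[ \omega\,\Delta'_{s_\nu} e_n\big|_{t=0} \;=\; \sum_{k=\ell(\nu)+1}^{|\nu|+1} P_{\nu,k-1}(q)\sum_{\substack{\mu\vdash n\\ \ell(\mu)=k}} q^{\overline{b}(\mu)} {k \brack m(\mu)}_q\, Q'_\mu, \] where \[ P_{\nu,k-1}(q) = q^{|\nu|-\binom{k}{2}} \sum_{\substack{|\rho|=|\nu|\\ \ell(\rho)=k-1}} q^{b(\rho)} {k-1\brack m(\rho)}_q K_{\nu,\rho}(q), \] the sum being over partitions $\rho$ (inner sums over an empty set of partitions are $0$).
   Context: Symmetric functions are over $\mathbb{Q}(q,t)$ in variables $\mathbf{x}=(x_1,x_2,\dots)$; $s_\lambda, e_n, h_n$ are Schur, elementary and complete homogeneous functions, and $\omega$ is the involution with $\omega e_n=h_n$. $K_{\lambda,\mu}(q)$ is the Kostka–Foulkes polynomial and $Q'_\mu=Q'_\mu(\mathbf{x};q)=\sum_\lambda K_{\lambda,\mu}(q)s_\lambda$ is the dual Hall–Littlewood function. For a partition $\lambda=(\lambda_1,\dots,\lambda_\ell)$: $\ell(\lambda)$ is its number of parts, $m_i(\lambda)$ the multiplicity of $i$ as a part, $b(\lambda)=\sum_i(i-1)\lambda_i$, $\overline{b}(\lambda)=b(\lambda)-\binom{\ell(\lambda)}{2}=\sum_i(\lambda_i-1)(i-1)$, and ${\ell(\lambda)\brack m(\lambda)}_q=[\ell(\lambda)]_q!/\prod_i [m_i(\lambda)]_q!$, with $[n]_q=1+q+\dots+q^{n-1}$,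 $[n]_q!=[n]_q\cdots[1]_q$. Let $\widetilde H_\mu(\mathbf{x};q,t)$ denote the modified Macdonald polynomials, indexed so that $\widetilde H_\mu|_{t=0}=\mathrm{rev}_q(Q'_\mu)$ (this is the transpose of the indexing in Haglund's book); in this indexing, the cell of $\mu$ in row $i$ ($1\le i\le \ell(\mu)$) and column $j$ ($1\le j\le\mu_i$) has weight $q^{i-1}t^{j-1}$. For a symmetric function $f$, the primed delta operator $\Delta'_f$ is the linear operator on symmetric functions with $\Delta'_f\widetilde H_\mu = f(\dots,q^{i-1}t^{j-1},\dots)\,\widetilde H_\mu$, where $(i,j)$ ranges over all cells of $\mu$ other than $(1,1)$ and all other variables of $f$ are set to $0$. Here $\mathrm{rev}_q$ reverses the coefficient sequence of a polynomial in $q$: if $f$ has $q$-degree $d$, $\mathrm{rev}_q f = q^d f|_{q\to q^{-1}}$. *)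

(* Defs.v *)
(* Symmetric functions of degree m are represented by their
   coordinate vectors in the monomial basis, indexed by partitions of m. *)
From HB Require Import structures.
From mathcomp Require Import all_boot all_order all_algebra.
From Stdlib Require Import ClassicalEpsilon.
Set Implicit Arguments. Unset Strict Implicit. Unset Printing Implicit Defensive.
Import Order.TTheory GRing.Theory Num.Theory.
Local Open Scope ring_scope.

Notation Qqt := {fraction {poly {poly rat}}}.
Definition qq : Qqt := tofrac ((('X : {poly rat}))%:P : {poly {poly rat}}).
Definition tt : Qqt := tofrac ('X : {poly {poly rat}}).

(* ---------- partitions of m: weakly decreasing m-tuples padded by zeros ---------- *)
Definition is_part (m : nat) (s : m.-tuple 'I_m.+1) : bool :=
  sorted (fun a b : nat => (b <= a)%N) (map val s) && (sumn (map val s) == m).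
Definition intpart (m : nat) := {s : m.-tuple 'I_m.+1 | is_part s}.

Definition parts m (la : intpart m) : seq nat := map val (val (val la)).
Definition part m (la : intpart m) (i : nat) : nat := nth 0%N (parts la) i.
Definition plen m (la : intpart m) : nat := count (fun x => 0 < x)%N (parts la).
Definition mult m (la : intpart m) (i : nat) : nat := count_mem i (parts la).

Definition dom m (la mu : intpart m) : bool :=
  [forall k : 'I_m.+1, (\sum_(i < k) part mu i <= \sum_(i < k) part la i)%N].

Definition is_conj m (la k : intpart m) : bool :=
  [forall j : 'I_m, part k j == count (fun x => j < x)%N (parts la)].
Definition conjp m (la : intpart m) : intpart m :=
  odflt la [pick k : intpart m | is_conj la k].

Definition bstat m (la : intpart m) : nat := (\sum_(i < m) i * part la i)%N.
Definition bbar m (la : intpart m) : nat := (\sum_(i < m) (part la i).-1 * i)%N.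

Definition qint (k : nat) : Qqt := \sum_(i < k) qq ^+ i.
Definition qfact (k : nat) : Qqt := \prod_(i < k) qint i.+1.
Definition qmultinom m (la : intpart m) : Qqt :=
  qfact (plen la) / \prod_(1 <= i < m.+1) qfact (mult la i).

Notation sym m := {ffun intpart m -> Qqt^o}.

Definition mono m (la : intpart m) : sym m := [ffun mu => (mu == la)%:R].

Definition incell m (la : intpart m) (c : 'I_m * 'I_m) : bool := (c.2 < part la c.1)%N.

(* semistandard tableaux of shape la with entries in {1..N}; value 0 outside la *)
Definition ssyt m (la : intpart m) N (T : {ffun 'I_m * 'I_m -> 'I_N.+1}) : bool :=
  [forall c : 'I_m * 'I_m, (val (T c) == 0%N) == ~~ incell la c] &&
  [forall c : 'I_m * 'I_m, forall d : 'I_m * 'I_m,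
     ((d.1 == c.1 :> nat) && (d.2 == c.2.+1 :> nat) && incell la d) ==> (T c <= T d)%N] &&
  [forall c : 'I_m * 'I_m, forall d : 'I_m * 'I_m,
     ((d.1 == c.1.+1 :> nat) && (d.2 == c.2 :> nat) && incell la d) ==> (T c < T d)%N].

(* Schur function s_la: coefficient of m_mu is the Kostka number #SSYT(la, mu) *)
Definition schur m (la : intpart m) : sym m :=
  [ffun mu => (#|[set T : {ffun 'I_m * 'I_m -> 'I_m.+1} | ssyt la T &&
       [forall k : 'I_m, #|[pred c | val (T c) == k.+1]| == part mu k]]|)%:R].

Definition schur_eval m (la : intpart m) (ys : seq Qqt) : Qqt :=
  \sum_(T : {ffun 'I_m * 'I_m -> 'I_(size ys).+1} | ssyt la T)
     \prod_(c | incell la c) ys`_((val (T c)).-1).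

(* power sum p_la: coefficient of x^mu *)
Definition psum m (la : intpart m) : sym m :=
  [ffun mu => (#|[set f : {ffun 'I_m -> 'I_m} |
       [forall i : 'I_m, (part la i == 0%N) ==> (val (f i) == 0%N)] &&
       [forall j : 'I_m, (\sum_(i < m | f i == j) part la i)%N == part mu j]]|)%:R].

(* e_n = m_{1^n} *)
Definition elem n : sym n := \sum_(la : intpart n | [forall i : 'I_n, (part la i <= 1)%N]) mono la.

(* coordinates of f in a basis B (B is a basis in all uses below) *)
Definition coords m (B : intpart m -> sym m) (f : sym m) : intpart m -> Qqt :=
  epsilon (inhabits (fun _ => 0)) (fun c : intpart m -> Qqt => f = \sum_la c la *: B la).

(* plethystic substitution X -> X(1 - z) : p_k -> (1 - z^k) p_k *)
Definition pleth1m m (z : Qqt) (f : sym m) : sym m :=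
  \sum_la (coords (@psum m) f la * \prod_(i < m | (0 < part la i)%N) (1 - z ^+ part la i))
          *: psum la.

Definition in_schur_span m (P : pred (intpart m)) (f : sym m) : Prop :=
  exists a : intpart m -> Qqt, f = \sum_(la | P la) a la *: schur la.

Definition omega m (f : sym m) : sym m :=
  \sum_la coords (@schur m) f la *: schur (conjp la).

Definition is_Qprime m (mu : intpart m) (Q : sym m) : Prop :=
  in_schur_span (fun la => dom la mu && (la != mu)) (Q - schur mu) /\
  in_schur_span (fun la => dom mu la) (pleth1m qq Q).
Definition Qprime m (mu : intpart m) : sym m :=
  epsilon (inhabits 0) (is_Qprime mu).
Definition kostka_foulkes m (la mu : intpart m) : Qqt := coords (@schur m) (Qprime mu) la.

(* H[X(1-t)] in span{s_la : la >= mu}, H[X(1-q)] in span{s_la : la >= mu'},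
   <H, s_(n)> = 1 (= coefficient of m_(n)) *)
Definition is_Htilde n (mu : intpart n) (H : sym n) : Prop :=
  [/\ in_schur_span (fun la => dom la mu) (pleth1m tt H),
      in_schur_span (fun la => dom la (conjp mu)) (pleth1m qq H) &
      forall la : intpart n, part la 0 = n -> H la = 1].
Definition Htilde n (mu : intpart n) : sym n := epsilon (inhabits 0) (is_Htilde mu).

Definition cell_weights n (mu : intpart n) : seq Qqt :=
  [seq qq ^+ c.1 * tt ^+ c.2 |
     c <- [seq c <- [seq (i, j) | i <- iota 0 n, j <- iota 0 (part mu i)] | c != (0%N, 0%N)]].

Definition DeltaP m (nu : intpart m) n (f : sym n) : sym n :=
  \sum_mu (coords (@Htilde n) f mu * schur_eval nu (cell_weights mu)) *: Htilde mu.

Definition Pcoef m (nu : intpart m) (j : nat) : Qqt :=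
  qq ^ ((m%:Z) - ('C(j.+1, 2))%:Z) *
  \sum_(rho : intpart m | plen rho == j) qq ^+ bstat rho * qmultinom rho * kostka_foulkes nu rho.

Definition rhs m (nu : intpart m) n : sym n :=
  \sum_((plen nu).+1 <= k < m.+2)
     Pcoef nu k.-1 *: \sum_(mu : intpart n | plen mu == k)
                          (qq ^+ bbar mu * qmultinom mu) *: Qprime mu.

(* x|_{t=0} = y  :  x = N/d with N, d in Q[q][t], d(q,0) <> 0, and y = N(q,0)/d(q,0) *)
Definition at_t0_eq (x y : Qqt) : Prop :=
  exists N d : {poly {poly rat}},
    [/\ d`_0 != 0, x = tofrac N / tofrac d &
        y * tofrac ((d`_0)%:P) = tofrac ((N`_0)%:P)].

(* Main.v *)
(* Identify a coordinate vector in the monomial basis with a linear functional on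
   symmetric functions, h_mu being dual to m_mu.  All the characterisations in the
   statement then say that functionals vanish on Schur functions, possibly after a
   plethysm X |-> X (1 - z).

   At t = 0 the conditions defining Htilde_mu become those of the dual
   Hall-Littlewood function with parameter 1/q, up to a scalar; the scalar is fixed
   by the value at h_n.  Hence the coefficients at t = 0 of e_n in the Htilde_mu are,
   up to the same scalars, the pairings <e_n, P_mu> with the Hall-Littlewood
   functions of parameter 1/q, and Delta'_(s_nu) multiplies them by
   s_nu(q, ..., q^(l(mu) - 1)).

   The principal specialization p_k |-> (1 - u^k) / (1 - z^k) of P_mu is a multiple of
   prod_(i < l(mu)) (1 - u z^-i).  For a fixed f, the expansion of f in the functions
   P_mu therefore gives an expansion of the specialized f in these products, and
   grouping by l(mu) yields coefficients D_r (for z = q).  Comparing the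
   expansion with parameter q of f and the one with parameter 1/q of omega f, and
   evaluating s_nu in the same way, the theorem becomes a connection
   formula between the two families of products. *)

(* [Htilde] and [Qprime] are chosen by [epsilon], so their existence must be proved before anything
   can be computed with them. For [Htilde] this rests on Macdonald's operator: it is triangular on
   the functions e_(la'), and after conjugation by X |-> X (1 - t) it becomes symmetric in q and t,
   so that a single eigenfunctional meets both triangularity conditions. That its value at h_n is
   nonzero is visible only at t = 0, where the Hall-Littlewood specialization computes it. Schur
   functions are handled through alternants in d or d + 1 variables; this is why degree d asks for d
   + (d + 1) <= N power sums. The passage from q to 1/q rests on 1 - q^-k = - q^-k (1 - q^k): up to
   a power of q it is omega, which conjugates shapes and reverses dominance. In the connection
   formula both families of products are bases of the polynomials in u, and the coefficients have a
   closed form with the power q^(j (j + 1)). This power absorbs both binomial exponents of the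
   statement, one from P and one from b - bbar. *)
Require Import Defs.
From HB Require Import structures.
From mathcomp Require Import all_boot all_order all_algebra.
From mathcomp Require Import fingroup perm.
From mathcomp Require Import mpoly.
From mathcomp Require Import zify ring.
From Stdlib Require Import ClassicalEpsilon.
Set Implicit Arguments. Unset Strict Implicit. Unset Printing Implicit Defensive.
Import GRing.Theory.
Local Open Scope ring_scope.

(** * Partitions *)

Section Partitions.
Local Open Scope nat_scope.

Lemma big_widen0 (R : Type) (idx : R) (op : Monoid.law idx) (f : nat -> R) k n :
  k <= n -> (forall i, k <= i -> f i = idx) ->
  \big[op/idx]_(i < n) f i = \big[op/idx]_(i < k) f i.
Proof.
move=> le_kn f0; rewrite -(subnKC le_kn) big_split_ord /= [X in op _ X]big1 ?Monoid.mulm1 //.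
by move=> i _; apply: f0; apply: leq_addr.
Qed.

Arguments big_widen0 {R idx op} f {k n}.

Lemma leq_sum_widen (f : nat -> nat) k n :
  k <= n -> \sum_(i < k) f i <= \sum_(i < n) f i.
Proof. by move=> le_kn; rewrite -(subnKC le_kn) big_split_ord leq_addr. Qed.

Section Fixed.
Variable m : nat.
Implicit Types la mu : intpart m.

Lemma size_parts la : size (parts la) = m.
Proof. by rewrite /parts size_map size_tuple. Qed.

Lemma sorted_parts la : sorted geq (parts la).
Proof. by have /andP[] := valP la. Qed.

Lemma sumn_parts la : sumn (parts la) = m.
Proof. by have /andP[_ /eqP] := valP la. Qed.

Lemma part_big la i : m <= i -> part la i = 0.
Proof. by move=> le_mi; rewrite /part nth_default // size_parts. Qed.

Lemma part_mono la i j : i <= j -> part la j <= part la i.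
Proof.
move=> le_ij; have [le_mj|lt_jm] := leqP m j; first by rewrite part_big.
have geq_trans : transitive geq by move=> x y z; rewrite /geq /= => h1 h2; apply: leq_trans h1.
apply: (sorted_leq_nth geq_trans _ 0 (sorted_parts la)) => //.
- by move=> x; rewrite /geq /=.
- by rewrite inE size_parts (leq_ltn_trans le_ij).
- by rewrite inE size_parts.
Qed.

Lemma sum_part la k : m <= k -> \sum_(i < k) part la i = m.
Proof.
move=> le_mk; rewrite (big_widen0 _ le_mk) => [|i]; last exact: part_big.
by have := sumn_parts la; rewrite sumnE (big_nth 0) big_mkord size_parts.
Qed.

Lemma partP la mu : (forall i, part la i = part mu i) -> la = mu.
Proof.
move=> eq_p; apply/val_inj/val_inj/(inj_map val_inj).
by apply: (@eq_from_nth _ 0); rewrite ?size_parts // => i _; apply: eq_p.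
Qed.

Lemma part_le la i : part la i <= m.
Proof.
have [le_mi|lt_im] := leqP m i; first by rewrite part_big.
by rewrite -[X in _ <= X](sum_part la (leqnn m)) (bigD1 (Ordinal lt_im)) //= leq_addr.
Qed.

Lemma leq_psum la k : \sum_(i < k) part la i <= m.
Proof.
rewrite -[X in _ <= X](sum_part la (leq_maxl m k)).
exact: leq_sum_widen (leq_maxr _ _).
Qed.

Lemma domP la mu :
  reflect (forall k, \sum_(i < k) part mu i <= \sum_(i < k) part la i) (dom la mu).
Proof.
apply: (iffP forallP) => [dom_lm k|dom_lm k]; last exact: dom_lm.
have [le_km|lt_mk] := leqP k m; first exact: (dom_lm (inord k)) || by have := dom_lm (inord k); rewrite inordK.
by rewrite !sum_part // ltnW.
Qed.

Lemma dom_refl la : dom la la.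
Proof. by apply/domP. Qed.

Lemma dom_trans la mu nu : dom la mu -> dom mu nu -> dom la nu.
Proof. by move=> /domP h1 /domP h2; apply/domP => k; apply: leq_trans (h1 k). Qed.

Lemma dom_anti la mu : dom la mu -> dom mu la -> la = mu.
Proof.
move=> /domP h1 /domP h2; have eq_s k : \sum_(i < k) part la i = \sum_(i < k) part mu i.
  by apply/eqP; rewrite eqn_leq h1 h2.
apply: partP => i; have := eq_s i.+1; rewrite !big_ord_recr /= eq_s; exact: addnI.
Qed.

Lemma ex_part (f : nat -> nat) :
  (forall i j, i <= j -> f j <= f i) -> (forall i, m <= i -> f i = 0) ->
  \sum_(i < m) f i = m -> exists la : intpart m, forall i, part la i = f i.
Proof.
move=> f_mono f_big f_sum.
have f_le i : f i < m.+1.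
  have [le_mi|lt_im] := leqP m i; first by rewrite f_big.
  by rewrite ltnS -[X in _ <= X]f_sum (bigD1 (Ordinal lt_im)) //= leq_addr.
pose s := [tuple (Ordinal (f_le i)) | i < m].
have Es : map val s = mkseq f m.
  by rewrite -map_comp /mkseq -val_enum_ord -map_comp.
have Ps : is_part s.
  rewrite /is_part Es; apply/andP; split.
    rewrite /mkseq; apply: homo_sorted (iota_sorted 0 m) => i j; exact: f_mono.
  by rewrite sumnE big_map -{1}[m]subn0 -/(index_iota 0 m) big_mkord f_sum.
exists (exist _ s Ps) => i; rewrite /part /parts /= Es.
have [le_mi|lt_im] := leqP m i; last by rewrite nth_mkseq.
by rewrite nth_default ?size_mkseq // f_big.
Qed.

Lemma leq_plen la k : (plen la <= k) = (part la k == 0).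
Proof.
suff key s : sorted geq s -> (count (fun x => 0 < x) s <= k) = (nth 0 s k == 0).
  exact: key (sorted_parts la).
elim: s k => [|x s IHs] k /=; first by rewrite nth_nil leq0n.
case: k => [|k] /= ss.
  case: x ss => [|x] //= ss; rewrite leqn0.
  have -> : count (fun x => 0 < x) s = 0; last by [].
  elim: s {IHs} ss => //= y s IHs /andP[]; rewrite /geq /= leqn0 => /eqP -> ss.
  by rewrite IHs.
rewrite -IHs ?(path_sorted ss) //; case: x ss => [|x] //= ss.
have -> : count (fun x => 0 < x) s = 0; last by rewrite !leq0n.
by elim: s {IHs} ss => //= y s IHs /andP[]; rewrite /geq /= leqn0 => /eqP -> ss; rewrite IHs.
Qed.

Lemma part_gt0 la i : (0 < part la i) = (i < plen la).
Proof. by rewrite lt0n -leq_plen -ltnNge. Qed.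

Lemma plen_le la : plen la <= m.
Proof. by rewrite leq_plen part_big. Qed.

Lemma dom_plen la mu : dom la mu -> plen la <= plen mu.
Proof.
move=> /domP h; rewrite leq_plen -leqn0.
have sum_mu : \sum_(i < plen mu) part mu i = m.
  rewrite -[RHS](sum_part mu (leqnn m)) (big_widen0 _ (plen_le mu)) // => i.
  by rewrite leq_plen => /eqP.
have := leq_psum la (plen mu).+1; rewrite big_ord_recr /= => le1.
have := h (plen mu); rewrite sum_mu => le2.
by rewrite -(leq_add2l (\sum_(i < plen mu) part la i)) addn0 (leq_trans le1).
Qed.

Lemma mult_sum la i : 0 < i -> mult la i = \sum_(j < m) (part la j == i).
Proof.
move=> _; rewrite /mult -sum1_count big_mkcond (big_nth 0) big_mkord size_parts.
by apply: eq_bigr => j _; rewrite /part /=; case: eqP.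
Qed.

(** Each row is at most c plus its excess over c. Together with [psum_minn_eq] this makes the total
    excess over c the maximum over k of the k-th partial sum minus k c, so dominance can be read off
    from excesses. *)
Lemma psum_minn la c k :
  \sum_(i < k) part la i <= k * c + \sum_(i < m) (part la i - c).
Proof.
have -> : k * c = \sum_(i < k) c by rewrite sum_nat_const card_ord.
have -> : \sum_(i < m) (part la i - c) = \sum_(i < maxn m k) (part la i - c).
  by rewrite (big_widen0 (fun i => part la i - c) (leq_maxl m k)) // => i /part_big ->.
apply: (@leq_trans (\sum_(i < k) (c + (part la i - c)))).
  by apply: leq_sum => i _; lia.
rewrite big_split /= leq_add2l.
exact: (leq_sum_widen (fun i => part la i - c) (leq_maxr _ _)).
Qed.

(** The k that works is the number of rows longer than c. *)
Lemma psum_minn_eq la c : exists k,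
  \sum_(i < k) part la i = k * c + \sum_(i < m) (part la i - c).
Proof.
pose P k := part la k <= c.
have exP : exists k, P k by exists m; rewrite /P part_big.
exists (ex_minn exP); case: ex_minnP => k Pk kmin.
have -> : k * c = \sum_(i < k) c by rewrite sum_nat_const card_ord.
have -> : \sum_(i < m) (part la i - c) = \sum_(i < k) (part la i - c).
  have le_km : k <= m by apply: kmin; rewrite /P part_big.
  apply: (big_widen0 (fun i => part la i - c)) => // i le_ki.
  apply/eqP; rewrite subn_eq0; exact: leq_trans (part_mono la le_ki) Pk.
rewrite -big_split /=; apply: eq_bigr => i _; rewrite subnKC // leqNgt.
by apply/negP => /ltnW Pi; have := kmin _ Pi; rewrite leqNgt ltn_ord.
Qed.

Definition cpart la j := \sum_(i < m) (j < part la i).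

Lemma sum_cpart la k : \sum_(j < k) cpart la j = \sum_(i < m) minn (part la i) k.
Proof.
rewrite exchange_big /=; apply: eq_bigr => i _.
elim: k => [|k IHk]; first by rewrite big_ord0 minn0.
by rewrite big_ord_recr /= IHk; lia.
Qed.

Lemma is_conjE la k : is_conj la k = [forall j : 'I_m, part k j == cpart la j].
Proof.
apply: eq_forallb => j; congr (_ == _); rewrite /cpart -sum1_count big_mkcond (big_nth 0).
by rewrite big_mkord size_parts; apply: eq_bigr => i _; rewrite /part; case: ifP.
Qed.

(** The default value of [conjp] has to be ruled out: by [ex_part] the column lengths do form a
    partition of m. *)
Lemma part_conj la j : part (conjp la) j = cpart la j.
Proof.
have cpart_big i : m <= i -> cpart la i = 0.
  by move=> le_mi; apply: big1 => k _; rewrite ltnNge (leq_trans (part_le la k) le_mi).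
rewrite /conjp; case: pickP => [k|no].
  rewrite is_conjE => /forallP eq_k; have [le_mj|lt_jm] := leqP m j; last exact/eqP/(eq_k (Ordinal lt_jm)).
  by rewrite cpart_big // part_big.
have [||k Ek] := ex_part _ cpart_big.
- by move=> i k le_ik; apply: leq_sum => l _; do 2!case: ltnP => //; lia.
- rewrite sum_cpart -[RHS](sum_part la (leqnn m)); apply: eq_bigr => i _.
  by apply/minn_idPl/part_le.
by have := no k; rewrite is_conjE; move/negP; case; apply/forallP => i; rewrite Ek.
Qed.

Lemma sum_conj la k : \sum_(j < k) part (conjp la) j = \sum_(i < m) minn (part la i) k.
Proof. by rewrite -sum_cpart; apply: eq_bigr => j _; rewrite part_conj. Qed.

(** The k-th partial sum of a conjugate is the complement in m of the total excess over k, and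
    excesses increase with dominance. *)
Lemma dom_conj la mu : dom la mu -> dom (conjp mu) (conjp la).
Proof.
move=> /domP h; apply/domP => k; rewrite !sum_conj.
have E (nu : intpart m) : \sum_(i < m) minn (part nu i) k + \sum_(i < m) (part nu i - k) = m.
  by rewrite -big_split /= -[RHS](sum_part nu (leqnn m)); apply: eq_bigr => i _; lia.
have [r Er] := psum_minn_eq mu k; have := h r; rewrite Er => le1.
have := leq_trans le1 (psum_minn la k r); rewrite leq_add2l => le2.
by have := E la; have := E mu; lia.
Qed.

Lemma conj_gt la i j : (i < part (conjp la) j) = (j < part la i).
Proof.
have card_lt : \sum_(k < m) (k < i) <= i.
  have [le_mi|/ltnW le_im] := leqP m i.
    apply: leq_trans le_mi; rewrite -[X in _ <= X]card_ord -sum1_card.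
    by apply: leq_sum => k _; apply: leq_b1.
  rewrite (big_widen0 (fun k => (k < i) : nat) le_im) => [|k]; last by rewrite ltnNge => ->.
  rewrite -[X in _ <= X]card_ord -sum1_card.
  by apply: leq_sum => k _; apply: leq_b1.
rewrite part_conj /cpart; apply/idP/idP => [|lt_j].
  apply: contraLR; rewrite -!leqNgt => le_ij; apply: leq_trans card_lt.
  apply: leq_sum => k _; case: (ltnP k i) => [_|le_ik]; first exact: leq_b1.
  by rewrite ltnNge (leq_trans (part_mono la le_ik) le_ij).
have lt_im : i < m.
  by rewrite ltnNge; apply/negP => le_mi; rewrite part_big in lt_j.
apply: leq_trans (leq_sum_widen (fun k => (j < part la k) : nat) lt_im).
rewrite -[X in X <= _]card_ord -sum1_card; apply: leq_sum => k _.
by rewrite (leq_trans lt_j (part_mono la _)) // -ltnS.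
Qed.

Lemma conjK la : conjp (conjp la) = la.
Proof.
apply: partP => i; apply/eqP; rewrite eqn_leq; apply/andP; split; rewrite leqNgt.
  by rewrite !conj_gt ltnn.
by rewrite -conj_gt -conj_gt ltnn.
Qed.

Lemma conj_inj : injective (@conjp m).
Proof. exact: can_inj conjK. Qed.

Lemma dom_conjE la mu : dom (conjp mu) (conjp la) = dom la mu.
Proof. by apply/idP/idP => /dom_conj; rewrite ?conjK. Qed.

End Fixed.

(** * Sorting and rearrangement inequalities *)

Lemma sort_fun n (al : 'I_n -> nat) :
  exists s : 'S_n, forall i j : 'I_n, i <= j -> al (s j) <= al (s i).
Proof.
pose t := [tuple al i | i < n]; pose u := sort geq t.
have size_u : size u == n by rewrite size_sort size_tuple.
have : perm_eq (Tuple size_u) t by rewrite perm_sort.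
case/tuple_permP => s Es; exists s => i j le_ij.
have us : sorted geq u by apply: sort_sorted => x y; apply: leq_total.
have nthu k : nth 0 u k = nth 0 [tuple tnth t (s i0) | i0 < n] k.
  by rewrite -[in RHS]Es.
have Eu (k : 'I_n) : nth 0 u k = al (s k).
  by rewrite nthu -tnth_nth !tnth_mktuple.
rewrite -!Eu.
have geq_trans : transitive geq by move=> x y z; rewrite /geq /= => h1 h2; apply: leq_trans h1.
apply: (sorted_leq_nth geq_trans _ 0 us) => //.
- by move=> x; rewrite /geq /=.
- by rewrite inE (eqP size_u).
- by rewrite inE (eqP size_u).
Qed.

(** Here [f] is the decreasing rearrangement of [be]. The threshold c is the largest value left out
    by the first #|I| ranks: the left side is at most #|I| c plus all excesses over c, and the right
    side equals this. *)
Lemma sum_set_le n (be : 'I_n -> nat) (f : nat -> nat) (s : 'S_n) (I : {set 'I_n}) :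
  (forall i j : 'I_n, i <= j -> f j <= f i) -> (forall i : 'I_n, be (s i) = f i) ->
  \sum_(i in I) be i <= \sum_(i < #|I|) f i.
Proof.
move=> f_mono Ef; have leIn : #|I| <= n by rewrite -[X in _ <= X]card_ord max_card.
have [En|ltIn] := eqVneq #|I| n.
  have -> : I = setT by apply/eqP; rewrite eqEcard subsetT cardsT card_ord En leqnn.
  rewrite cardsT card_ord (reindex_inj (@perm_inj _ s)) /=.
  by rewrite (eq_bigl predT) => [|i]; rewrite ?inE //; apply: leq_sum => i _; rewrite Ef.
have {ltIn} ltIn : #|I| < n by rewrite ltn_neqAle ltIn.
pose c := f #|I|.
apply: (@leq_trans (#|I| * c + \sum_i (be i - c))).
  rewrite -sum_nat_const.
  apply: (@leq_trans (\sum_(i in I) c + \sum_(i in I) (be i - c))).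
    by rewrite -big_split /=; apply: leq_sum => i _; lia.
  rewrite leq_add2l [X in _ <= X](bigID (mem I)) /=; exact: leq_addr.
rewrite (reindex_inj (@perm_inj _ s)) /=.
rewrite (eq_bigr (fun i : 'I_n => f i - c)); last by move=> i _; rewrite Ef.
have -> : #|I| * c = \sum_(i < #|I|) c by rewrite sum_nat_const card_ord.
have -> : \sum_(i < n) (f i - c) = \sum_(i < #|I|) (f i - c).
  rewrite [RHS](big_ord_widen n (fun i => f i - c)) // [RHS]big_mkcond /=.
  apply: eq_bigr => i _; case: ltnP => // le_Ii; apply/eqP; rewrite subn_eq0.
  exact: (f_mono (Ordinal ltIn)).
rewrite -big_split /= leq_eqVlt; apply/orP; left; apply/eqP/eq_bigr => i _.
by rewrite subnKC //; apply: (f_mono (widen_ord (ltnW ltIn) i) (Ordinal ltIn)); exact: ltnW (ltn_ord i).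
Qed.

Lemma ex_partn n d (f : nat -> nat) :
  (forall i j, i <= j -> f j <= f i) -> (forall i, n <= i -> f i = 0) ->
  \sum_(i < n) f i = d -> exists la : intpart d, forall i, part la i = f i.
Proof.
move=> f_mono f_big f_sumn.
have f_sum k : n <= k -> \sum_(i < k) f i = d.
  by move=> le_nk; rewrite -f_sumn; exact: (big_widen0 f).
have f_d i : d <= i -> f i = 0.
  move=> le_di; apply/eqP; rewrite -leqn0 leqNgt; apply/negP => fi.
  have : i.+1 <= \sum_(j < maxn n i.+1) f j.
    apply: leq_trans (leq_sum_widen f (leq_maxr _ _)).
    rewrite -[X in X <= _]card_ord -sum1_card; apply: leq_sum => j _.
    by apply: leq_trans fi (f_mono _ _ _); rewrite -ltnS.
  by rewrite f_sum ?leq_maxl // ltnNge le_di.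
apply: (ex_part f_mono f_d).
by rewrite -[RHS](f_sum _ (leq_maxl n d)) (big_widen0 f (leq_maxr n d)).
Qed.

Lemma sort_part n d (al : 'I_n -> nat) : \sum_i al i = d ->
  exists (la : intpart d) (s : 'S_n),
    (forall i : 'I_n, part la i = al (s i)) /\ (forall i, n <= i -> part la i = 0).
Proof.
move=> Ed; have [s s_mono] := sort_fun al.
pose f i := if insub i is Some j then al (s j) else 0.
have fE (i : 'I_n) : f i = al (s i) by rewrite /f valK.
have f_big i : n <= i -> f i = 0 by move=> le_ni; rewrite /f insubN // -leqNgt.
have f_mono i j : i <= j -> f j <= f i.
  have [le_nj|lt_jn] := leqP n j; first by rewrite f_big.
  move=> le_ij; have lt_in := leq_ltn_trans le_ij lt_jn.
  by rewrite (fE (Ordinal lt_in)) (fE (Ordinal lt_jn)); apply: s_mono.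
have [|la Ela] := ex_partn f_mono f_big (d := d).
  rewrite -Ed [RHS](reindex_inj (@perm_inj _ s)).
  by apply: eq_bigr => i _; rewrite fE.
exists la, s; split=> i; last by move=> /f_big; rewrite Ela.
by rewrite Ela fE.
Qed.

(** The reflection i |-> n - 1 - i turns the upper bound of [sum_set_le] into this lower bound. *)
Lemma perm_sum_set n (s : 'S_n) (I : {set 'I_n}) : \sum_(i < #|I|) i <= \sum_(i in I) s i.
Proof.
have h := @sum_set_le n (fun i => n.-1 - s i) (fun i => n.-1 - i) (s^-1)%g I.
have E1 : \sum_(i in I) (n.-1 - s i) + \sum_(i in I) s i = #|I| * n.-1.
  rewrite -big_split -sum_nat_const; apply: eq_bigr => i _ /=.
  by have := ltn_ord (s i); lia.
have E2 : \sum_(i < #|I|) (n.-1 - i) + \sum_(i < #|I|) i = #|I| * n.-1.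
  have -> : #|I| * n.-1 = \sum_(i < #|I|) n.-1 by rewrite sum_nat_const card_ord.
  rewrite -big_split; apply: eq_bigr => i _ /=.
  have le_In : #|I| <= n by rewrite -[X in _ <= X]card_ord max_card.
  have lt_in := leq_trans (ltn_ord i) le_In.
  by rewrite subnK // -ltnS (ltn_predK lt_in).
suff : \sum_(i in I) (n.-1 - s i) <= \sum_(i < #|I|) (n.-1 - i) by lia.
apply: h => [i j le_ij|i]; first by rewrite leq_sub2l.
by rewrite permKV.
Qed.

Lemma perm_psum_eq n (s : 'S_n) :
  (forall k, k <= n -> \sum_(i < n | i < k) s i = \sum_(i < n | i < k) i) -> s = 1%g.
Proof.
move=> h; apply/permP => i; rewrite perm1; apply: val_inj => /=.
have E (g : 'I_n -> nat) : \sum_(j < n | j < i.+1) g j = g i + \sum_(j < n | j < i) g j.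
  rewrite (bigD1 i) //=; congr (_ + _); apply: eq_bigl => j.
  by rewrite ltnS ltn_neqAle andbC -val_eqE.
have := h i.+1 (ltn_ord i); rewrite !E h ?(ltnW (ltn_ord i)) //; exact: addIn.
Qed.

Lemma big_ord_lt (R : Type) (idx : R) (op : Monoid.com_law idx) n k (f : nat -> R) : k <= n ->
  \big[op/idx]_(i < n | i < k) f i = \big[op/idx]_(i < k) f i.
Proof. by move=> le_kn; rewrite (big_ord_widen n f). Qed.

Lemma sum_ord_lt n k (f : nat -> nat) : k <= n ->
  \sum_(i < n | i < k) f i = \sum_(i < k) f i.
Proof. exact: big_ord_lt. Qed.

Lemma card_ord_lt n k : k <= n -> #|[set i : 'I_n | i < k]| = k.
Proof.
move=> le_kn; rewrite -sum1_card -[RHS]card_ord -sum1_card -(big_ord_lt _ (fun=> 1) le_kn).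
by apply: eq_bigl => i; rewrite inE.
Qed.

End Partitions.

(** * Newton identities and specializations *)

Section Newton.
Variables (B : comNzRingType) (n : nat).
Implicit Types (c pi : nat -> B).

(* [c] lists the values of h_0, ..., h_n in a specialization with power sums [pi]. *)
Definition newton c pi :=
  c 0%N = 1 /\ forall k, (k < n)%N ->
    k.+1%:R * c k.+1 = \sum_(i < k.+1) pi i.+1 * c (k - i)%N.

Definition conv c c' k := \sum_(i < k.+1) c i * c' (k - i)%N.

(** The recursion is the differential equation H' = P H of the generating functions, up to order n.
    In this form Leibniz's rule shows that adding power sums multiplies the h-series. *)
Lemma newtonP c pi : c 0%N = 1 ->
  newton c pi <-> (forall k, (k < n)%N ->
    (\poly_(i < n.+1) c i)^`()`_k = ((\poly_(i < n) pi i.+1) * \poly_(i < n.+1) c i)`_k).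
Proof.
move=> c0; have E k : (k < n)%N -> (k.+1%:R * c k.+1 = \sum_(i < k.+1) pi i.+1 * c (k - i)%N) <->
    ((\poly_(i < n.+1) c i)^`()`_k = ((\poly_(i < n) pi i.+1) * \poly_(i < n.+1) c i)`_k).
  move=> lt_kn; rewrite coef_deriv coef_poly ltnS lt_kn mulr_natl coefM.
  have -> // : \sum_(j < k.+1) (\poly_(i < n) pi i.+1)`_j * (\poly_(i < n.+1) c i)`_(k - j)
     = \sum_(i < k.+1) pi i.+1 * c (k - i)%N.
  apply: eq_bigr => j _; rewrite !coef_poly !ifT //; have := ltn_ord j; lia.
by split=> [[_ h] k lt_kn|h]; [apply/E/h | split=> // k lt_kn; apply/E/h].
Qed.

Lemma newton_conv c pi c' pi' :
  newton c pi -> newton c' pi' -> newton (conv c c') (fun k => pi k + pi' k).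
Proof.
move=> hc hc'; have c0 := hc.1; have c'0 := hc'.1.
move/(newtonP _ c0): hc => hc; move/(newtonP _ c'0): hc' => hc'.
have cc0 : conv c c' 0%N = 1 by rewrite /conv big_ord1 c0 c'0 mulr1.
apply/newtonP => // k lt_kn.
pose P := \poly_(i < n.+1) c i; pose P' := \poly_(i < n.+1) c' i.
have convE j : (j < n.+1)%N -> (\poly_(i < n.+1) conv c c' i)`_j = (P * P')`_j.
  move=> lt_jn; rewrite coef_poly lt_jn coefM; apply: eq_bigr => i _.
  by rewrite !coef_poly !ifT //; have := ltn_ord i; lia.
rewrite coef_deriv convE ?ltnS // -coef_deriv derivM coefD.
have -> : (P^`() * P')`_k = ((\poly_(i < n) pi i.+1) * P * P')`_k.
  by rewrite !coefM; apply: eq_bigr => i _; rewrite hc //; have := ltn_ord i; lia.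
have -> : (P * P'^`())`_k = ((\poly_(i < n) pi' i.+1) * P' * P)`_k.
  by rewrite mulrC !coefM; apply: eq_bigr => i _; rewrite hc' //; have := ltn_ord i; lia.
rewrite -coefD -!mulrA [P' * P]mulrC -mulrDl !coefM; apply: eq_bigr => i _.
rewrite convE; last by have := ltn_ord i; lia.
by rewrite coefD !coef_poly; case: ifP; rewrite ?addr0.
Qed.

Lemma eq_newton c pi pi' :
  (forall k, (0 < k <= n)%N -> pi k = pi' k) -> newton c pi -> newton c pi'.
Proof.
move=> eq_pi [c0 hc]; split=> // k lt_kn; rewrite hc //; apply: eq_bigr => i _.
by rewrite eq_pi //; have := ltn_ord i; lia.
Qed.

Lemma newton_geom (y : B) : newton (fun k => y ^+ k) (fun k => y ^+ k).
Proof.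
split=> // k _; rewrite mulr_natl -[LHS](_ : \sum_(i < k.+1) y ^+ k.+1 = _); last first.
  by rewrite sumr_const card_ord.
by apply: eq_bigr => i _; rewrite -exprD; congr (_ ^+ _); have := ltn_ord i; lia.
Qed.

Lemma newton_one : newton (fun k => (1 : {poly B})`_k) (fun=> 0).
Proof.
split=> [|k _]; first by rewrite coef1.
by rewrite coef1 mulr0 big1 // => i _; rewrite mul0r.
Qed.

(** The negative of the one-variable alphabet y; products of such factors remove variables from an
    alphabet. *)
Lemma newton_linear (y : B) : newton (fun k => (1 - y *: 'X)`_k) (fun k => - y ^+ k).
Proof.
have co k : (1 - y *: 'X)`_k = (k == 0%N)%:R - y * (k == 1%N)%:R.
  by rewrite coefB coef1 coefZ coefX.
split=> [|k _]; first by rewrite co /= mulr0 subr0.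
rewrite (eq_bigr (fun i : 'I_k.+1 => (- y ^+ i.+1) * ((k - i == 0)%N%:R - y * (k - i == 1)%N%:R))); last first.
  by move=> i _; rewrite co.
case: k => [|k]; first by rewrite big_ord1 co /=; ring.
rewrite !big_ord_recr /= big1 => [|i _]; last first.
  have -> : (k.+1 - i == 0)%N = false by have := ltn_ord i; lia.
  have -> : (k.+1 - i == 1)%N = false by have := ltn_ord i; lia.
  by rewrite mulr0 subr0 mulr0.
rewrite co subSnn subnn /= !mulr0 !subr0 !mulr1 !sub0r add0r mulr0 mulrN mulNr opprK -exprSr.
by rewrite subrr.
Qed.

Lemma newton_mul_poly (p p' : {poly B}) pi pi' :
  newton (fun k => p`_k) pi -> newton (fun k => p'`_k) pi' ->
  newton (fun k => (p * p')`_k) (fun k => pi k + pi' k).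
Proof.
move=> hp hp'; have [h0 h1] := newton_conv hp hp'.
by split=> [|k lt_kn]; rewrite ?coefM // h1 //; apply: eq_bigr => i _; rewrite coefM.
Qed.

Lemma newton_prod (I : Type) (r : seq I) (P : pred I) (x : I -> B) :
  newton (fun k => (\prod_(i <- r | P i) (1 - x i *: 'X))`_k)
         (fun k => - \sum_(i <- r | P i) x i ^+ k).
Proof.
elim: r => [|i r IHr].
  by rewrite big_nil; apply: eq_newton newton_one => k _; rewrite big_nil oppr0.
rewrite big_cons; case Pi: (P i); last first.
  by apply: eq_newton IHr => k _; rewrite big_cons Pi.
apply: eq_newton (newton_mul_poly (newton_linear (x i)) IHr) => k _.
by rewrite big_cons Pi opprD.
Qed.

End Newton.

Lemma newton_uniq (B : idomainType) n (c c' pi : nat -> B) :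
  (forall k, k.+1%:R != 0 :> B) ->
  newton n c pi -> newton n c' pi -> forall k, (k <= n)%N -> c k = c' k.
Proof.
move=> B0 [c0 hc] [c'0 hc'] k; elim/ltn_ind: k => -[|k] IHk lt_kn; first by rewrite c0 c'0.
apply: (mulfI (B0 k)); rewrite hc // hc' //; apply: eq_bigr => i _.
by rewrite IHk //; have := ltn_ord i; lia.
Qed.

Section Ring.
Variables (K : fieldType) (N : nat).
Hypothesis K0 : [pchar K] =i pred0.
Notation A := {mpoly K[N]}.

Lemma natK_neq0 k : k.+1%:R != 0 :> K.
Proof. by have /pcharf0P -> := K0. Qed.

Lemma natB_neq0 (B : nzRingType) (f : {rmorphism K -> B}) k : k.+1%:R != 0 :> B.
Proof. by rewrite -(rmorph_nat f) fmorph_eq0 natK_neq0. Qed.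

(* The variables of [A] are the power sums p_1, ..., p_N, so that p_k and h_k
   have their usual meaning only for k <= N. *)
Definition pgen k : A := \sum_(i < N | i.+1 == k) 'X_i.

Lemma pgenE (i : 'I_N) : pgen i.+1 = 'X_i.
Proof. by rewrite /pgen (eq_bigl (pred1 i)) ?big_pred1_eq. Qed.

(** Newton's recursion solved for h_k. All earlier values are kept in a list because each step
    refers to all of them. *)
Fixpoint hrec k : seq A :=
  if k is k'.+1 then
    rcons (hrec k') (k'.+1%:R^-1 *: \sum_(i < k'.+1) pgen i.+1 * (hrec k')`_(k' - i))
  else [:: 1].
Definition hgen k : A := (hrec k)`_k.

Lemma size_hrec k : size (hrec k) = k.+1.
Proof. by elim: k => //= k IHk; rewrite size_rcons IHk. Qed.

Lemma nth_hrec k i : (i <= k)%N -> (hrec k)`_i = hgen i.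
Proof.
elim: k => [|k IHk]; first by rewrite leqn0 => /eqP ->.
rewrite leq_eqVlt => /predU1P[-> // | lt_ik].
by rewrite /= nth_rcons size_hrec lt_ik IHk.
Qed.

Lemma hgen0 : hgen 0 = 1. Proof. by []. Qed.

Lemma hgenS k : k.+1%:R *: hgen k.+1 = \sum_(i < k.+1) pgen i.+1 * hgen (k - i).
Proof.
rewrite {1}/hgen /= nth_rcons size_hrec ltnn eqxx scalerA divff ?natK_neq0 // scale1r.
by apply: eq_bigr => i _; rewrite nth_hrec // leq_subr.
Qed.

Lemma newton_hgen n : newton n hgen pgen.
Proof. by split=> // k _; rewrite -hgenS mulr_natl scaler_nat. Qed.

Section Spec.
Variables (B : comNzRingType) (f : {rmorphism K -> B}).

Definition spec (pi : nat -> B) := mmap f (fun i : 'I_N => pi i.+1).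

HB.instance Definition _ pi := GRing.RMorphism.on (spec pi).

Lemma specC pi c : spec pi c%:MP = f c. Proof. exact: mmapC. Qed.

Lemma specX pi i : spec pi 'X_i = pi i.+1.
Proof. by rewrite /spec mmapX mmap1U. Qed.

Lemma specZ pi c a : spec pi (c *: a) = f c * spec pi a.
Proof. exact: mmapZ. Qed.

Lemma spec_pgen pi k : (0 < k <= N)%N -> spec pi (pgen k) = pi k.
Proof. by case: k => [|k] //= lt_kN; rewrite (pgenE (Ordinal lt_kN)) specX. Qed.

Lemma spec_newton pi : newton N (fun k => spec pi (hgen k)) pi.
Proof.
split=> [|k lt_kN]; first by rewrite rmorph1.
rewrite -(rmorph_nat (spec pi)) -rmorphM (newton_hgen N).2 // rmorph_sum.
by apply: eq_bigr => i _; rewrite rmorphM /= spec_pgen //; have := ltn_ord i; lia.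
Qed.

Lemma rmorph_mpoly_eq (g g' : {rmorphism A -> B}) :
  (forall c, g c%:MP = g' c%:MP) ->
  (forall k, (0 < k <= N)%N -> g (pgen k) = g' (pgen k)) -> g =1 g'.
Proof.
move=> eqC eqX a; rewrite [a]mpolyE !rmorph_sum; apply: eq_bigr => m _.
rewrite -mul_mpolyC !rmorphM eqC mpolyXE_id; congr (_ * _).
by rewrite !rmorph_prod; apply: eq_bigr => i _; rewrite !rmorphXn -pgenE eqX //= ltn_ord.
Qed.

Lemma spec_uniq (g : {rmorphism A -> B}) pi :
  (forall c, g c%:MP = f c) ->
  (forall k, (0 < k <= N)%N -> g (pgen k) = pi k) -> forall a, g a = spec pi a.
Proof.
move=> gC gX; apply: rmorph_mpoly_eq => [c|k kN]; first by rewrite gC /= specC.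
by rewrite gX //= spec_pgen.
Qed.

Lemma eq_spec pi pi' : (forall k, (0 < k <= N)%N -> pi k = pi' k) -> spec pi =1 spec pi'.
Proof.
move=> eq_pi; apply: (spec_uniq (g := spec pi)) => [c|k kN] /=; first exact: specC.
by rewrite spec_pgen // eq_pi.
Qed.

End Spec.

(** The way in which h_k is evaluated throughout: guess the h-series of the specialization and check
    Newton's identities for it. *)
Lemma spec_hgen (B : idomainType) (f : {rmorphism K -> B}) pi c k :
  newton N c pi -> (k <= N)%N -> spec f pi (hgen k) = c k.
Proof. by move=> hc; apply: newton_uniq (natB_neq0 f) (spec_newton f pi) hc _. Qed.

Lemma spec_hgenD (B : idomainType) (f : {rmorphism K -> B}) pi pi' k : (k <= N)%N ->
  spec f (fun k => pi k + pi' k) (hgen k) =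
  \sum_(i < k.+1) spec f pi (hgen i) * spec f pi' (hgen (k - i)).
Proof.
exact: spec_hgen (newton_conv (spec_newton f pi) (spec_newton f pi')).
Qed.

End Ring.

(** * Plethysm and vertex operators *)

Lemma coef_mul_linear (B : comNzRingType) (p : {poly B}) (y : B) k :
  (p * (1 - y *: 'X))`_k.+1 = p`_k.+1 - y * p`_k.
Proof. by rewrite mulrBr mulr1 -scalerAr coefB coefZ coefMX. Qed.

Lemma size_coef_prod_linear (B : comNzRingType) n (y : 'I_n -> B) :
  (size (\prod_i (1 - y i *: 'X))%R <= n.+1)%N /\
  (\prod_i (1 - y i *: 'X))`_n = \prod_i (- y i).
Proof.
elim: n y => [|n IHn] y; first by rewrite !big_ord0 size_poly1 coef1.
have [IHs IHc] := IHn (fun i => y (widen_ord (leqnSn n) i)).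
rewrite !big_ord_recr /= -IHc; set p := \prod_(i < n) _ in IHs *; split.
  apply/leq_sizeP => -[|k] //; rewrite ltnS => le_nk.
  by rewrite coef_mul_linear !(leq_sizeP _ _ IHs) ?mulr0 ?subr0 // ltnW.
by rewrite coef_mul_linear [p`_n.+1](leq_sizeP _ _ IHs) // sub0r mulrN mulrC.
Qed.

Section PartialFraction.
Variables (F : fieldType) (n : nat) (x : 'I_n -> F) (z : F).
Hypotheses (x_inj : injective x) (x_neq0 : forall i, x i != 0).

Definition pfcoef i := \prod_(j | j != i) ((x i - z * x j) / (x i - x j)).

(** Partial fractions of \prod_i (1 - z x_i X) / (1 - x_i X), cleared of denominators. The term z^n
    cancels the coefficient of X^n, so the difference of the two sides has degree below n, and it
    vanishes at the n distinct points x_i^-1. *)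
Lemma partial_fraction :
  \prod_i (1 - (z * x i) *: 'X) = z ^+ n *: \prod_i (1 - x i *: 'X) +
    (1 - z) *: \sum_i pfcoef i *: \prod_(j | j != i) (1 - x j *: 'X).
Proof.
apply/eqP; rewrite -subr_eq0; apply/eqP; set P := _ - _.
have sizeP1 : (size P <= n.+1)%N.
  rewrite /P; apply: leq_trans (size_polyD _ _) _; rewrite size_polyN geq_max (size_coef_prod_linear _).1 /=.
  apply: leq_trans (size_polyD _ _) _; rewrite geq_max; apply/andP; split.
    by apply: leq_trans (size_scale_leq _ _) (size_coef_prod_linear _).1.
  apply: leq_trans (size_scale_leq _ _) _; apply: leq_trans (size_sum _ _ _) _.
  apply/bigmax_leqP => i _; apply: leq_trans (size_scale_leq _ _) _.
  pose x' j := if j == i then 0 else x j.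
  have <- : \prod_j (1 - x' j *: 'X) = \prod_(j | j != i) (1 - x j *: 'X); last exact: (size_coef_prod_linear _).1.
  rewrite [LHS](bigD1 i) //= /x' eqxx scale0r subr0 mul1r.
  by apply: eq_bigr => j /negbTE ->.
have Pn : P`_n = 0.
  have Di i : (\prod_(j | j != i) (1 - x j *: 'X))`_n = 0.
    pose x' j := if j == i then 0 else x j.
    have <- : \prod_j (1 - x' j *: 'X) = \prod_(j | j != i) (1 - x j *: 'X); last first.
      by rewrite (size_coef_prod_linear _).2 (bigD1 i) //= /x' eqxx oppr0 mul0r.
    rewrite [LHS](bigD1 i) //= /x' eqxx scale0r subr0 mul1r.
    by apply: eq_bigr => j /negbTE ->.
  rewrite /P coefB coefD !coefZ coef_sum !(size_coef_prod_linear _).2.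
  rewrite [X in (1 - z) * X]big1 => [|i _]; last by rewrite coefZ Di mulr0.
  rewrite mulr0 addr0.
  rewrite (eq_bigr (fun i => z * - x i)) => [|i _]; last by rewrite mulrN.
  by rewrite big_split /= prodr_const card_ord subrr.
have sizeP : (size P <= n)%N.
  by apply/leq_sizeP => j; rewrite leq_eqVlt => /predU1P[<- // | /(leq_sizeP _ _ sizeP1)].
apply/eqP; apply: contraTT sizeP; rewrite -ltnNge => P_neq0.
have := @max_poly_roots _ P [seq (x i)^-1 | i <- enum 'I_n] P_neq0.
rewrite size_map size_enum_ord; apply; last first.
  by rewrite map_inj_uniq ?enum_uniq // => i j /invr_inj /x_inj.
apply/allP => _ /mapP[i _ ->]; rewrite rootE /P; apply/eqP.
have h1 (a : F) j : (1 - (a * x j) *: 'X).[(x i)^-1] = 1 - a * x j / x i.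
  by rewrite hornerD hornerN hornerZ hornerX hornerC.
have h2 j : (1 - (x j) *: 'X).[(x i)^-1] = 1 - x j / x i.
  by rewrite hornerD hornerN hornerZ hornerX hornerC.
rewrite hornerD hornerN hornerD !hornerZ !horner_prod horner_sum.
rewrite [X in z ^+ n * X](bigD1 i) //= h2 divff // subrr mul0r mulr0 add0r.
rewrite [X in (1 - z) * X](bigD1 i) //= [X in (1 - z) * (_ + X)]big1 => [|k ki]; last first.
  by rewrite hornerZ horner_prod (bigD1 i) 1?eq_sym //= h2 divff // subrr mul0r mulr0.
rewrite addr0 hornerZ horner_prod /pfcoef -big_split /=.
rewrite (bigD1 i) //= h1 mulfK // -mulrBr; apply/eqP; rewrite mulf_eq0 subr_eq0; apply/orP; right.
rewrite subr_eq0; apply/eqP/eq_bigr => j ji; rewrite h1 h2; field.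
by rewrite x_neq0 /= subr_eq0; apply: contra_neq ji => /x_inj ->.
Qed.

End PartialFraction.

Section Ops.
Variables (K : fieldType) (N : nat).
Hypothesis K0 : [pchar K] =i pred0.
Notation A := {mpoly K[N]}.
Notation hgen := (hgen K N).
Notation pgen := (pgen K N).

Lemma spec_spec (B B' : comNzRingType) (f : {rmorphism K -> B}) (pi : nat -> B)
    (g : {rmorphism B -> B'}) (f' : {rmorphism K -> B'}) a :
  (forall c, g (f c) = f' c) ->
  g (spec f pi a : B) = spec f' (fun k => g (pi k)) (a : A).
Proof.
move=> gf; apply: (spec_uniq (g := g \o spec f pi)) => [c|k kN] /=.
  by rewrite specC gf.
by rewrite spec_pgen.
Qed.

Definition theta (z : K) : A -> A := spec (@mpolyC N K) (fun k => (1 - z ^+ k) *: pgen k).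
HB.instance Definition _ z := GRing.RMorphism.on (theta z).

Definition poly_const (c : K) : {poly A} := (c%:MP)%:P.
HB.instance Definition _ := GRing.RMorphism.copy poly_const (polyC \o @mpolyC N K).

(* [tau y] is the plethystic substitution X |-> X - (1 - y) u, where u is the
   polynomial variable. *)
Definition tau (y : K) : A -> {poly A} :=
  spec poly_const (fun k => (pgen k)%:P - poly_const (1 - y ^+ k) * 'X^k).
HB.instance Definition _ y := GRing.RMorphism.on (tau y).

(* Coefficient of a vertex operator.  With r = 0, z = q and y = t this is
   Macdonald's operator; with y = 0 it adds a row of length r to a
   Hall-Littlewood function with parameter z. *)
Definition vertex (z y : K) r (a : A) : A :=
  \sum_(k < N.+1) theta z (hgen (r + k)) * (tau y a)`_k.

Lemma thetaC z c : theta z c%:MP = c%:MP.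
Proof. exact: specC. Qed.

Lemma thetaZ z c a : theta z (c *: a) = c *: theta z a.
Proof. by rewrite /theta specZ mul_mpolyC. Qed.

Lemma theta_pgen z k : (0 < k <= N)%N -> theta z (pgen k) = (1 - z ^+ k) *: pgen k.
Proof. exact: spec_pgen. Qed.

Lemma tauZ y c a : tau y (c *: a) = c%:MP *: tau y a.
Proof. by rewrite /tau specZ /poly_const mul_polyC. Qed.

Lemma vertexZ z y r c a : vertex z y r (c *: a) = c *: vertex z y r a.
Proof.
rewrite /vertex scaler_sumr; apply: eq_bigr => k _.
by rewrite tauZ coefZ mulrCA mul_mpolyC.
Qed.

Lemma vertexD z y r a b : vertex z y r (a + b) = vertex z y r a + vertex z y r b.
Proof.
rewrite /vertex -big_split; apply: eq_bigr => k _ /=.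
by rewrite rmorphD coefD mulrDr.
Qed.

Section Phi.
Variables (B : comNzRingType) (f : {rmorphism K -> B}).

Definition phi n (x : 'I_n -> B) : A -> B := spec f (fun k => \sum_i x i ^+ k).
HB.instance Definition _ n (x : 'I_n -> B) := GRing.RMorphism.on (phi x).

Lemma phiZ n (x : 'I_n -> B) c a : phi x (c *: a) = f c * phi x a.
Proof. exact: specZ. Qed.

Lemma phi_theta n (x : 'I_n -> B) z a :
  phi x (theta z a) = spec f (fun k => (1 - f z ^+ k) * \sum_i x i ^+ k) a.
Proof.
rewrite (spec_spec _ _ (f' := f)) /= => [|c]; last by rewrite /phi specC.
apply: eq_spec => k kN; rewrite /phi /= specZ spec_pgen //.
by rewrite rmorphB rmorph1 rmorphXn.
Qed.

End Phi.

(** Each factor 1 - x_i X cancels the contribution of x_i to the h-series. *)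
Lemma phi_conv_prod (F : idomainType) (f : {rmorphism K -> F}) n (x : 'I_n -> F) (P : pred 'I_n) k :
  (k <= N)%N ->
  \sum_(j < k.+1) phi f x (hgen j) * (\prod_(i | P i) (1 - x i *: 'X))`_(k - j) =
  spec f (fun k => \sum_(i | ~~ P i) x i ^+ k) (hgen k).
Proof.
move=> le_kN; have h := newton_conv (spec_newton N K0 f (fun k => \sum_i x i ^+ k))
  (newton_prod N (index_enum 'I_n) P x).
rewrite -[LHS](spec_hgen K0 f h) //; apply: eq_spec => j _.
by rewrite [X in X - _](bigID P) /= [X in X - _]addrC addrK.
Qed.

Lemma phi_theta_hgen (F : fieldType) (f : {rmorphism K -> F}) n (x : 'I_n -> F) z k :
  injective x -> (forall i, x i != 0) -> (k <= N)%N ->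
  phi f x (theta z (hgen k)) = f z ^+ n * (k == 0%N)%:R +
     (1 - f z) * \sum_i pfcoef x (f z) i * x i ^+ k.
Proof.
move=> x_inj x0 le_kN; rewrite phi_theta.
have h := newton_conv (spec_newton N K0 f (fun k => \sum_i x i ^+ k))
  (newton_prod N (index_enum 'I_n) predT (fun i => f z * x i)).
rewrite (eq_spec _ (pi' := fun k => \sum_i x i ^+ k + - \sum_i (f z * x i) ^+ k)); last first.
  move=> j _; rewrite mulrBl mul1r mulr_sumr; congr (_ - _).
  by apply: eq_bigr => i _; rewrite exprMn.
rewrite (spec_hgen K0 f h le_kN) /conv partial_fraction //.
under [LHS]eq_bigr => j _ do rewrite coefD !coefZ coef_sum mulrDr mulrCA [in X in _ + X]mulrCA.
rewrite big_split /= -!mulr_sumr; congr (_ * _ + _ * _).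
  rewrite phi_conv_prod // (eq_spec _ (pi' := fun=> 0)) => [|j _]; last by rewrite big_pred0.
  by rewrite (spec_hgen K0 f (newton_one F N)) // coef1.
under [LHS]eq_bigr => j _ do rewrite mulr_sumr.
rewrite exchange_big /=; apply: eq_bigr => i _.
under [LHS]eq_bigr => j _ do rewrite coefZ mulrCA.
rewrite -mulr_sumr phi_conv_prod //; congr (_ * _).
rewrite (eq_spec _ (pi' := fun k => x i ^+ k)) => [|j _]; last first.
  by rewrite (eq_bigl (pred1 i)) ?big_pred1_eq // => l; rewrite negbK.
exact: spec_hgen (newton_geom _ _) _.
Qed.

Lemma horner_tau (B : comNzRingType) (f : {rmorphism K -> B}) (pi : nat -> B) y a (u : B) :
  (map_poly (spec f pi) (tau y a)).[u] =
  spec f (fun k => pi k - (1 - f y ^+ k) * u ^+ k) a.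
Proof.
have h := @spec_spec _ _ poly_const (fun k => (pgen k)%:P - poly_const (1 - y ^+ k) * 'X^k)
  (horner_eval u \o map_poly (spec f pi : A -> B)) f a.
rewrite -[LHS]/((horner_eval u \o map_poly (spec f pi : A -> B)) (tau y a)) /tau h => [|c]; last first.
  by rewrite /= /poly_const map_polyC /= /horner_eval hornerC specC.
apply: eq_spec => k kN; rewrite /= /horner_eval rmorphB rmorphM /= map_polyXn /poly_const !map_polyC /=.
rewrite hornerD hornerN hornerM hornerXn !hornerC spec_pgen // specC.
by rewrite rmorphB rmorph1 rmorphXn.
Qed.

Definition subst1 n (B : Type) (x : 'I_n -> B) i u : 'I_n -> B :=
  fun j => if j == i then u else x j.

Lemma phi_vertex (F : fieldType) (f : {rmorphism K -> F}) n (x : 'I_n -> F) z y r a :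
  injective x -> (forall i, x i != 0) ->
  (forall k, (N < r + k)%N -> (tau y a)`_k = 0) ->
  phi f x (vertex z y r a) = f z ^+ n * (r == 0%N)%:R * phi f x a +
    (1 - f z) * \sum_i pfcoef x (f z) i * x i ^+ r * phi f (subst1 x i (f y * x i)) a.
Proof.
move=> x_inj x0 a_bound; rewrite /vertex rmorph_sum /=.
pose R := map_poly (phi f x) (tau y a).
have sizeR : (size R <= N.+1)%N.
  apply/leq_sizeP => j lt_Nj; rewrite coef_map /= a_bound ?rmorph0 //.
  by apply: leq_trans lt_Nj (leq_addl _ _).
have Rh u : R.[u] = \sum_(k < N.+1) R`_k * u ^+ k by apply: horner_coef_wide.
have R0 : R`_0 = phi f x a.
  rewrite -horner_coef0 horner_tau; apply: eq_spec => k /andP[k_gt0 _].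
  by rewrite expr0n eqn0Ngt k_gt0 mulr0 subr0.
have Ri i : R.[x i] = phi f (subst1 x i (f y * x i)) a.
  rewrite horner_tau; apply: eq_spec => k _.
  rewrite (bigD1 i) //= [RHS](bigD1 i) //= /subst1 eqxx exprMn.
  have -> : \sum_(j < n | j != i) (if j == i then f y * x i else x j) ^+ k = \sum_(j | j != i) x j ^+ k.
    by apply: eq_bigr => j /negbTE ->.
  by ring.
transitivity (\sum_(k < N.+1) (f z ^+ n * (r + k == 0)%N%:R +
     (1 - f z) * \sum_i pfcoef x (f z) i * x i ^+ (r + k)) * R`_k).
  apply: eq_bigr => k _; rewrite rmorphM /= /R coef_map.
  have [le_rk|lt_rk] := leqP (r + k) N; first by rewrite phi_theta_hgen.
  by rewrite a_bound //= rmorph0 !mulr0.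
under [LHS]eq_bigr => k _ do rewrite mulrDl.
rewrite big_split /=; congr (_ + _).
  rewrite -R0 big_ord_recl addn0 big1 ?addr0 // => k _.
  by rewrite addnS mulr0 mul0r.
under [LHS]eq_bigr => k _ do rewrite -mulrA mulr_suml.
rewrite -mulr_sumr exchange_big /=; congr (_ * _); apply: eq_bigr => i _.
rewrite -Ri Rh mulr_sumr; apply: eq_bigr => k _.
by rewrite exprD; ring.
Qed.

(** The coefficients of (1 - X) / (1 - y X), that is, h_j of the alphabet y - 1. *)
Definition wcoef (y : K) j : K := if j is j'.+1 then y ^+ j - y ^+ j' else 1.

Lemma spec_wcoef y j : (j <= N)%N ->
  spec poly_const (fun k => - (poly_const (1 - y ^+ k) * 'X^k)) (hgen j) = poly_const (wcoef y j) * 'X^j.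
Proof.
move=> le_jN; have h := newton_conv (newton_geom N (poly_const y * 'X)) (newton_linear N ('X : {poly A})).
rewrite -[LHS](eq_spec _ (pi := fun k => (poly_const y * 'X) ^+ k + - 'X^k)); last first.
  by move=> k _; rewrite rmorphB rmorph1 rmorphXn exprMn; ring.
rewrite (spec_hgen K0 poly_const h le_jN) /conv.
have co k : (1 - 'X *: 'X : {poly {poly A}})`_k = (k == 0%N)%:R - 'X * (k == 1%N)%:R.
  by rewrite coefB coef1 coefZ coefX.
under [LHS]eq_bigr => i _ do rewrite co.
case: j {le_jN} => [|j]; first by rewrite big_ord1 /= mulr0 subr0 !expr0 !mulr1 rmorph1.
rewrite !big_ord_recr /= big1 => [|i _]; last first.
  have -> : (j.+1 - i == 0)%N = false by have := ltn_ord i; lia.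
  have -> : (j.+1 - i == 1)%N = false by have := ltn_ord i; lia.
  by rewrite mulr0 subr0 mulr0.
rewrite subSnn subnn /= rmorphB !rmorphXn !exprMn /= !exprS; ring.
Qed.

Lemma tau_hgen y b : (b <= N)%N ->
  tau y (hgen b) = \sum_(j < b.+1) poly_const (wcoef y j) * 'X^j * (hgen (b - j))%:P.
Proof.
move=> le_bN; rewrite /tau.
rewrite (eq_spec _ (pi' := fun k => - (poly_const (1 - y ^+ k) * 'X^k) + (pgen k)%:P)); last first.
  by move=> k _; rewrite addrC.
rewrite (spec_hgenD K0) //; apply: eq_bigr => j _.
have le_jN : (j <= N)%N by apply: leq_trans le_bN; rewrite -ltnS.
rewrite (spec_wcoef y le_jN); congr (_ * _).
by apply/esym/(@spec_uniq _ _ _ poly_const polyC (fun k => (pgen k)%:P)).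
Qed.

End Ops.

(** * Homogeneous bases *)

Section Span.
Variables (K : fieldType) (V : lmodType K) (I : finType).
Implicit Types (P Q : pred I) (a b : I -> V) (v w : V).

Definition lspan P a v := exists c : I -> K, v = \sum_(i | P i) c i *: a i.
Definition lfree a := forall c : I -> K, \sum_i c i *: a i = 0 -> forall i, c i = 0.

Lemma lspan0 P a : lspan P a 0.
Proof. by exists (fun=> 0); rewrite big1 // => i _; rewrite scale0r. Qed.

Lemma lspanD P a v w : lspan P a v -> lspan P a w -> lspan P a (v + w).
Proof.
move=> [c ->] [c' ->]; exists (fun i => c i + c' i); rewrite -big_split /=.
by apply: eq_bigr => i _; rewrite scalerDl.
Qed.

Lemma lspanZ P a x v : lspan P a v -> lspan P a (x *: v).
Proof.
move=> [c ->]; exists (fun i => x * c i); rewrite scaler_sumr.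
by apply: eq_bigr => i _; rewrite scalerA.
Qed.

Lemma lspanN P a v : lspan P a v -> lspan P a (- v).
Proof. by rewrite -scaleN1r; apply: lspanZ. Qed.

Lemma lspan_sum P a (J : Type) (r : seq J) (Q : pred J) (F : J -> V) :
  (forall j, Q j -> lspan P a (F j)) -> lspan P a (\sum_(j <- r | Q j) F j).
Proof. by move=> h; elim/big_ind: _ => //; [apply: lspan0 | apply: lspanD]. Qed.

Lemma lspan_mem P a i : P i -> lspan P a (a i).
Proof.
move=> Pi; exists (fun j => (j == i)%:R).
rewrite (bigD1 i) //= eqxx scale1r big1 ?addr0 // => j /andP[_ /negbTE ->].
by rewrite scale0r.
Qed.

Lemma lspan_trans P Q a b v :
  lspan P a v -> (forall i, P i -> lspan Q b (a i)) -> lspan Q b v.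
Proof. by move=> [c ->] h; apply: lspan_sum => i Pi; apply/lspanZ/h. Qed.

Lemma lspan_sub P Q a v : (forall i, P i -> Q i) -> lspan P a v -> lspan Q a v.
Proof. by move=> PQ h; apply: lspan_trans h _ => i Pi; apply/lspan_mem/PQ. Qed.

Lemma lfree_uniq a (c c' : I -> K) :
  lfree a -> \sum_i c i *: a i = \sum_i c' i *: a i -> c =1 c'.
Proof.
move=> fa eq_s i; apply/eqP; rewrite -subr_eq0; apply/eqP.
apply: (fa (fun i => c i - c' i)); apply/eqP.
under eq_bigr => j _ do rewrite scalerBl.
by rewrite sumrB subr_eq0 eq_s.
Qed.

(* A square coefficient matrix whose rows are independent is invertible. *)
Lemma lspan_swapT a b : (forall i, lspan predT a (b i)) -> lfree b ->
  (forall i, lspan predT b (a i)) /\ lfree a.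
Proof.
move=> ba fb; pose k := #|I|; pose e (i : 'I_k) : I := enum_val i.
pose cf i : I -> K := epsilon (inhabits (fun=> 0)) (fun c => b i = \sum_(j | predT j) c j *: a j).
have cfE i : b i = \sum_(j | predT j) cf i j *: a j by exact: (epsilon_spec _ _ (ba i)).
have reE (F : I -> V) : \sum_(j | predT j) F j = \sum_(j < k) F (e j).
  by rewrite (reindex_onto e enum_rank) => [|i _]; rewrite /e ?enum_rankK //;
    apply: eq_bigl => i; rewrite enum_valK eqxx.
pose M := \matrix_(i < k, j < k) cf (e i) (e j).
have bM (u : 'rV_k) : \sum_i u 0 i *: b (e i) = \sum_j (u *m M) 0 j *: a (e j).
  under [LHS]eq_bigr => i _ do rewrite cfE reE scaler_sumr.
  rewrite exchange_big; apply: eq_bigr => j _; rewrite mxE scaler_suml.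
  by apply: eq_bigr => i _; rewrite mxE scalerA.
have Munit : M \in unitmx.
  rewrite -row_free_unit; apply: inj_row_free => u uM.
  have : \sum_i u 0 (enum_rank i) *: b i = 0.
    rewrite [LHS](reE (fun i => u 0 (enum_rank i) *: b i)).
    transitivity (\sum_i u 0 i *: b (e i)); first by apply: eq_bigr => i _; rewrite enum_valK.
    by rewrite bM uM big1 // => j _; rewrite mxE scale0r.
  move/fb => u0; apply/rowP => i; rewrite mxE -[i]enum_valK; exact: u0.
have aE i : a i = \sum_j invmx M (enum_rank i) j *: b (e j).
  transitivity (\sum_j row (enum_rank i) (invmx M) 0 j *: b (e j)).
    rewrite bM -row_mul mulVmx // (bigD1 (enum_rank i)) //= big1 => [|j ji].
      by rewrite !mxE eqxx scale1r addr0 /e enum_rankK.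
    by rewrite !mxE eq_sym (negbTE ji) scale0r.
  by apply: eq_bigr => j _; rewrite mxE.
split=> [i|c].
  exists (fun j => invmx M (enum_rank i) (enum_rank j)).
  by rewrite reE aE; apply: eq_bigr => j _; rewrite enum_valK.
pose u := \row_j c (e j) : 'rV_k.
have [v vE] : exists v : 'rV_k, u = v *m M by exists (u *m invmx M); rewrite mulmxKV.
rewrite [LHS](reE (fun i => c i *: a i)) => ca0.
have : \sum_j (v *m M) 0 j *: a (e j) = 0.
  by rewrite -vE -[RHS]ca0; apply: eq_bigr => j _; rewrite mxE.
rewrite -bM => vb0 i.
have v0 : v = 0.
  apply/rowP => j; rewrite [RHS]mxE -[j]enum_valK.
  apply: (fb (fun i => v 0 (enum_rank i))); rewrite [LHS](reE (fun i => v 0 (enum_rank i) *: b i)).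
  by rewrite -[RHS]vb0; apply: eq_bigr => l _; rewrite enum_valK.
have : u 0 (enum_rank i) = 0 by rewrite vE v0 mul0mx mxE.
by rewrite mxE /e enum_rankK.
Qed.

(** Reduction to [lspan_swapT]: outside P the family a is replaced by b. An expansion of a_i in b
    then has no terms outside P, since these would give a relation in the free family [a']. *)
Lemma lspan_swap P a b : (forall i, P i -> lspan P a (b i)) -> lfree b ->
  forall i, P i -> lspan P b (a i).
Proof.
move=> ba fb; pose a' i := if P i then a i else b i.
have a'P i : P i -> a' i = a i by rewrite /a' => ->.
have ba' i : P i -> lspan P a' (b i).
  by move/ba => [c ->]; exists c; apply: eq_bigr => j Pj; rewrite a'P.
have [|a'b fa'] := @lspan_swapT a' b _ fb.
  move=> i; case Pi: (P i); first by apply: lspan_sub (ba' i Pi).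
  have -> : b i = a' i by rewrite /a' Pi.
  exact: lspan_mem.
move=> i Pi; have [c Ec] := a'b i.
have [c' Ec'] : lspan P a' (\sum_(j | P j) c j *: b j).
  by apply: lspan_sum => j Pj; apply/lspanZ/ba'.
have c0 j : ~~ P j -> c j = 0.
  move=> nPj; pose g l := if P l then c' l - (l == i)%:R else c l.
  suff : g j = 0 by rewrite /g (negbTE nPj).
  apply: fa'; rewrite /g (bigID P) /=.
  have -> : \sum_(l | P l) (if P l then c' l - (l == i)%:R else c l) *: a' l
      = \sum_(l | P l) c l *: b l - a' i.
    have -> : a' i = \sum_(l | P l) (l == i)%:R *: a' l.
      rewrite (bigD1 i) //= eqxx scale1r big1 ?addr0 // => l /andP[_ /negbTE ->].
      by rewrite scale0r.
    rewrite Ec'.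
    by rewrite -sumrB; apply: eq_bigr => l Pl; rewrite Pl scalerBl.
  rewrite Ec [X in _ - X](bigID P) /= opprD addrA subrr sub0r.
  rewrite -sumrN -big_split big1 //= => l nPl.
  by rewrite /a' (negbTE nPl) addNr.
exists c; rewrite -(a'P i Pi) Ec (bigID P) /= [X in _ + X]big1 ?addr0 // => j nPj.
by rewrite c0 // scale0r.
Qed.

End Span.

Section Basis.
Variables (K : fieldType) (N : nat).
Hypothesis K0 : [pchar K] =i pred0.
Notation A := {mpoly K[N]}.
Notation hgen := (hgen K N).
Notation pgen := (pgen K N).

Lemma prod_part (B : comNzRingType) (g : nat -> B) n d (mu : intpart d) :
  g 0%N = 1 -> (plen mu <= n)%N -> \prod_(i < n) g (part mu i) = \prod_(i < d) g (part mu i).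
Proof.
move=> g0 le_n; have g1 i : (plen mu <= i)%N -> g (part mu i) = 1.
  by rewrite leq_plen => /eqP ->.
by rewrite (@big_widen0 _ _ _ (fun i => g (part mu i)) _ _ le_n g1)
  (@big_widen0 _ _ _ (fun i => g (part mu i)) _ _ (plen_le mu) g1).
Qed.

Lemma prod_sort_part (B : comNzRingType) (g : nat -> B) n d (al : 'I_n -> nat) (mu : intpart d)
    (s : 'S_n) : g 0%N = 1 ->
  (forall i : 'I_n, part mu i = al (s i)) -> (forall i, (n <= i)%N -> part mu i = 0%N) ->
  \prod_(i < n) g (al i) = \prod_(i < d) g (part mu i).
Proof.
move=> g0 Es mu0; rewrite -(@prod_part _ _ n) //; last by rewrite leq_plen mu0.
by rewrite (reindex_inj (@perm_inj _ s)) /=; apply: eq_bigr => i _; rewrite Es.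
Qed.

Definition hp d (mu : intpart d) : A := \prod_(i < d) hgen (part mu i).
Definition pm d (rho : intpart d) : 'X_{1..N} := [multinom mult rho i.+1 | i < N].
Definition pp d (rho : intpart d) : A := 'X_[pm rho].

Notation hspan := (fun d => lspan predT (@hp d)).

Lemma hspan_prod n d (al : 'I_n -> nat) : (\sum_i al i)%N = d ->
  hspan d (\prod_i hgen (al i)).
Proof.
move=> /sort_part[mu [s [Es mu0]]]; rewrite (prod_sort_part _ Es mu0) //.
exact: lspan_mem.
Qed.

Lemma hspanM d e a b : hspan d a -> hspan e b -> hspan (d + e)%N (a * b).
Proof.
move=> [c ->] [c' ->]; rewrite mulr_suml; apply: lspan_sum => mu _.
rewrite mulr_sumr; apply: lspan_sum => nu _; rewrite -scalerAl -scalerAr scalerA.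
apply: lspanZ; rewrite /hp.
pose al (i : 'I_(d + e)) := match split i with inl j => part mu j | inr j => part nu j end.
have El (j : 'I_d) : al (lshift e j) = part mu j by rewrite /al (unsplitK (inl j)).
have Er (j : 'I_e) : al (rshift d j) = part nu j by rewrite /al (unsplitK (inr j)).
have := @hspan_prod _ (d + e) al; rewrite big_split_ord /=.
under eq_bigr => j _ do rewrite El.
under [X in (_ + X)%N]eq_bigr => j _ do rewrite Er.
rewrite !sum_part // big_split_ord /=.
under [X in lspan _ _ (X * _)]eq_bigr => j _ do rewrite El.
under [X in lspan _ _ (_ * X)]eq_bigr => j _ do rewrite Er.
exact.
Qed.

Lemma hspan1 : hspan 0%N 1.
Proof. by have := @hspan_prod 0 0 (fun=> 0%N); rewrite !big_ord0; apply. Qed.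

Lemma hspan_hgen k : hspan k (hgen k).
Proof. by have := @hspan_prod 1 k (fun=> k); rewrite !big_ord1; apply. Qed.

Lemma hspan_pgen k : (0 < k)%N -> hspan k (pgen k).
Proof.
elim/ltn_ind: k => -[|k] // IHk _.
have -> : pgen k.+1 = k.+1%:R *: hgen k.+1 - \sum_(i < k) pgen i.+1 * hgen (k - i).
  by rewrite hgenS // big_ord_recr /= subnn hgen0 mulr1 addrC addrK.
apply: lspanD; first exact/lspanZ/hspan_hgen.
apply/lspanN/lspan_sum => i _.
have -> : k.+1 = (i.+1 + (k - i))%N by have := ltn_ord i; lia.
by apply: hspanM (hspan_hgen _); apply: IHk => //; rewrite ltnS.
Qed.

Lemma ppE d (rho : intpart d) : (d <= N)%N ->
  pp rho = \prod_(i < d) (if part rho i == 0%N then 1 else pgen (part rho i)).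
Proof.
move=> le_dN; rewrite /pp mpolyXE_id.
under eq_bigr => i _ do rewrite mnmE mult_sum // -pgenE.
transitivity (\prod_(i < N) \prod_(j < d) pgen i.+1 ^+ (part rho j == i.+1)).
  by apply: eq_bigr => i _; elim/big_rec2: _ => [|j a b _]; rewrite ?expr0 // => <-; rewrite exprD.
rewrite exchange_big /=; apply: eq_bigr => j _; case: eqP => [-> | /eqP].
  by rewrite big1 // => i _; rewrite expr0.
rewrite -lt0n => rj0; have lt_N : ((part rho j).-1 < N)%N.
  by rewrite (leq_trans _ le_dN) // prednK // part_le.
rewrite (bigD1 (Ordinal lt_N)) //= prednK // eqxx expr1 big1 ?mulr1 // => i.
rewrite -val_eqE /= => ni; have -> : (part rho j == i.+1) = false by lia.
by rewrite expr0.
Qed.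

Lemma hspan_pp d (rho : intpart d) : (d <= N)%N -> hspan d (pp rho).
Proof.
move=> le_dN; rewrite ppE //; have key k : hspan (\sum_(i < k) part rho i)%N
    (\prod_(i < k) (if part rho i == 0%N then 1 else pgen (part rho i))).
  elim: k => [|k IHk]; first by rewrite !big_ord0; apply: hspan1.
  rewrite !big_ord_recr /=; apply: hspanM IHk _.
  by case: (part rho k) => [|r] /=; [apply: hspan1 | apply: hspan_pgen].
by have := key d; rewrite (sum_part rho (leqnn d)).
Qed.

Lemma pm_inj d : (d <= N)%N -> injective (@pm d).
Proof.
move=> le_dN la mu eq_pm; apply: conj_inj; apply: partP => j.
have Ec (rho : intpart d) : part (conjp rho) j = (\sum_(i < N | (j <= i)%N) pm rho i)%N.
  rewrite part_conj /cpart; under [RHS]eq_bigr => i _ do rewrite mnmE mult_sum //.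
  rewrite exchange_big /=; apply: eq_bigr => k _; case: ltnP => [lt_j|le_j].
    have lt_N : ((part rho k).-1 < N)%N.
      by rewrite (leq_trans _ le_dN) // (leq_trans _ (part_le rho k)) // prednK //; lia.
    rewrite (bigD1 (Ordinal lt_N)) /=; last by lia.
    rewrite prednK ?eqxx ?big1 //; last by lia.
    by move=> i /andP[_ ]; rewrite -val_eqE /= => /eqP ni; apply/eqP; rewrite eqb0; apply/eqP; lia.
  by rewrite big1 // => i le_ji; apply/eqP; rewrite eqb0; apply/eqP; lia.
by rewrite !Ec eq_pm.
Qed.

Lemma pp_coef d (rho si : intpart d) : (d <= N)%N -> (pp rho)@_(pm si) = (rho == si)%:R.
Proof. by move=> le_dN; rewrite mcoeffX (inj_eq (pm_inj le_dN)). Qed.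

Lemma lfree_pp d : (d <= N)%N -> lfree (@pp d).
Proof.
move=> le_dN c c0 si; have /(congr1 (mcoeff (pm si))) := c0.
rewrite mcoeff0 raddf_sum /= (bigD1 si) //= mcoeffZ pp_coef // eqxx mulr1 big1 ?addr0 // => i ni.
by rewrite mcoeffZ pp_coef // (negbTE ni) mulr0.
Qed.

(** The p_rho lie in the span of the h_mu and are distinct monomials, hence independent; as both
    families have the same index set, each spans the other. *)
Lemma hp_span_pp d (mu : intpart d) : (d <= N)%N -> lspan predT (@pp d) (hp mu).
Proof.
move=> le_dN; have [h _] := lspan_swapT (fun rho : intpart d => hspan_pp rho le_dN) (lfree_pp le_dN).
exact: h.
Qed.

Lemma lfree_hp d : (d <= N)%N -> lfree (@hp d).
Proof.
move=> le_dN; by have [] := lspan_swapT (fun rho : intpart d => hspan_pp rho le_dN) (lfree_pp le_dN).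
Qed.

Lemma hspanE d a : (d <= N)%N -> hspan d a -> a = \sum_(rho : intpart d) a@_(pm rho) *: pp rho.
Proof.
move=> le_dN ha; have [c Ec] : lspan predT (@pp d) a.
  by apply: lspan_trans ha _ => mu _; apply: hp_span_pp.
rewrite {1}Ec; apply: eq_bigr => rho _; congr (_ *: _).
rewrite Ec raddf_sum /= (bigD1 rho) //= mcoeffZ pp_coef // eqxx mulr1 big1 ?addr0 // => i ni.
by rewrite mcoeffZ pp_coef // (negbTE ni) mulr0.
Qed.

Lemma hspan_coef d a : (d <= N)%N -> hspan d a ->
  (forall rho : intpart d, a@_(pm rho) = 0) -> a = 0.
Proof. by move=> le_dN /hspanE E h; rewrite E // big1 // => rho _; rewrite h scale0r. Qed.

End Basis.

(** * The Hall scalar product *)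

Lemma mcoeffMX_sub (R : comNzRingType) n (g : {mpoly R[n]}) m k :
  (g * 'X_[m])@_k = if (m <= k)%MM then g@_(k - m) else 0.
Proof.
case: ifP => [le_mk | nle]; first by rewrite -{1}(submK le_mk) addmC mcoeffMX.
apply/eqP; rewrite mcoeff_eq0 (perm_mem (msuppMX _ _)); apply/negP => /mapP[m' _ Ek].
by rewrite Ek lem_addr in nle.
Qed.

Lemma mderiv_prod (R : comNzRingType) N (i : 'I_N) n (F : 'I_n -> {mpoly R[N]}) :
  (\prod_k F k)^`M(i) = \sum_j \prod_k (if k == j then (F k)^`M(i) else F k).
Proof.
elim: n F => [|n IHn] F; first by rewrite !big_ord0 -mpolyC1 mderivC.
rewrite !big_ord_recr /= mderivM IHn mulr_suml; congr (_ + _).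
  apply: eq_bigr => j _; rewrite big_ord_recr /=; congr (_ * _).
    by rewrite -val_eqE /= gtn_eqF // ltn_ord.
rewrite eqxx; congr (_ * _); apply: eq_bigr => k _.
by rewrite -val_eqE /= ltn_eqF // ltn_ord.
Qed.

Section Pairing.
Variables (K : fieldType) (N : nat).
Hypothesis K0 : [pchar K] =i pred0.
Notation A := {mpoly K[N]}.
Notation hgen := (hgen K N).
Notation pgen := (pgen K N).
Notation hspan := (fun d => lspan predT (@hp K N d)).
Notation hp := (@hp K N _).
Notation pp := (@pp K N _).
Notation pm := (@pm N _).

(* k d/dp_k for k = i + 1, the adjoint of multiplication by p_k *)
Definition dp (i : 'I_N) (a : A) : A := i.+1%:R *: a^`M(i).

Lemma dp_sum i (I : Type) (r : seq I) (P : pred I) (F : I -> A) :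
  dp i (\sum_(j <- r | P j) F j) = \sum_(j <- r | P j) dp i (F j).
Proof. by rewrite /dp [(\sum_(j <- r | P j) F j)^`M(i)]raddf_sum scaler_sumr. Qed.

Lemma dpZ i c a : dp i (c *: a) = c *: dp i a.
Proof. by rewrite /dp mderivZ !scalerA mulrC. Qed.

Lemma dpM i a b : dp i (a * b) = dp i a * b + a * dp i b.
Proof. by rewrite /dp mderivM scalerDr scalerAl -scalerAr. Qed.

Lemma dp_pgen i k : dp i (pgen k) = (i.+1 == k)%:R * i.+1%:R.
Proof.
rewrite /(pgen _) dp_sum.
have E j : dp i 'X_j = (i == j)%:R * i.+1%:R.
  rewrite /dp mderivX mnm1E eq_sym; case: eqP => [->|_].
    have -> : (U_(j) - U_(j))%MM = 0%MM :> 'X_{1..N} by apply/mnmP => l; rewrite mnmBE subnn mnm0E.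
    by rewrite mpolyX0 scale1r mul1r scaler_nat.
  by rewrite scale0r scaler0 mul0r.
under eq_bigr => j _ do rewrite E.
have [Ek|nk] := eqVneq i.+1 k.
  rewrite (bigD1 i) ?Ek //= eqxx big1 ?addr0 ?Ek // => j /andP[_ /negbTE ji].
  by rewrite eq_sym ji mul0r.
rewrite big1 ?mul0r // => j /eqP Ej; case: eqP => [Eij|_]; last by rewrite mul0r.
by rewrite Eij Ej eqxx in nk.
Qed.

(** Induction through Newton's recursion for k + 1: the explicit power sum contributes i + 1 copies
    of h_(k - i), and the induction hypothesis, summed again by Newton, the remaining k - i
    copies. *)
Lemma dp_hgen i k : dp i (hgen k) = if (i < k)%N then hgen (k - i.+1) else 0.
Proof.
elim/ltn_ind: k => -[|k] IHk; first by rewrite hgen0 /dp -mpolyC1 mderivC scaler0.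
apply: (@scalerI _ _ (k.+1%:R : K)); first exact: natK_neq0.
rewrite -dpZ hgenS // dp_sum.
under eq_bigr => j _ do rewrite dpM dp_pgen.
rewrite big_split /=.
have -> : \sum_(j < k.+1) (i.+1 == j.+1)%:R * i.+1%:R * hgen (k - j)
    = if (i <= k)%N then i.+1%:R *: hgen (k - i) else 0.
  case: leqP => [le_ik|lt_ki].
    rewrite (bigD1 (Ordinal (le_ik : i < k.+1)%N)) //= eqxx mul1r big1 ?addr0 => [|j].
      by rewrite mulr_natl scaler_nat.
    by rewrite -val_eqE /= eqSS eq_sym => /negbTE ->; rewrite !mul0r.
  rewrite big1 // => j _; rewrite eqSS; case: eqP => [Eij|_]; last by rewrite !mul0r.
  by have := ltn_ord j; lia.
have -> : \sum_(j < k.+1) pgen j.+1 * dp i (hgen (k - j))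
    = if (i <= k)%N then (k - i)%:R *: hgen (k - i) else 0.
  under eq_bigr => j _ do rewrite IHk ?ltnS ?leq_subr //.
  rewrite (@big_widen0 _ _ _ (fun j => pgen j.+1 * (if (i < k - j)%N then hgen (k - j - i.+1) else 0)) (k - i)%N).
  - case: leqP => [le_ik|lt_ki]; last by have -> : (k - i = 0)%N; [lia | rewrite big_ord0].
    case E: (k - i)%N => [|l]; first by rewrite big_ord0 scale0r.
    rewrite hgenS //; apply: eq_bigr => j _; have := ltn_ord j => lt_j.
    have -> : (i < k - j)%N by lia.
    by congr (_ * hgen _); lia.
  - lia.
  - by move=> j le_j; case: ifP; rewrite ?mulr0 //; lia.
rewrite ltnS subSS; case: leqP => [le_ik|_]; last by rewrite addr0 scaler0.
by rewrite -scalerDl -natrD; congr (_%:R *: _); lia.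
Qed.

Lemma hgen_coef0 k : (hgen k)@_0%MM = (k == 0%N)%:R.
Proof.
case: k => [|k]; first by rewrite hgen0 mcoeff1 eqxx.
apply: (mulfI (natK_neq0 K0 k)); rewrite -mcoeffZ hgenS // mulr0 raddf_sum big1 // => j _.
have h : multiplicative (mcoeff 0%MM : A -> K) by exact: mcoeff0_is_multiplicative.
rewrite /= h.1 /(pgen _) raddf_sum big1 ?mul0r // => l _.
by rewrite /= mcoeffX mnm1_eq0.
Qed.

(** The classical z_rho, for rho given by its multiplicities. *)
Definition zed (m : 'X_{1..N}) : K := \prod_(i < N) (i.+1%:R ^+ m i * (m i)`!%:R).

Lemma zed_neq0 m : zed m != 0.
Proof.
apply/prodf_neq0 => i _; rewrite mulf_neq0 ?expf_neq0 ?natK_neq0 //.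
by rewrite -(prednK (fact_gt0 _)) natK_neq0.
Qed.

Lemma zed0 : zed 0%MM = 1.
Proof. by rewrite /zed big1 // => i _; rewrite mnm0E expr0 fact0 mulr1. Qed.

Lemma zedDU m i : zed (m + U_(i)) = zed m * (i.+1%:R * (m i).+1%:R).
Proof.
rewrite /zed (bigD1 i) //= [in RHS](bigD1 i) //= mnmDE mnm1E eqxx addn1 exprS factS natrM.
have -> : \prod_(j | j != i) (j.+1%:R ^+ (m + U_(i))%MM j * ((m + U_(i))%MM j)`!%:R)
     = \prod_(j | j != i) (j.+1%:R ^+ m j * (m j)`!%:R) :> K.
  by apply: eq_bigr => j ji; rewrite mnmDE mnm1E eq_sym (negbTE ji) addn0.
ring.
Qed.

Lemma mcoeff_dp i a m : zed (m + U_(i)) * a@_(m + U_(i)) = zed m * (dp i a)@_m.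
Proof.
rewrite zedDU /dp mcoeffZ mcoeff_mderiv -mulr_natr; ring.
Qed.

Definition gphi n : A -> {mpoly K[n]} := phi (@mpolyC n K) (fun i : 'I_n => 'X_i).
HB.instance Definition _ n := GRing.RMorphism.on (@gphi n).

Lemma gphi_pgen n k : (0 < k <= N)%N -> gphi n (pgen k) = \sum_(j < n) 'X_j ^+ k.
Proof. exact: spec_pgen. Qed.

Lemma gphiZ n c a : gphi n (c *: a) = c *: gphi n a.
Proof. by rewrite /gphi phiZ mul_mpolyC. Qed.

(* Both sides satisfy the same recursion: multiplication by p_k on one side,
   the derivation k d/dp_k, which maps h_j to h_(j-k), on the other. *)
Lemma gphi_coefX n (al : 'X_{1..n}) m :
  (gphi n 'X_[m])@_al = zed m * (\prod_j hgen (al j))@_m.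
Proof.
elim: {m}(mdeg m) {-2}m (erefl (mdeg m)) al => [|e IHe] m Em al.
  have -> : m = 0%MM by apply/eqP; rewrite -mdeg_eq0 Em.
  rewrite mpolyX0 rmorph1 zed0 mul1r mcoeff1.
  have -> : (\prod_j hgen (al j))@_0%MM = \prod_j (hgen (al j))@_0%MM.
    have h : multiplicative (mcoeff 0%MM : A -> K) by exact: mcoeff0_is_multiplicative.
    by elim/big_rec2: _ => [|j a b _ <-]; [exact: h.2 | rewrite -h.1].
  under [RHS]eq_bigr => j _ do rewrite hgen_coef0.
  case: eqP => [->|/eqP]; first by rewrite big1 // => j _; rewrite mnm0E.
  rewrite -mdeg_eq0 mdegE sum_nat_eq0 negb_forall => /existsP[j /= al_j].
  by rewrite (bigD1 j) //= (negbTE al_j) mul0r.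
have [i mi] : exists i, (0 < m i)%N.
  case: (pickP (fun i => 0 < m i)%N) => [i mi|m0]; first by exists i.
  suff : mdeg m = 0%N by rewrite Em.
  by rewrite mdegE big1 // => i _; apply/eqP; have := m0 i; rewrite lt0n => /negbFE.
have Emi : m = (m - U_(i) + U_(i))%MM by rewrite submK // lep1mP -lt0n.
have Em' : mdeg (m - U_(i)) = e.
  by have := Em; rewrite {1}Emi mdegD mdeg1 addn1 => -[].
move: (m - U_(i))%MM Emi Em' => m' -> {m mi Em} Em'.
rewrite mcoeff_dp mpolyXD rmorphM /= -pgenE gphi_pgen ?ltn_ord // mulr_sumr raddf_sum.
rewrite /dp mderiv_prod scaler_sumr [(\sum_j _)@_m']raddf_sum mulr_sumr; apply: eq_bigr => j _ /=.
have -> : 'X_j ^+ i.+1 = 'X_[U_(j) *+ i.+1] :> {mpoly K[n]} by rewrite mpolyXn.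
rewrite mcoeffMX_sub.
have -> : (U_(j) *+ i.+1 <= al)%MM = (i.+1 <= al j)%N.
  apply/mnm_lepP/idP => [/(_ j)|le_i k]; first by rewrite mulmnE mnm1E eqxx mul1n.
  by rewrite mulmnE mnm1E; case: eqP => [<-|_]; rewrite ?mul1n ?mul0n.
rewrite -mul_mpolyC (bigD1 j) //= eqxx mulrA mul_mpolyC -/(dp i _) dp_hgen.
case: ltnP => le_i; last by rewrite mul0r mcoeff0 mulr0.
rewrite IHe //; congr (_ * _@_m'); rewrite [LHS](bigD1 j) //=; congr (_ * _).
  by rewrite mnmBE mulmnE mnm1E eqxx mul1n.
apply: eq_bigr => k /negbTE kj; rewrite kj mnmBE mulmnE mnm1E eq_sym kj.
by rewrite mul0n subn0.
Qed.

(* the Hall scalar product in degree [d] *)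
Definition form d (a b : A) : K := \sum_(rho : intpart d) zed (pm rho) * a@_(pm rho) * b@_(pm rho).

Lemma form_sym d a b : form d a b = form d b a.
Proof. by apply: eq_bigr => rho _; rewrite mulrAC. Qed.

Lemma formDr d a b b' : form d a (b + b') = form d a b + form d a b'.
Proof. by rewrite -big_split; apply: eq_bigr => rho _; rewrite mcoeffD mulrDr. Qed.

Lemma formZr d a c b : form d a (c *: b) = c * form d a b.
Proof. by rewrite mulr_sumr; apply: eq_bigr => rho _; rewrite mcoeffZ mulrCA. Qed.

Lemma form_sumr d a (I : Type) (r : seq I) (P : pred I) F :
  form d a (\sum_(i <- r | P i) F i) = \sum_(i <- r | P i) form d a (F i).
Proof.
by rewrite /form exchange_big; apply: eq_bigr => rho _; rewrite raddf_sum mulr_sumr.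
Qed.

Lemma gphi_coef n d a (al : 'X_{1..n}) : (d <= N)%N -> hspan d a ->
  (gphi n a)@_al = form d a (\prod_j hgen (al j)).
Proof.
move=> le_dN ha; rewrite (hspanE K0 le_dN ha) rmorph_sum raddf_sum; apply: eq_bigr => rho _.
rewrite /= gphiZ mcoeffZ gphi_coefX -(hspanE K0 le_dN ha); ring.
Qed.

Definition ppcoord d (rho : intpart d) : intpart d -> K :=
  epsilon (inhabits (fun=> 0)) (fun c => pp rho = \sum_(mu | predT mu) c mu *: hp mu).

Lemma ppcoordE d (rho : intpart d) : (d <= N)%N ->
  pp rho = \sum_(mu | predT mu) ppcoord rho mu *: hp mu.
Proof. by move=> le_dN; apply: (epsilon_spec _ _ (hspan_pp K0 rho le_dN)). Qed.

(* Since (h_mu) is dual to (m_mu), a vector [v] of coordinates in the monomial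
   basis is identified with the functional [pr v] sending each h_mu to [v mu]. *)
Definition pr d (v : intpart d -> K) (a : A) : K :=
  \sum_(rho : intpart d) a@_(pm rho) * \sum_mu ppcoord rho mu * v mu.

Lemma prD d (v : intpart d -> K) a b : pr v (a + b) = pr v a + pr v b.
Proof. by rewrite -big_split; apply: eq_bigr => rho _; rewrite mcoeffD mulrDl. Qed.

Lemma prZ d (v : intpart d -> K) c a : pr v (c *: a) = c * pr v a.
Proof. by rewrite mulr_sumr; apply: eq_bigr => rho _; rewrite mcoeffZ mulrA. Qed.

Lemma pr_sum d (v : intpart d -> K) (I : Type) (r : seq I) (P : pred I) F :
  pr v (\sum_(i <- r | P i) F i) = \sum_(i <- r | P i) pr v (F i).
Proof.
by rewrite /pr exchange_big; apply: eq_bigr => rho _; rewrite raddf_sum mulr_suml.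
Qed.

Lemma pr_suml d (I : Type) (r : seq I) (P : pred I) (c : I -> K) (v : I -> intpart d -> K) a :
  pr (fun mu => \sum_(i <- r | P i) c i * v i mu) a = \sum_(i <- r | P i) c i * pr (v i) a.
Proof.
under [RHS]eq_bigr => i _ do rewrite /pr mulr_sumr.
rewrite exchange_big; apply: eq_bigr => rho _ /=.
under [RHS]eq_bigr => i _ do rewrite mulrCA.
rewrite -mulr_sumr; congr (_ * _).
under eq_bigr => mu _ do rewrite mulr_sumr.
rewrite exchange_big; apply: eq_bigr => i _ /=; rewrite mulr_sumr.
by apply: eq_bigr => mu _; rewrite mulrCA.
Qed.

Lemma eq_pr d (v w : intpart d -> K) a : v =1 w -> pr v a = pr w a.
Proof.
move=> eq_vw; apply: eq_bigr => rho _; congr (_ * _).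
by apply: eq_bigr => mu _; rewrite eq_vw.
Qed.

Lemma pr_hp d (v : intpart d -> K) mu : (d <= N)%N -> pr v (hp mu) = v mu.
Proof.
move=> le_dN; have E : hp mu = \sum_(ka : intpart d) (\sum_(rho : intpart d) (hp mu)@_(pm rho) * ppcoord rho ka) *: hp ka.
  have hmu : hspan d (hp mu) by exact: lspan_mem.
  rewrite {1}(hspanE K0 le_dN hmu).
  transitivity (\sum_(rho : intpart d) \sum_(ka : intpart d) ((hp mu)@_(pm rho) * ppcoord rho ka) *: hp ka).
    apply: eq_bigr => rho _; rewrite ppcoordE // scaler_sumr.
    by apply: eq_bigr => ka _; rewrite scalerA.
  by rewrite exchange_big; apply: eq_bigr => ka _; rewrite scaler_suml.
have dl (ka : intpart d) : (ka == mu)%:R = \sum_(rho : intpart d) (hp mu)@_(pm rho) * ppcoord rho ka.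
  have h := @lfree_uniq _ _ _ _ (fun ka => (ka == mu)%:R)
    (fun ka => \sum_(rho : intpart d) (hp mu)@_(pm rho) * ppcoord rho ka) (lfree_hp K0 le_dN).
  apply: h ka.
  rewrite -E (bigD1 mu) //= eqxx scale1r big1 ?addr0 // => ka /negbTE ->.
  by rewrite scale0r.
rewrite /pr; under eq_bigr => rho _ do rewrite mulr_sumr.
rewrite exchange_big /= (bigD1 mu) //= [X in _ + X]big1 => [|ka /negbTE nka].
  rewrite addr0; under eq_bigr => rho _ do rewrite mulrA.
  by rewrite -mulr_suml -dl eqxx mul1r.
under eq_bigr => rho _ do rewrite mulrA.
by rewrite -mulr_suml -dl nka mul0r.
Qed.

(** Both sides are the coefficient of x^mu in p_la(x_1, ..., x_d). Expanding the product chooses a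
    variable for each nonzero part; sending the zero parts to index 0 makes every choice count
    once. *)
Lemma card_psum d (la mu : intpart d) : (d <= N)%N ->
  (#|[set f : {ffun 'I_d -> 'I_d} |
       [forall i : 'I_d, (part la i == 0%N) ==> (val (f i) == 0%N)] &&
       [forall j : 'I_d, (\sum_(i < d | f i == j) part la i)%N == part mu j]]|)%:R
  = zed (pm la) * (hp mu)@_(pm la) :> K.
Proof.
move=> le_dN; pose al := [multinom part mu i | i < d].
have -> : hp mu = \prod_j hgen (al j) by apply: eq_bigr => j _; rewrite mnmE.
rewrite -gphi_coefX -/(pp la) ppE // rmorph_prod.
pose G (i j : 'I_d) : {mpoly K[d]} :=
  if part la i == 0%N then (val j == 0%N)%:R else 'X_[U_(j) *+ part la i].
have -> : \prod_(i < d) gphi d (if part la i == 0%N then 1 else pgen (part la i)) = \prod_(i < d) \sum_j G i j.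
  apply: eq_bigr => i _; rewrite /G; case: eqP => [_|/eqP ri].
    rewrite rmorph1; have d_gt0 : (0 < d)%N by apply: leq_ltn_trans (ltn_ord i).
    rewrite (bigD1 (Ordinal d_gt0)) //= big1 ?addr0 // => j.
    by rewrite -val_eqE /= => /negbTE ->.
  rewrite gphi_pgen ?lt0n ?ri ?(leq_trans (part_le _ _)) //.
  by apply: eq_bigr => j _; rewrite mpolyXn.
rewrite bigA_distr_bigA /= raddf_sum -sum1_card natr_sum big_mkcond /=.
apply: eq_bigr => f _; rewrite inE.
case: forallP => [f0|nf0] /=; last first.
  have /existsP[i] : [exists i : 'I_d, ~~ ((part la i == 0%N) ==> (val (f i) == 0%N))].
    by rewrite -negb_forall; apply/forallP.
  rewrite negb_imply => /andP[la_i f_i].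
  by rewrite (bigD1 i) //= /G la_i (negbTE f_i) mul0r mcoeff0.
have -> : \prod_i G i (f i) = 'X_[\sum_i (U_(f i) *+ part la i)%MM].
  elim/big_rec2: _ => [|i a g _ ->]; first by rewrite mpolyX0.
  rewrite mpolyXD /G; case: eqP => // la_i.
  by have := f0 i; rewrite la_i /= => ->; rewrite mulm0n mpolyX0.
rewrite mcoeffX; have -> : ((\sum_i (U_(f i) *+ part la i)%MM)%MM == al) =
    [forall j : 'I_d, (\sum_(i < d | f i == j) part la i)%N == part mu j]; last by case: ifP.
apply/eqP/forallP => [E j|E].
  have := congr1 (fun m : 'X_{1..d} => m j) E; rewrite mnmE mnm_sumE => <-.
  rewrite big_mkcond /=; apply/eqP/eq_bigr => i _; rewrite mulmnE mnm1E.
  by case: eqP; rewrite ?mul1n ?mul0n.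
apply/mnmP => j; rewrite mnmE mnm_sumE -(eqP (E j)) [RHS]big_mkcond /=; apply: eq_bigr => i _.
by rewrite mulmnE mnm1E; case: eqP; rewrite ?mul1n ?mul0n.
Qed.

End Pairing.

(** * Jacobi-Trudi determinants *)

Definition delta n (j : 'I_n) : nat := (n - j.+1)%N.

Section JacobiTrudi.
Variable B : comNzRingType.
Implicit Types (c : nat -> B).

Definition hz c a b : B := if (b <= a)%N then c (a - b)%N else 0.
(* The entry (i, j) is c_(al_i + j - i), with c_k = 0 for k < 0. *)
Definition JT c n (al : nat -> nat) : B :=
  \det (\matrix_(i < n, j < n) hz c (al i + j) i).

Lemma JTS c n al : c 0%N = 1 -> al n = 0%N -> JT c n.+1 al = JT c n al.
Proof.
move=> c0 al_n; rewrite /JT (expand_det_row _ ord_max) (bigD1 ord_max) //= big1 ?addr0 => [|j].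
  rewrite mxE /hz al_n add0n leqnn subnn c0 mul1r /cofactor /= addnn -mul2n exprM sqrrN expr1n expr1n mul1r.
  have lift_max (i : 'I_n) : nat_of_ord (lift ord_max i) = i by rewrite /= /bump leqNgt ltn_ord.
  by congr (\det _); apply/matrixP => i j; rewrite !mxE !lift_max.
rewrite -val_eqE /= => nj; rewrite mxE /hz al_n add0n ifF ?mul0r //=.
by have := ltn_ord j; move: nj => /=; lia.
Qed.

Lemma JT_widen c n k al : c 0%N = 1 -> (forall i, (n <= i)%N -> al i = 0%N) ->
  (n <= k)%N -> JT c k al = JT c n al.
Proof.
move=> c0 al0; elim: k => [|k IHk]; first by rewrite leqn0 => /eqP ->.
by rewrite leq_eqVlt => /predU1P[-> // | le_nk]; rewrite JTS ?al0 ?IHk.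
Qed.

Lemma JT_zero c n : c 0%N = 1 -> JT c n (fun=> 0%N) = 1.
Proof. by move=> c0; rewrite (@JT_widen c 0 n) // /JT det_mx00. Qed.

Lemma JT_expand c n al : JT c n al = \sum_(s : 'S_n) (-1) ^+ s * \prod_(i < n) hz c (al i + s i) i.
Proof.
by apply: eq_bigr => s _; congr (_ * _); apply: eq_bigr => i _; rewrite mxE.
Qed.

Lemma eq_JT c n al al' : (forall i, (i < n)%N -> al i = al' i) -> JT c n al = JT c n al'.
Proof. by move=> E; congr (\det _); apply/matrixP => i j; rewrite !mxE E. Qed.

Lemma hz_prod c n (al : nat -> nat) (s : 'S_n) : \prod_(i < n) hz c (al i + s i) i =
  if [forall i : 'I_n, i <= al i + s i]%N then \prod_(i < n) c (al i + s i - i)%N else 0.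
Proof.
case: forallP => [h | /forallP]; first by apply: eq_bigr => i _; rewrite /hz h.
rewrite negb_forall => /existsP[i /negbTE ni].
by rewrite (bigD1 i) //= /hz ni mul0r.
Qed.

Lemma sum_sub_perm n (al : nat -> nat) (s : 'S_n) : (forall i : 'I_n, i <= al i + s i)%N ->
  (\sum_(i < n) (al i + s i - i))%N = (\sum_(i < n) al i)%N.
Proof.
move=> h; apply/eqP; rewrite -(eqn_add2r (\sum_(i < n) i)) -big_split /=.
rewrite (eq_bigr (fun i : 'I_n => al i + s i)%N) => [|i _]; last by rewrite subnK.
by rewrite big_split /= eqn_add2l [X in _ == X](reindex_inj (@perm_inj _ s)).
Qed.

(** In each nonzero term of the determinant the indices of c add up to \sum_i al_i, so none exceeds
    it. *)
Lemma JT_local c c' n (al : nat -> nat) : (forall k, (k <= \sum_(i < n) al i)%N -> c k = c' k) ->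
  JT c n al = JT c' n al.
Proof.
move=> E; rewrite !JT_expand; apply: eq_bigr => s _; congr (_ * _).
rewrite !hz_prod; case: forallP => // h; apply: eq_bigr => i _; apply: E.
by rewrite -(sum_sub_perm h) (bigD1 i) //= leq_addr.
Qed.

Definition alt n (x : 'I_n -> B) (be : 'I_n -> nat) : B :=
  \det (\matrix_(i, j) x i ^+ be j).

Lemma altE n (x : 'I_n -> B) be : alt x be = \sum_(s : 'S_n) (-1) ^+ s * \prod_i x i ^+ be (s i).
Proof.
by apply: eq_bigr => s _; congr (_ * _); apply: eq_bigr => i _; rewrite mxE.
Qed.

Lemma eq_alt n (x x' : 'I_n -> B) be be' : x =1 x' -> be =1 be' -> alt x be = alt x' be'.
Proof. by move=> Ex Eb; congr (\det _); apply/matrixP => i j; rewrite !mxE Ex Eb. Qed.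

Lemma alt_perm n (x : 'I_n -> B) be (s : 'S_n) :
  alt x (fun i => be (s i)) = (-1) ^+ s * alt x be.
Proof.
rewrite /alt -[X in _ = _ * X]det_tr.
have -> : (\matrix_(i, j) x i ^+ be (s j)) = (row_perm s (\matrix_(i, j) x i ^+ be j)^T)^T.
  by apply/matrixP => i j; rewrite !mxE.
by rewrite [LHS]det_tr row_permE det_mulmx det_perm.
Qed.

Lemma alt_eq0 n (x : 'I_n -> B) be i j : i != j -> be i = be j -> alt x be = 0.
Proof.
move=> ij Eb; rewrite /alt -det_tr; apply: (determinant_alternate ij) => k.
by rewrite !mxE Eb.
Qed.

End JacobiTrudi.

Lemma rmorph_JT (B B' : comNzRingType) (g : {rmorphism B -> B'}) c n al :
  g (JT c n al) = JT (fun k => g (c k)) n al.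
Proof.
rewrite -det_map_mx; congr (\det _); apply/matrixP => i j; rewrite !mxE /hz.
by case: ifP; rewrite ?rmorph0.
Qed.

Lemma rmorph_alt (B B' : comNzRingType) (g : {rmorphism B -> B'}) n (x : 'I_n -> B) be :
  g (alt x be) = alt (fun i => g (x i)) be.
Proof.
by rewrite -det_map_mx; congr (\det _); apply/matrixP => i j; rewrite !mxE rmorphXn.
Qed.

(** * Straightening of exponents *)

Section Straighten.
Local Open Scope nat_scope.

Lemma inj_mono_delta n (be : 'I_n -> nat) : injective be ->
  (forall i j : 'I_n, i <= j -> be j <= be i) ->
  forall i j : 'I_n, i <= j -> be j + (j - i) <= be i.
Proof.
move=> be_inj be_mono i j; move Ek : (j - i) => k; elim: k i j Ek => [|k IHk] i j Ek le_ij.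
  by rewrite addn0 be_mono.
have lt_i : i.+1 < n by have := ltn_ord j; lia.
have := IHk (Ordinal lt_i) j; rewrite /= => h.
have {h} h : be j + k <= be (Ordinal lt_i) by apply: h; lia.
have : be (Ordinal lt_i) < be i.
  rewrite ltn_neqAle be_mono /= ?leqnSn // andbT.
  by apply/eqP => /be_inj /(congr1 val) /=; lia.
lia.
Qed.

(** Distinct exponents, once sorted, drop by at least one at each step, so subtracting the staircase
    [delta] leaves a partition. *)
Lemma straighten n d (be : 'I_n -> nat) : injective be ->
  \sum_i be i = d + \sum_(i < n) delta i ->
  exists (la : intpart d) (s : 'S_n), plen la <= n /\ forall i : 'I_n, part la i + delta i = be (s i).
Proof.
move=> be_inj Ed; have [s s_mono] := sort_fun be.
have bs_inj : injective (fun i => be (s i)) by move=> i j /be_inj /perm_inj.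
have bs_delta := inj_mono_delta bs_inj s_mono.
have le_delta (i : 'I_n) : delta i <= be (s i).
  have lt_n : n.-1 < n by have := ltn_ord i; lia.
  have := bs_delta i (Ordinal lt_n); rewrite /delta /= => h.
  have := h _; have := ltn_ord i; lia.
pose f i := if insub i is Some j then be (s j) - delta (j : 'I_n) else 0.
have fE (i : 'I_n) : f i = be (s i) - delta i by rewrite /f valK.
have f_big i : n <= i -> f i = 0 by move=> le_ni; rewrite /f insubN // -leqNgt.
have f_mono i j : i <= j -> f j <= f i.
  have [le_nj|lt_jn] := leqP n j; first by rewrite f_big.
  move=> le_ij; have lt_in := leq_ltn_trans le_ij lt_jn.
  rewrite (fE (Ordinal lt_in)) (fE (Ordinal lt_jn)).
  have := bs_delta (Ordinal lt_in) (Ordinal lt_jn) le_ij; rewrite /delta /=; lia.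
have [|la Ela] := ex_partn f_mono f_big (d := d).
  apply/eqP; rewrite -(eqn_add2r (\sum_(i < n) delta i)) -Ed -big_split /=.
  rewrite [X in _ == X](reindex_inj (@perm_inj _ s)) /=; apply/eqP/eq_bigr => i _.
  by rewrite fE subnK.
exists la, s; split=> [|i]; first by rewrite leq_plen Ela f_big.
by rewrite Ela fE subnK.
Qed.

End Straighten.

Section Schur.
Variables (K : fieldType) (N : nat).
Hypothesis K0 : [pchar K] =i pred0.
Notation A := {mpoly K[N]}.
Notation hgen := (hgen K N).
Notation hspan := (fun d => lspan predT (@hp K N d)).
Notation hp := (@hp K N _).

(** The Schur function in the ring of power sums, by Jacobi-Trudi; [form_kostka] reconciles it with
    the tableaux that define [schur]. *)
Definition sA d (la : intpart d) : A := JT hgen d (part la).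

Lemma sA_JT d (la : intpart d) n : (plen la <= n)%N -> sA la = JT hgen n (part la).
Proof.
move=> le_n; have h i : (plen la <= i)%N -> part la i = 0%N by rewrite leq_plen => /eqP.
by rewrite /sA (JT_widen (hgen0 _ _) h le_n) (JT_widen (hgen0 _ _) h (plen_le la)).
Qed.

(** The identity permutation gives h_la. For another s, the first k entries la_i + s i - i gain the
    amount \sum s i - \sum i >= 0 over those of la, strictly for some k, and sorting can only
    increase partial sums. *)
Lemma sA_sub_hp d (la : intpart d) :
  lspan (fun ka => dom ka la && (ka != la)) (fun mu : intpart d => hp mu) (sA la - hp la).
Proof.
rewrite /sA JT_expand (bigD1 1%g) //= odd_perm1 expr0 mul1r.
have -> : \prod_(i < d) hz hgen (part la i + (1%g : 'S_d) i) i = hp la.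
  by apply: eq_bigr => i _; rewrite perm1 /hz leq_addl addnK.
rewrite addrAC subrr add0r; apply: lspan_sum => s s_neq1.
rewrite hz_prod; case: forallP => [h|_]; last by rewrite mulr0; apply: lspan0.
have Ed := sum_sub_perm h; rewrite sum_part // in Ed.
have [ka [w [Ew ka0]]] := sort_part Ed.
rewrite (prod_sort_part (g := hgen) _ Ew ka0) // -/(hp ka) mulr_sign -(scaler_sign _ (hp ka : A)).
have key k : (k <= d)%N -> (\sum_(i < k) part la i + \sum_(i < d | i < k) s i <=
    \sum_(i < k) part ka i + \sum_(i < d | i < k) i)%N.
  move=> le_kd; have := @sum_set_le d (fun i => part la i + s i - i)%N (part ka) w [set i : 'I_d | (i < k)%N].
  rewrite card_ord_lt // => h1.
  have {}h1 : (\sum_(i in [set i : 'I_d | (i < k)%N]) (part la i + s i - i) <= \sum_(i < k) part ka i)%N.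
    by apply: h1 => [i j|i]; [apply: part_mono | rewrite -Ew].
  rewrite (eq_bigl (fun i : 'I_d => i < k)%N) in h1; last by move=> i; rewrite inE.
  rewrite -(@big_ord_lt _ _ _ d k (part la)) // -big_split /=.
  apply: leq_trans (_ : (\sum_(i < d | i < k) (part la i + s i - i) + \sum_(i < d | i < k) i <= _)%N); last by rewrite leq_add2r.
  by rewrite -big_split /=; apply: leq_sum => i _; rewrite subnK.
have perm_ge k : (k <= d)%N -> (\sum_(i < d | i < k) i <= \sum_(i < d | i < k) s i)%N.
  move=> le_kd; have := perm_sum_set s [set i : 'I_d | (i < k)%N].
  rewrite card_ord_lt // (big_ord_lt _ id) // => h1; apply: leq_trans h1 _.
  by rewrite (eq_bigl (fun i : 'I_d => i < k)%N) // => i; rewrite inE.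
apply/lspanZ/lspan_mem/andP; split.
  apply/domP => k; have [le_kd|lt_dk] := leqP k d; last by rewrite !sum_part // ltnW.
  by have := key k le_kd; have := perm_ge k le_kd; lia.
apply/eqP => Eka; case/eqP: s_neq1; apply: perm_psum_eq => k le_kd.
by have := key k le_kd; have := perm_ge k le_kd; rewrite Eka; lia.
Qed.

Lemma sA_hp d (la : intpart d) : lspan (fun ka => dom ka la) (fun mu : intpart d => hp mu) (sA la).
Proof.
rewrite -[sA la](subrK (hp la)); apply: lspanD; last exact/lspan_mem/dom_refl.
by apply: lspan_sub (sA_sub_hp la) => ka /andP[].
Qed.

Lemma hspan_sA d (la : intpart d) : hspan d (sA la).
Proof. by apply: lspan_sub (sA_hp la). Qed.

(** The bialternant formula. Since 1 / (1 - x_r X) is the h-series times the product of the 1 - x_l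
    X with l != r, each power of x_r is a combination of the h_k with coefficients in row r of [E];
    the alternant matrix is thus [E] times a transposed Jacobi-Trudi matrix. *)
Lemma alt_sA (F : idomainType) (f : {rmorphism K -> F}) n (x : 'I_n -> F) d (la : intpart d) :
  (plen la <= n)%N -> (d + n <= N)%N ->
  alt x (fun i : 'I_n => part la i + delta i)%N = alt x (@delta n) * phi f x (sA la).
Proof.
move=> le_n le_N; pose c k := phi f x (hgen k).
pose E := \matrix_(r < n, j < n) (\prod_(l | l != r) (1 - x l *: 'X))`_(delta j).
have key (al : nat -> nat) : (forall i, (al i <= d)%N) ->
    alt x (fun i : 'I_n => al i + delta i)%N = \det E * JT c n al.
  move=> al_le; rewrite /JT -[X in _ * X]det_tr -det_mulmx; congr (\det _).
  apply/matrixP => r i; rewrite mxE [in RHS]mxE.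
  have coE l : (n <= l)%N -> (\prod_(l | l != r) (1 - x l *: 'X))`_l = 0.
    pose x' j := if j == r then 0 else x j.
    have <- : \prod_j (1 - x' j *: 'X) = \prod_(j | j != r) (1 - x j *: 'X).
      rewrite [LHS](bigD1 r) //= /x' eqxx scale0r subr0 mul1r.
      by apply: eq_bigr => j /negbTE ->.
    have [sz co] := size_coef_prod_linear x'.
    rewrite leq_eqVlt => /predU1P[<-|/(leq_sizeP _ _ sz) //].
    by rewrite co (bigD1 r) //= /x' eqxx oppr0 mul0r.
  set P := \prod_(l | l != r) _ in coE *; set b := (al i + delta i)%N.
  pose g l := P`_l * (if (l <= b)%N then c (b - l)%N else 0).
  transitivity (\sum_(l < n) g l); last first.
    rewrite [RHS](reindex_inj rev_ord_inj); apply: eq_bigr => l _; rewrite !mxE /hz /g.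
    have -> : delta (rev_ord l) = l by rewrite /delta /=; have := ltn_ord l; lia.
    congr (_ * _); rewrite /b /delta /=; have := ltn_ord l; have := ltn_ord i => lt_i lt_l.
    have -> : (i <= al i + (n - l.+1))%N = (l <= al i + (n - i.+1))%N by apply/idP/idP; lia.
    by case: ifP => // _; congr c; lia.
  transitivity (\sum_(l < b.+1) g l); last first.
    rewrite -(@big_widen0 _ _ _ g n (n + b.+1)) ?leq_addr //; last first.
      by move=> l /coE; rewrite /g => ->; rewrite mul0r.
    rewrite -(@big_widen0 _ _ _ g b.+1 (n + b.+1)) ?leq_addl // => l lt_bl.
    by rewrite /g leqNgt lt_bl mulr0.
  have le_bN : (b <= N)%N.
    by apply: leq_trans le_N; rewrite leq_add ?al_le // /delta; lia.
  have -> : \sum_(l < b.+1) g l = \sum_(l < b.+1) c l * P`_(b - l).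
    rewrite (reindex_inj rev_ord_inj); apply: eq_bigr => l _; rewrite /g /= subSS leq_subr.
    by rewrite subKn; [exact: mulrC | rewrite -ltnS].
  rewrite phi_conv_prod // (eq_spec _ (pi' := fun k => x r ^+ k)) => [|k _]; last first.
    by rewrite (eq_bigl (pred1 r)) ?big_pred1_eq // => l; rewrite negbK.
  by rewrite (spec_hgen K0 f (newton_geom N (x r))).
have c0 : c 0%N = 1 by rewrite /c hgen0 rmorph1.
rewrite (key (part la)) => [|i]; last exact: part_le.
(* The empty shape, whose Jacobi-Trudi determinant is 1, identifies [\det E] with the Vandermonde
   determinant. *)
have -> : alt x (@delta n) = \det E.
  by rewrite -[RHS]mulr1 -(JT_zero n c0) -key // => i; rewrite leq0n.
by rewrite (sA_JT le_n) rmorph_JT.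
Qed.

End Schur.

Lemma sum_delta_perm n k (s : 'S_n) : (k <= n)%N ->
  (\sum_(i < n | i < k) delta (s i) + \sum_(i < n | i < k) s i =
   \sum_(i < n | i < k) delta i + \sum_(i < n | i < k) i)%N.
Proof.
move=> le_kn; rewrite -!big_split /=; apply: eq_bigr => i _.
by have := ltn_ord i; have := ltn_ord (s i); rewrite /delta; lia.
Qed.

Lemma psum_perm_ge n k (s : 'S_n) : (k <= n)%N ->
  (\sum_(i < n | i < k) i <= \sum_(i < n | i < k) s i)%N.
Proof.
move=> le_kn; have := perm_sum_set s [set i : 'I_n | (i < k)%N].
rewrite card_ord_lt // -(sum_ord_lt id le_kn) => h1; apply: leq_trans h1 _.
by rewrite (eq_bigl (fun i : 'I_n => i < k)%N) // => i; rewrite inE.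
Qed.

(** Partial sums of mu are those of the permuted al minus \sum s i - \sum i, which is nonnegative.
    Equality for all k forces both this cost to vanish, hence s = 1, and al to agree with la. *)
Lemma straight_dom n d (la mu : intpart d) (al : 'I_n -> nat) (s : 'S_n) :
  (plen mu <= n)%N ->
  (forall I : {set 'I_n}, (\sum_(i in I) al i <= \sum_(i < #|I|) part la i)%N) ->
  (forall i : 'I_n, part mu i + delta i = al (s i) + delta (s i))%N ->
  dom la mu /\ (mu = la -> s = 1%g /\ forall i : 'I_n, al i = part la i).
Proof.
move=> le_n le_al Es.
have sumE k : (k <= n)%N -> (\sum_(i < k) part mu i + \sum_(i < n | i < k) s i =
    \sum_(i < n | i < k) al (s i) + \sum_(i < n | i < k) i)%N.
  move=> le_kn; have h := sum_delta_perm s le_kn; rewrite -(sum_ord_lt (part mu) le_kn).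
  have : (\sum_(i < n | i < k) part mu i + \sum_(i < n | i < k) delta i =
      \sum_(i < n | i < k) al (s i) + \sum_(i < n | i < k) delta (s i))%N.
    by rewrite -!big_split /=; apply: eq_bigr => i _.
  by lia.
have alE k : (k <= n)%N -> (\sum_(i < n | i < k) al (s i) <= \sum_(i < k) part la i)%N.
  move=> le_kn; have := le_al (s @: [set i : 'I_n | (i < k)%N]).
  rewrite card_imset ?card_ord_lt //; last exact: perm_inj.
  rewrite big_imset /=; last by move=> i j _ _; apply: perm_inj.
  by rewrite (eq_bigl (fun i : 'I_n => i < k)%N) // => i; rewrite inE.
have dom_n k : (k <= n)%N -> (\sum_(i < k) part mu i <= \sum_(i < k) part la i)%N.
  by move=> le_kn; have := sumE k le_kn; have := alE k le_kn; have := psum_perm_ge s le_kn; lia.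
split.
  apply/domP => k; have [|lt_nk] := leqP k n; first exact: dom_n.
  have -> : (\sum_(i < k) part mu i = \sum_(i < n) part mu i)%N.
    apply: (@big_widen0 _ _ _ (part mu)) => [|i le_ni]; first exact: ltnW.
    by apply/eqP; rewrite -leq_plen (leq_trans le_n).
  by apply: leq_trans (dom_n n (leqnn n)) _; apply/leq_sum_widen/ltnW.
move=> Emu; have s1 : s = 1%g.
  apply: perm_psum_eq => k le_kn.
  by have := sumE k le_kn; have := alE k le_kn; have := psum_perm_ge s le_kn; rewrite Emu; lia.
by split=> // i; have := Es i; rewrite s1 perm1 Emu => /addIn.
Qed.

Lemma alt_straighten n d (be : 'I_n -> nat) : (\sum_i be i = d + \sum_(i < n) delta i)%N ->
  (forall (B : comNzRingType) (x : 'I_n -> B), alt x be = 0) \/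
  exists (la : intpart d) (s : 'S_n), [/\ (plen la <= n)%N,
    (forall i : 'I_n, part la i + delta i = be (s i))%N &
    forall (B : comNzRingType) (x : 'I_n -> B),
      alt x be = (-1) ^+ s * alt x (fun i : 'I_n => part la i + delta i)%N].
Proof.
move=> Ed; have [/injectiveP be_inj | /injectiveP] := boolP (injectiveb (finfun be)).
  have {}be_inj : injective be by move=> i j Eij; apply: be_inj; rewrite !ffunE.
  have [la [s [le_n Es]]] := straighten be_inj Ed.
  right; exists la, s; split=> // B x.
  have -> : alt x (fun i : 'I_n => part la i + delta i)%N = alt x (fun i => be (s i)).
    by apply: eq_alt.
  by rewrite alt_perm mulrA -expr2 sqrr_sign mul1r.
move/injectiveP/injectivePn => [i [j ij Eij]]; left=> B x; apply: (alt_eq0 x ij).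
by rewrite !ffunE in Eij.
Qed.

(** * From alternants to Schur functions *)

Section Lift.
Variables (K : fieldType) (N : nat).
Hypothesis K0 : [pchar K] =i pred0.
Notation A := {mpoly K[N]}.
Notation hgen := (hgen K N).
Notation hspan := (fun d => lspan predT (@hp K N d)).
Notation hp := (@hp K N _).
Notation pp := (@pp K N _).
Notation pm := (@pm N _).
Notation gphi := (@gphi K N).
Notation sA := (@sA K N _).

Notation "'ladelta' la n" := (fun i : 'I_n => part la i + delta i)%N
  (at level 10, la at level 9, n at level 9).
Definition galt n (be : 'I_n -> nat) : {mpoly K[n]} := alt (fun i : 'I_n => 'X_i) be.

(** With n >= d variables every h_mu of degree d is a pairing seen by a coefficient of [gphi n a],
    and the h_mu span the p_rho, whose pairings give the coefficients of a. *)
Lemma gphi_inj n d (a : A) : (d <= n)%N -> (d <= N)%N -> hspan d a -> gphi n a = 0 -> a = 0.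
Proof.
move=> le_dn le_dN ha a0; have fa (mu : intpart d) : form d a (hp mu) = 0.
  have <- : (gphi n a)@_[multinom part mu i | i < n] = form d a (hp mu).
    rewrite (gphi_coef K0 _ le_dN ha); congr form.
    rewrite /(hp _) -(@prod_part _ hgen n) ?hgen0 //; first by apply: eq_bigr => i _; rewrite mnmE.
    exact: leq_trans (plen_le mu) le_dn.
  by rewrite a0 mcoeff0.
apply: (hspan_coef K0 le_dN ha) => rho; apply: (mulfI (zed_neq0 K0 (pm rho))); rewrite mulr0.
have -> : zed K (pm rho) * a@_(pm rho) = form d a (pp rho).
  rewrite /form (bigD1 rho) //= pp_coef // eqxx mulr1 big1 ?addr0 // => si /negbTE nsi.
  by rewrite pp_coef // eq_sym nsi mulr0.
by rewrite (ppcoordE K0 rho le_dN) form_sumr big1 // => mu _; rewrite formZr fa mulr0.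
Qed.

Lemma gphi_sA n d (la : intpart d) : (plen la <= n)%N -> (d + n <= N)%N ->
  galt (ladelta la n) = galt (@delta n) * gphi n (sA la).
Proof. by move=> le_n le_N; rewrite /galt (@alt_sA _ N K0 _ (@mpolyC n K)). Qed.

Lemma galt_coef n d (la mu : intpart d) : (plen la <= n)%N -> (plen mu <= n)%N ->
  (galt (ladelta la n))@_[multinom ladelta mu n i | i < n] = (la == mu)%:R.
Proof.
move=> la_n mu_n; rewrite /galt altE raddf_sum /=.
have co (s : 'S_n) : ((-1) ^+ s * \prod_(i < n) 'X_i ^+ (part la (s i) + delta (s i)))@_[multinom ladelta mu n i | i < n]
   = (-1) ^+ s * [forall i : 'I_n, part mu i + delta i == part la (s i) + delta (s i)]%N%:R :> K.
  have -> : \prod_(i < n) 'X_i ^+ (part la (s i) + delta (s i)) =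
      'X_[[multinom ladelta la n (s i) | i < n]] :> {mpoly K[n]}.
    by rewrite mpolyXE_id; apply: eq_bigr => i _; rewrite mnmE.
  rewrite mulr_sign -scaler_sign mcoeffZ mcoeffX; congr (_ * _%:R).
  congr nat_of_bool; rewrite eq_sym; apply/eqP/'forall_eqP => [E i|E].
    by have := congr1 (fun m : 'X_{1..n} => m i) E; rewrite !mnmE => ->.
  by apply/mnmP => i; rewrite !mnmE E.
under eq_bigr => s _ do rewrite co.
have key (s : 'S_n) : [forall i : 'I_n, part mu i + delta i == part la (s i) + delta (s i)]%N ->
    la = mu /\ s = 1%g.
  move/forallP => E; have le_la (nu : intpart d) (I : {set 'I_n}) :
      (\sum_(i in I) part nu i <= \sum_(i < #|I|) part nu i)%N.
    by apply: (@sum_set_le n (fun i => part nu i) (part nu) 1%g) => [i j|i]; [apply: part_mono | rewrite perm1].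
  have [dom1 h] := straight_dom mu_n (le_la la) (fun i => eqP (E i)).
  have [|dom2 _] := @straight_dom n d mu la (fun i => part mu i) (s^-1)%g la_n (le_la mu).
    by move=> i; rewrite (eqP (E _)) permKV.
  have Elm := dom_anti dom1 dom2; split=> //.
  by have [] := h (esym Elm).
case: eqP => [Elm|ne].
  rewrite (bigD1 1%g) //= odd_perm1 expr0 mul1r big1 ?addr0 => [|s s1].
    by case: forallP => // h; case: h => i; rewrite perm1 Elm.
  case E: [forall i, _]; last by rewrite mulr0.
  by have [_ Es] := key s E; rewrite Es eqxx in s1.
apply: big1 => s _; case E: [forall i, _]; last by rewrite mulr0.
by have [] := key s E.
Qed.

Lemma galt_delta_neq0 n : galt (@delta n) != 0.
Proof.
have [la0 p0] : exists la : intpart 0, forall i, part la i = 0%N.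
  by apply: (@ex_partn 0 0 (fun=> 0%N)) => //; rewrite big_ord0.
have le_n : (plen la0 <= n)%N by rewrite leq_plen p0.
apply/eqP => /(congr1 (mcoeff [multinom ladelta la0 n i | i < n])); rewrite mcoeff0.
have -> : galt (@delta n) = galt (ladelta la0 n) by apply: eq_alt => // i; rewrite p0.
by rewrite galt_coef // eqxx => /eqP; rewrite oner_eq0.
Qed.

(** Dividing by the Vandermonde determinant turns each alternant into zero or a signed Schur
    polynomial, and [gphi_inj] lifts the identity from n variables to the ring. Triangularity of an
    operator thus becomes a condition [P] on the shapes obtained by straightening exponents of
    nonzero weight. *)
Lemma lift_alt n d (a : A) (J : finType) (w : J -> K) (be : J -> 'I_n -> nat) (P : pred (intpart d)) :
  (d <= n)%N -> (d + n <= N)%N -> hspan d a ->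
  (forall j, w j != 0 -> (\sum_i be j i = d + \sum_(i < n) delta i)%N) ->
  galt (@delta n) * gphi n a = \sum_j w j *: galt (be j) ->
  (forall j la (s : 'S_n), w j != 0 -> (plen la <= n)%N ->
     (forall i : 'I_n, part la i + delta i = be j (s i))%N -> P la) ->
  lspan P sA a.
Proof.
move=> le_dn le_N ha Ebe E hP; have le_dN : (d <= N)%N by apply: leq_trans le_N; apply: leq_addr.
have exb j : exists b : A, [/\ hspan d b, lspan P sA b & w j != 0 -> galt (@delta n) * gphi n b = galt (be j)].
  have [wj0|wj] := eqVneq (w j) 0.
    by exists 0; split=> //; exact: lspan0.
  have [z|[la [s [le_n Es alt_s]]]] := alt_straighten (Ebe j wj).
    by exists 0; split=> [||_]; [exact: lspan0 | exact: lspan0 | rewrite rmorph0 mulr0 /galt z].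
  exists ((-1) ^+ s *: sA la); split=> [||_].
  - exact/lspanZ/hspan_sA.
  - exact/lspanZ/lspan_mem/(hP j la s).
  by rewrite gphiZ -scalerAr -gphi_sA // /galt alt_s scaler_sign mulr_sign.
pose b j := epsilon (inhabits 0) (fun b : A => [/\ hspan d b, lspan P sA b & w j != 0 -> galt (@delta n) * gphi n b = galt (be j)]).
have bP j : [/\ hspan d (b j), lspan P sA (b j) & w j != 0 -> galt (@delta n) * gphi n (b j) = galt (be j)] by exact: (epsilon_spec _ _ (exb j)).
suff -> : a = \sum_j w j *: b j by apply: lspan_sum => j _; apply: lspanZ; have [] := bP j.
apply/eqP; rewrite -subr_eq0; apply/eqP; apply: (gphi_inj le_dn le_dN).
  by apply: lspanD => //; apply/lspanN/lspan_sum => j _; apply: lspanZ; have [] := bP j.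
apply: (mulfI (galt_delta_neq0 n)); rewrite mulr0 rmorphB mulrBr E rmorph_sum mulr_sumr -sumrB.
apply: big1 => j _; rewrite /= gphiZ -scalerAr.
have [->|wj] := eqVneq (w j) 0; first by rewrite !scale0r subrr.
by have [_ _ ->] := bP j; rewrite ?subrr.
Qed.

(** Expanding s_ka by Jacobi-Trudi, the pairings of s_la with products of h_k are coefficients of
    the polynomial s_la; summed with signs they are the coefficient of x^(ka + delta) in s_la times
    the Vandermonde determinant, which [galt_coef] knows. *)
Lemma form_sA d (la ka : intpart d) : (d + d <= N)%N -> form d (sA la) (sA ka) = (la == ka)%:R.
Proof.
move=> le_N; have le_dN : (d <= N)%N by apply: leq_trans le_N; apply: leq_addr.
rewrite -(galt_coef (plen_le la) (plen_le ka)) gphi_sA ?plen_le //.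
rewrite /galt altE mulr_suml raddf_sum /(sA ka) JT_expand form_sumr; apply: eq_bigr => s _ /=.
rewrite !mulr_sign -!scaler_sign formZr -scalerAl mcoeffZ; congr (_ * _).
have -> : \prod_(i < d) 'X_i ^+ delta (s i) = 'X_[[multinom delta (s i) | i < d]] :> {mpoly K[d]}.
  by rewrite mpolyXE_id; apply: eq_bigr => i _; rewrite mnmE.
rewrite mulrC mcoeffMX_sub hz_prod.
(* A Vandermonde monomial fails to divide x^(ka + delta) exactly when the Jacobi-Trudi term of the
   same s has a negative index, where [hz] is 0. *)
have -> : ([multinom delta (s i) | i < d] <= [multinom ladelta ka d i | i < d])%MM
    = [forall i : 'I_d, i <= part ka i + s i]%N.
  apply/mnm_lepP/forallP => h i; have := h i; rewrite ?mnmE /delta;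
    have := ltn_ord i; have := ltn_ord (s i); lia.
case: forallP => [h|_]; last by rewrite -[0](scale0r (0 : A)) formZr mul0r.
rewrite (gphi_coef K0 _ le_dN (@hspan_sA K N d la)); congr form.
apply: eq_bigr => i _; rewrite mnmBE !mnmE; congr hgen.
by have := h i; have := ltn_ord i; have := ltn_ord (s i); rewrite /delta; lia.
Qed.

Lemma form_comb d (P : pred (intpart d)) (c : intpart d -> K) (la : intpart d) : (d + d <= N)%N ->
  form d (sA la) (\sum_(ka | P ka) c ka *: sA ka) = (P la)%:R * c la.
Proof.
move=> le_N; rewrite form_sumr.
transitivity (\sum_(ka | P ka) c ka * (la == ka)%:R).
  by apply: eq_bigr => ka _; rewrite formZr (form_sA la ka le_N).
have z ka : ka != la -> c ka * (la == ka)%:R = 0 by rewrite eq_sym => /negbTE ->; rewrite mulr0.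
case Pla: (P la).
  rewrite (bigD1 la) //= eqxx mulr1 mul1r big1 ?addr0 // => ka /andP[_]; exact: z.
by rewrite mul0r big1 // => ka Pka; rewrite z //; apply: contraTneq Pka => ->; rewrite Pla.
Qed.

Lemma lfree_sA d : (d + d <= N)%N -> lfree (fun la : intpart d => sA la).
Proof.
move=> le_N c c0 la; have := form_comb predT c la le_N.
by rewrite mul1r c0 -[0 in LHS](scale0r (0 : A)) formZr mul0r.
Qed.

(** A matrix triangular for dominance has a triangular inverse: the shapes above [la] are closed
    under going up, so [lspan_swap] applies to them. *)
Lemma dom_closed_lspan (V : lmodType K) d (a b : intpart d -> V) :
  (forall la, lspan (fun ka => dom ka la) a (b la)) -> lfree b ->
  forall la, lspan (fun ka => dom ka la) b (a la).
Proof.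
move=> ab fb la; apply: (lspan_swap (P := fun ka => dom ka la)) => //; last exact: dom_refl.
by move=> ka ka_la; apply: lspan_sub (ab ka) => nu nu_ka; apply: dom_trans nu_ka ka_la.
Qed.

Lemma domC_closed_lspan (V : lmodType K) d (a b : intpart d -> V) :
  (forall la, lspan (fun ka => dom la ka) a (b la)) -> lfree b ->
  forall la, lspan (fun ka => dom la ka) b (a la).
Proof.
move=> ab fb la; apply: (lspan_swap (P := fun ka => dom la ka)) => //; last exact: dom_refl.
by move=> ka la_ka; apply: lspan_sub (ab ka) => nu; apply: dom_trans la_ka.
Qed.

Lemma hp_sA d (la : intpart d) : (d + d <= N)%N -> lspan (fun ka => dom ka la) sA (hp la).
Proof. by move=> le_N; apply: dom_closed_lspan (lfree_sA le_N) _ => ka; apply: sA_hp. Qed.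

Lemma hspanS d (a : A) : (d + d <= N)%N -> hspan d a -> a = \sum_(la : intpart d) form d (sA la) a *: sA la.
Proof.
move=> le_N ha; have hs (la : intpart d) : lspan predT (fun ka : intpart d => sA ka) (hp la).
  by apply: lspan_sub (hp_sA la le_N).
have [c Ec] : lspan predT (fun ka : intpart d => sA ka) a.
  by apply: lspan_trans ha _ => la _; apply: hs.
rewrite {1}Ec; apply: eq_bigr => la _; congr (_ *: _).
by rewrite Ec form_comb // mul1r.
Qed.

Lemma lspan_form d (P : pred (intpart d)) (a : A) : (d + d <= N)%N ->
  lspan P sA a -> forall la, ~~ P la -> form d (sA la) a = 0.
Proof.
by move=> le_N [c ->] la /negbTE nP; rewrite form_comb // nP mul0r.
Qed.

End Lift.

(** * Diagonal operators and elementary functions *)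

Section Diagonal.
Variables (K : fieldType) (N : nat).
Hypothesis K0 : [pchar K] =i pred0.
Notation A := {mpoly K[N]}.
Notation hgen := (hgen K N).
Notation pgen := (pgen K N).
Notation hspan := (fun d => lspan predT (@hp K N d)).
Notation hp := (@hp K N _).

(** Operators diagonal in the power sums, such as omega and X |-> X (1 - z); they commute and are
    self-adjoint. *)
Definition dop (c : nat -> K) : A -> A := spec (@mpolyC N K) (fun k => c k *: pgen k).
HB.instance Definition _ c := GRing.RMorphism.on (dop c).

Lemma dopZ c x a : dop c (x *: a) = x *: dop c a.
Proof. by rewrite /dop specZ mul_mpolyC. Qed.

Lemma dop_pgen c k : (0 < k <= N)%N -> dop c (pgen k) = c k *: pgen k.
Proof. exact: spec_pgen. Qed.

Definition dweight (c : nat -> K) (m : 'X_{1..N}) : K := \prod_(i < N) c i.+1 ^+ m i.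

Lemma dopX c m : dop c 'X_[m] = dweight c m *: 'X_[m].
Proof.
rewrite {1}mpolyXE_id rmorph_prod /dweight mpolyXE_id -mul_mpolyC rmorph_prod -big_split.
apply: eq_bigr => i _; rewrite /= !rmorphXn /= -pgenE dop_pgen ?ltn_ord //.
by rewrite -mul_mpolyC exprMn.
Qed.

Lemma dop_coef c a m : (dop c a)@_m = dweight c m * a@_m.
Proof.
rewrite {1}[a]mpolyE rmorph_sum raddf_sum /=.
under eq_bigr => m' _ do rewrite dopZ mcoeffZ dopX mcoeffZ mcoeffX.
have [ma|ma] := boolP (m \in msupp a).
  rewrite (bigD1_seq m) ?msupp_uniq //= eqxx mulr1 big1 ?addr0; first exact: mulrC.
  by move=> m' /negbTE ->; rewrite !mulr0.
rewrite (memN_msupp_eq0 ma) mulr0 big_seq big1 // => m' m'a.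
case: eqP => [Em|]; last by rewrite !mulr0.
by rewrite -Em m'a in ma.
Qed.

Lemma eq_dop c c' a : (forall k, (0 < k <= N)%N -> c k = c' k) -> dop c a = dop c' a.
Proof. by move=> E; apply: eq_spec => k kN; rewrite E. Qed.

Lemma dop_comp c c' a : dop c (dop c' a) = dop (fun k => c k * c' k) a.
Proof.
apply/mpolyP => m; rewrite !dop_coef mulrA; congr (_ * _).
by rewrite -big_split; apply: eq_bigr => i _ /=; rewrite exprMn.
Qed.

Lemma dop1 c a : (forall k, (0 < k <= N)%N -> c k = 1) -> dop c a = a.
Proof.
move=> c1; apply/mpolyP => m; rewrite dop_coef /dweight big1 ?mul1r // => i _.
by rewrite c1 ?expr1n ?ltn_ord.
Qed.

Lemma hspan_dop c d a : (d <= N)%N -> hspan d a -> hspan d (dop c a).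
Proof.
move=> le_dN ha; rewrite (hspanE K0 le_dN ha) rmorph_sum; apply: lspan_sum => rho _ /=.
by rewrite dopZ dopX; apply/lspanZ/lspanZ/hspan_pp.
Qed.

Lemma form_dop c d a b : form d (dop c a) b = form d a (dop c b).
Proof. by apply: eq_bigr => rho _; rewrite !dop_coef; ring. Qed.

Lemma thetaE z a : theta z a = dop (fun k => 1 - z ^+ k) a.
Proof. by []. Qed.

Definition omegaA : A -> A := dop (fun k => (-1) ^+ k.-1).
HB.instance Definition _ := GRing.RMorphism.on omegaA.

Lemma omegaAZ x a : omegaA (x *: a) = x *: omegaA a.
Proof. exact: dopZ. Qed.

Lemma omegaAK a : omegaA (omegaA a) = a.
Proof.
by rewrite /omegaA dop_comp dop1 // => k _; rewrite -expr2 sqrr_sign.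
Qed.

Lemma form_omega d a b : form d (omegaA a) (omegaA b) = form d a b.
Proof. by rewrite /omegaA form_dop -/(omegaA _) -/(omegaA _) omegaAK. Qed.

(** Homogeneity of total degree d, where the polynomial variable u counts as degree 1. *)
Definition tspan d (p : {poly A}) :=
  forall k, ((k <= d)%N -> hspan (d - k)%N p`_k) /\ ((d < k)%N -> p`_k = 0).

Lemma tspan1 : tspan 0 1.
Proof.
move=> [|k]; split=> // _; last by rewrite coef1.
by rewrite coef1; apply: hspan1.
Qed.

Lemma tspanM d e p q : tspan d p -> tspan e q -> tspan (d + e) (p * q).
Proof.
move=> hp hq k; split=> [le_k|lt_k]; rewrite coefM; last first.
  apply: big1 => j _; have [le_jd|lt_dj] := leqP j d; last by rewrite (hp j).2 // mul0r.
  by rewrite (hq (k - j)%N).2 ?mulr0 //; lia.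
apply: lspan_sum => j _; have [le_jd|lt_dj] := leqP j d; last first.
  by rewrite (hp j).2 // mul0r; apply: lspan0.
have [le_e|lt_e] := leqP (k - j) e; last first.
  by rewrite (hq (k - j)%N).2 // mulr0; apply: lspan0.
have -> : (d + e - k = d - j + (e - (k - j)))%N by have := ltn_ord j; lia.
by apply: hspanM; [apply: (hp j).1 | apply: (hq (k - j)%N).1].
Qed.

Lemma tspan_tau_hgen y b : (b <= N)%N -> tspan b (tau y (hgen b)).
Proof.
move=> le_bN k; rewrite tau_hgen // coef_sum.
have co (j : 'I_b.+1) : (poly_const N (wcoef y j) * 'X^j * (hgen (b - j))%:P)`_k =
    (k == j :> nat)%:R * (wcoef y j *: hgen (b - j)).
  rewrite coefMC /poly_const coefCM coefXn -mul_mpolyC.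
  by case: eqP => _ /=; rewrite ?mulr1 ?mul1r // mulr0 !mul0r.
under eq_bigr => j _ do rewrite co.
split=> [le_kb|lt_bk].
  rewrite (bigD1 (inord k)) //= inordK // eqxx mul1r big1 ?addr0.
    exact/lspanZ/hspan_hgen.
  move=> j; rewrite -val_eqE /= inordK // => /negbTE; rewrite eq_sym => ->.
  by rewrite mul0r.
apply: big1 => j _; have -> : (k == j :> nat) = false by have := ltn_ord j; lia.
by rewrite mul0r.
Qed.

Lemma tspan_tau y d a : (d <= N)%N -> hspan d a -> tspan d (tau y a).
Proof.
move=> le_dN ha; have hh (mu : intpart d) : tspan d (tau y (hp mu)).
  rewrite rmorph_prod.
  suff h k : tspan (\sum_(i < k) part mu i) (\prod_(i < k) tau y (hgen (part mu i))).
    by have := h d; rewrite (sum_part mu (leqnn d)).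
  elim: k => [|k IHk]; first by rewrite !big_ord0; apply: tspan1.
  rewrite !big_ord_recr /=; apply: tspanM => //; apply: tspan_tau_hgen.
  exact: leq_trans (part_le _ _) le_dN.
case: ha => c -> k; rewrite rmorph_sum coef_sum; split=> h.
  by apply: lspan_sum => mu _; rewrite /= tauZ coefZ mul_mpolyC; apply/lspanZ/(hh mu k).1.
by apply: big1 => mu _; rewrite /= tauZ coefZ (hh mu k).2 // mulr0.
Qed.

Lemma hspan_vertex z y r d a : (r + d <= N)%N -> hspan d a -> hspan (r + d)%N (vertex z y r a).
Proof.
move=> le_N ha; have le_dN : (d <= N)%N by apply: leq_trans le_N; apply: leq_addl.
apply: lspan_sum => k _; have [le_kd|lt_dk] := leqP k d; last first.
  by rewrite (tspan_tau y le_dN ha k).2 // mulr0; apply: lspan0.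
have -> : (r + d = r + k + (d - k))%N by lia.
apply: hspanM; last exact: (tspan_tau y le_dN ha k).1.
by rewrite thetaE; apply: (@hspan_dop _ (r + k)); [lia | exact: hspan_hgen].
Qed.

Lemma tau_bound y r d a : (r + d <= N)%N -> hspan d a ->
  forall k, (N < r + k)%N -> (tau y a)`_k = 0.
Proof.
move=> le_N ha k lt_k; have le_dN : (d <= N)%N by apply: leq_trans le_N; apply: leq_addl.
by apply: (tspan_tau y le_dN ha k).2; lia.
Qed.

(* the elementary function e_ka *)
Definition ep d (ka : intpart d) : A := omegaA (hp ka).

(** The signed power sums are - \sum_i (- x_i)^k, so the h-series is \prod_i (1 + x_i X), expanded
    over subsets. *)
Lemma phi_omega_hgen (F : idomainType) (f : {rmorphism K -> F}) n (x : 'I_n -> F) k :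
  (k <= N)%N -> phi f x (omegaA (hgen k)) =
  \sum_(S : {ffun 'I_n -> bool} | (\sum_i S i == k)%N) \prod_i x i ^+ S i.
Proof.
move=> le_kN; rewrite /omegaA /dop (spec_spec _ _ (f' := f)) /= => [|c]; last by rewrite /phi specC.
rewrite (eq_spec _ (pi' := fun k => - \sum_i (- x i) ^+ k)); last first.
  move=> j /andP[j_gt0 le_jN]; rewrite /phi /= specZ spec_pgen ?j_gt0 //.
  rewrite mulr_sumr -sumrN; apply: eq_bigr => i _; rewrite rmorphXn rmorphN rmorph1.
  by case: j j_gt0 le_jN => [|j] // _ _ /=; rewrite [(- x i) ^+ _]exprNn [(-1) ^+ j.+1]exprS; ring.
rewrite (spec_hgen K0 f (newton_prod N (index_enum 'I_n) predT (fun i => - x i)) le_kN).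
have -> : \prod_(i < n) (1 - (- x i) *: 'X) = \prod_(i < n) \sum_(b : bool) (if b then x i *: 'X else 1).
  by apply: eq_bigr => i _; rewrite big_bool /= scaleNr opprK addrC.
rewrite bigA_distr_bigA coef_sum [RHS]big_mkcond /=; apply: eq_bigr => S _.
have -> : \prod_(i < n) (if S i then x i *: 'X else 1) = (\prod_i x i ^+ S i) *: 'X^(\sum_i S i).
  rewrite -prodrXr -mul_polyC rmorph_prod -big_split; apply: eq_bigr => i _ /=.
  by case: (S i); rewrite ?expr1 ?expr0 ?mul1r // mul_polyC.
by rewrite coefZ coefXn eq_sym; case: eqP => _; rewrite ?mulr1 ?mulr0.
Qed.

(** A 0-1 matrix: row b records the variables chosen in the factor e_(ka_b), and the column sums
    [fcnt] are the exponents of the resulting monomial. *)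
Definition filling d n := {ffun 'I_d -> {ffun 'I_n -> bool}}.
Definition fcnt d n (T : filling d n) (i : 'I_n) : nat := (\sum_b T b i)%N.
Definition fok d n (ka : intpart d) (T : filling d n) : bool :=
  [forall b : 'I_d, (\sum_i T b i)%N == part ka b].

Lemma phi_ep (F : idomainType) (f : {rmorphism K -> F}) n (x : 'I_n -> F) d (ka : intpart d) :
  (d <= N)%N -> phi f x (ep ka) = \sum_(T : filling d n | fok ka T) \prod_i x i ^+ fcnt T i.
Proof.
move=> le_dN; rewrite /ep /(hp _) !rmorph_prod /=.
under [LHS]eq_bigr => b _ do rewrite phi_omega_hgen ?(leq_trans (part_le _ _)) //.
rewrite bigA_distr_big_dep; apply: eq_big => [T|T _].
  by apply/familyP/forallP => h b; have := h b; rewrite ?inE.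
rewrite exchange_big; apply: eq_bigr => i _ /=.
by rewrite /fcnt -prodrXr.
Qed.

Lemma fok_sum d n (ka : intpart d) (T : filling d n) : fok ka T -> (\sum_i fcnt T i = d)%N.
Proof.
move/forallP => h; rewrite /fcnt exchange_big /=.
by under eq_bigr => b _ do rewrite (eqP (h b)); rewrite sum_part.
Qed.

(** The Gale-Ryser inequality: row b meets the columns I in at most min(la'_b, #|I|) places. *)
Lemma fok_dom d n (la : intpart d) (T : filling d n) (I : {set 'I_n}) : fok (conjp la) T ->
  (\sum_(i in I) fcnt T i <= \sum_(i < #|I|) part la i)%N.
Proof.
move/forallP => h; rewrite -[in X in (_ <= X)%N](conjK la) sum_conj /fcnt exchange_big /=.
apply: leq_sum => b _; rewrite leq_min -{1}(eqP (h b)); apply/andP; split.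
  by rewrite [X in (_ <= X)%N](bigID (mem I)) /= leq_addr.
by rewrite -sum1_card; apply: leq_sum => i _; apply: leq_b1.
Qed.

Definition fperm d n (s : 'S_n) (T : filling d n) : filling d n :=
  [ffun b => [ffun i => T b ((s^-1)%g i)]].

Lemma fcnt_perm d n (s : 'S_n) (T : filling d n) i : fcnt (fperm s T) (s i) = fcnt T i.
Proof. by apply: eq_bigr => b _; rewrite !ffunE permK. Qed.

Lemma fpermK d n (s : 'S_n) : cancel (@fperm d n s) (@fperm d n (s^-1)%g).
Proof.
by move=> T; apply/ffunP => b; apply/ffunP => i; rewrite !ffunE invgK permK.
Qed.

Lemma fok_perm d n (s : 'S_n) (ka : intpart d) (T : filling d n) : fok ka (fperm s T) = fok ka T.
Proof.
apply: eq_forallb => b; congr (_ == _); rewrite (reindex_inj (@perm_inj _ s)) /=.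
by apply: eq_bigr => i _; rewrite !ffunE permK.
Qed.

(** Permuting columns preserves row sums, so a signed sum over s can be moved from the staircase to
    the whole exponent, where it forms alternants. *)
Lemma alt_fillings (B : comNzRingType) n (x : 'I_n -> B) d (ka : intpart d) (Psi : filling d n -> B) :
  \sum_(T : filling d n | fok ka T) \sum_(s : 'S_n)
     (-1) ^+ s * (\prod_i x i ^+ (fcnt T i + delta (s i))) * Psi (fperm s T) =
  \sum_(T : filling d n | fok ka T) Psi T * alt x (fun i => fcnt T i + delta i)%N.
Proof.
rewrite exchange_big /=; under [RHS]eq_bigr => T _ do rewrite altE mulr_sumr.
rewrite [RHS]exchange_big; apply: eq_bigr => s _ /=.
have fperm_inj : injective (@fperm d n s) := can_inj (@fpermK d n s).
rewrite [RHS](reindex_inj fperm_inj) /=; apply: eq_big => [T|T _]; first by rewrite fok_perm.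
rewrite mulrC; congr (_ * (_ * _)); apply: eq_bigr => i _.
by rewrite fcnt_perm.
Qed.

Lemma alt_ep (F : idomainType) (f : {rmorphism K -> F}) n (x : 'I_n -> F) d (ka : intpart d) :
  (d <= N)%N -> alt x (@delta n) * phi f x (ep ka) =
  \sum_(T : filling d n | fok ka T) alt x (fun i => fcnt T i + delta i)%N.
Proof.
move=> le_dN; rewrite phi_ep //.
under [RHS]eq_bigr => T _ do rewrite -[alt _ _]mul1r.
rewrite -(alt_fillings x ka (fun=> 1)) mulr_sumr; apply: eq_bigr => T _.
rewrite altE mulr_suml; apply: eq_bigr => s _; rewrite mulr1 -mulrA; congr (_ * _).
by rewrite -big_split; apply: eq_bigr => i _ /=; rewrite addnC exprD.
Qed.

End Diagonal.

Lemma thetaV_aux (F : fieldType) (a e : F) : e ^+ 2 = 1 -> a != 0 ->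
  1 - a^-1 = -1 * e * a^-1 * ((1 - a) * e).
Proof.
move=> e2 a0; transitivity (- (1 - a) / a * e ^+ 2); first by rewrite e2; field.
by field.
Qed.

Section Homogeneous.
Variables (K : fieldType) (N : nat).
Hypothesis K0 : [pchar K] =i pred0.
Variable d : nat.
Hypothesis le_dN : (d <= N)%N.
Notation pp := (@pp K N _).
Notation pm := (@pm N _).
Notation hspan := (fun d => lspan predT (@hp K N d)).

Lemma dweight_pm (c : nat -> K) (la : intpart d) :
  dweight c (pm la) = \prod_(i < d | (0 < part la i)%N) c (part la i).
Proof.
have E : dop c (pp la) = (\prod_(i < d | (0 < part la i)%N) c (part la i)) *: pp la.
  rewrite ppE // rmorph_prod -mul_mpolyC rmorph_prod [X in X * _]big_mkcond -big_split.
  apply: eq_bigr => i _ /=; case: posnP => [_|gt0] /=; first by rewrite !rmorph1 mul1r.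
  rewrite dop_pgen ?mul_mpolyC // gt0 /=.
  by apply: leq_trans (part_le _ _) le_dN.
have := congr1 (mcoeff (pm la)) E; rewrite /(pp _) dopX !mcoeffZ !mcoeffX eqxx !mulr1.
exact.
Qed.

Lemma dop_homog (c : K) e f : hspan d f ->
  dop (fun k => c ^+ k * e k) f = c ^+ d *: dop e f.
Proof.
move=> hf; have hd : hspan d (dop e f) by apply: hspan_dop.
rewrite -[LHS](dop_comp (fun k => c ^+ k) e).
rewrite {1}(hspanE K0 le_dN hd) [in RHS](hspanE K0 le_dN hd) scaler_sumr rmorph_sum.
apply: eq_bigr => rho _ /=; rewrite dopZ dopX !scalerA mulrC; congr (_ * _ *: _).
rewrite dweight_pm -[in RHS](sum_part rho (leqnn d)) -prodrXr [LHS]big_mkcond.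
by apply: eq_bigr => i _; case: posnP => [->|].
Qed.

(** From 1 - q^-k = (- q^-1)^k (-1)^(k - 1) (1 - q^k). Vanishing conditions at parameter q become
    conditions at 1/q on conjugate shapes. *)
Lemma thetaV q f : q != 0 -> hspan d f ->
  theta q^-1 f = (- q^-1) ^+ d *: theta q (omegaA f).
Proof.
move=> q0 hf; rewrite !thetaE /(omegaA _) dop_comp -dop_homog //; apply: eq_dop => -[|k] // _.
have -> : (- q^-1) ^+ k.+1 = -1 * (-1) ^+ k * (q ^+ k.+1)^-1 by rewrite (exprNn q^-1) exprVn (exprS (-1)).
rewrite exprVn /=.
by apply: thetaV_aux; [exact: sqrr_sign | exact: expf_neq0].
Qed.

End Homogeneous.

(** * The Macdonald operator *)

Lemma frac_var_inj (K : fieldType) n : injective (fun i : 'I_n => tofrac ('X_i : {mpoly K[n]})).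
Proof.
move=> i j /eqP; rewrite tofrac_eq => /eqP /(congr1 (mcoeff U_(i))) /eqP.
rewrite !mcoeffX eqxx; case: (U_(j) =P U_(i))%MM => [/mnmP/(_ i)|_]; last by rewrite oner_eq0.
by rewrite !mnm1E eqxx; case: eqP.
Qed.

Lemma frac_var_neq0 (K : fieldType) n (i : 'I_n) : tofrac ('X_i : {mpoly K[n]}) != 0.
Proof.
rewrite tofrac_eq0; apply/eqP => /(congr1 (mcoeff U_(i))) /eqP.
by rewrite mcoeffX eqxx mcoeff0 oner_eq0.
Qed.

Section Cofactor.
Variables (F : fieldType) (n : nat) (x : 'I_n.+1 -> F) (i : 'I_n.+1).
Hypothesis x_inj : injective x.

Let M := \matrix_(r < n.+1, c < n.+1) x r ^+ delta c.

(* the determinant of the alternant as a polynomial in its [i]-th variable *)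
Let p : {poly F} := \sum_c cofactor M i c *: 'X^(delta c).

Let horner_p j : p.[x j] = alt x (@delta n.+1) * (j == i)%:R.
Proof.
have := congr1 (fun B : 'M_n.+1 => B j i) (mul_mx_adj M); rewrite !mxE => E.
rewrite mulr_natr -[RHS]E horner_sum; apply: eq_bigr => c _.
by rewrite hornerZ hornerXn !mxE mulrC.
Qed.

Let alt' := (-1) ^+ i * alt (fun j => x (lift i j)) (@delta n).

(** The other variables are roots of [p], and its coefficient of degree n is a cofactor, up to sign
    the Vandermonde determinant of these variables. *)
Let pE : p = alt' *: \prod_(j < n) ('X - (x (lift i j))%:P).
Proof.
pose rs := [seq x (lift i j) | j <- enum 'I_n].
have -> : \prod_(j < n) ('X - (x (lift i j))%:P) = \prod_(a <- rs) ('X - a%:P).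
  by rewrite big_map big_enum.
have size_rs : size rs = n by rewrite size_map size_enum_ord.
have pn : p`_n = alt'.
  rewrite coef_sum (bigD1 ord0) //= big1 ?addr0 => [|c].
    rewrite coefZ coefXn /delta /= subSS subn0 eqxx mulr1 /cofactor addn0; congr (_ * \det _).
    by apply/matrixP => r c; rewrite !mxE; congr (_ ^+ _); rewrite /delta /= /bump; lia.
  rewrite -val_eqE /= => c0; rewrite coefZ coefXn.
  have -> : (n == delta c) = false by have := ltn_ord c; rewrite /delta; lia.
  by rewrite mulr0.
apply/eqP; rewrite -subr_eq0; apply/eqP; set P := _ - _.
have size_P1 : (size P <= n.+1)%N.
  apply: leq_trans (size_polyD _ _) _; rewrite size_polyN geq_max; apply/andP; split.
    apply: leq_trans (size_sum _ _ _) _; apply/bigmax_leqP => c _.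
    apply: leq_trans (size_scale_leq _ _) _; rewrite size_polyXn /delta; lia.
  by apply: leq_trans (size_scale_leq _ _) _; rewrite size_prod_XsubC size_rs.
have lead1 : (\prod_(a <- rs) ('X - a%:P))`_n = 1.
  have /monicP := monic_prod_XsubC rs predT id; rewrite /lead_coef size_prod_XsubC size_rs; exact.
have Pn : P`_n = 0 by rewrite coefB coefZ lead1 mulr1 pn subrr.
have size_P : (size P <= n)%N.
  by apply/leq_sizeP => j; rewrite leq_eqVlt => /predU1P[<- // | /(leq_sizeP _ _ size_P1)].
apply/eqP; apply: contraTT size_P; rewrite -ltnNge => P_neq0.
rewrite -size_rs; apply: (max_poly_roots P_neq0); last first.
  by rewrite map_inj_uniq ?enum_uniq // => j k /x_inj /lift_inj.
apply/allP => _ /mapP[j _ ->]; rewrite rootE hornerD hornerN hornerZ horner_p.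
rewrite [lift i j == i]eq_sym (negbTE (neq_lift i j)) mulr0 sub0r horner_prod.
rewrite (_ : \prod_(a <- rs) _ = 0) ?mulr0 ?oppr0 //.
rewrite big_map big_enum /= (bigD1 j) //=.
by rewrite hornerD hornerN hornerX hornerC subrr mul0r.
Qed.

Let altE' : alt x (@delta n.+1) = alt' * \prod_(j < n) (x i - x (lift i j)).
Proof.
have := horner_p i; rewrite eqxx mulr1 => <-; rewrite pE hornerZ horner_prod.
by congr (_ * _); apply: eq_bigr => j _; rewrite hornerD hornerN hornerX hornerC.
Qed.

Lemma alt_pfcoef z : alt x (@delta n.+1) * pfcoef x z i =
  alt' * \prod_(j < n) (x i - z * x (lift i j)).
Proof.
have -> : pfcoef x z i = \prod_(j < n) ((x i - z * x (lift i j)) / (x i - x (lift i j))).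
  rewrite /pfcoef big_mkcond (bigD1_ord i) //= eqxx mul1r; apply: eq_bigr => j _.
  by rewrite eq_sym neq_lift.
rewrite altE' -mulrA -big_split; congr (_ * _); apply: eq_bigr => j _ /=.
rewrite mulrC divfK // subr_eq0; apply/eqP => /x_inj E.
by have := neq_lift i j; rewrite -E eqxx.
Qed.

(** \prod_j (x_i - z x_j) is z^n \prod_j (x_i / z - x_j), so this is z^n times the Vandermonde
    determinant with x_i / z for x_i. As c + delta c = n, column c of row i is multiplied by z^c. *)
Lemma alt_pfcoef_det z : z != 0 -> alt x (@delta n.+1) * pfcoef x z i =
  \sum_(s : 'S_n.+1) (-1) ^+ s * (\prod_r x r ^+ delta (s r)) * z ^+ s i.
Proof.
move=> z0; rewrite alt_pfcoef; pose M' := \matrix_(r < n.+1, c < n.+1)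
  (x r ^+ delta c * (if r == i then z ^+ c else 1)).
transitivity (\det M'); last first.
  apply: eq_bigr => s _; rewrite -mulrA; congr (_ * _).
  under eq_bigr => r _ do rewrite mxE.
  rewrite big_split /=; congr (_ * _).
  by rewrite (bigD1 i) //= eqxx big1 ?mulr1 // => r /negbTE ->.
transitivity (z ^+ n * p.[x i / z]).
  rewrite pE hornerZ horner_prod mulrCA; congr (_ * _).
  have -> : z ^+ n = \prod_(j < n) z by rewrite prodr_const card_ord.
  rewrite -big_split; apply: eq_bigr => j _ /=.
  by rewrite hornerD hornerN hornerX hornerC mulrBr mulrCA divff // mulr1.
rewrite horner_sum mulr_sumr (expand_det_row _ i); apply: eq_bigr => c _.
rewrite hornerZ hornerXn mxE eqxx mulrCA mulrC; congr (_ * _).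
  have le_c : (c <= n)%N by rewrite -ltnS.
  have Ec : n = (c + delta c)%N by rewrite /delta; lia.
  by rewrite {1}Ec exprD expr_div_n; field; rewrite expf_neq0.
congr (_ * \det _); apply/matrixP => r c'; rewrite !mxE.
by rewrite eq_sym (negbTE (neq_lift _ _)) mulr1.
Qed.

End Cofactor.

Section Macdonald.
Variables (K : fieldType) (N : nat).
Hypothesis K0 : [pchar K] =i pred0.
Notation A := {mpoly K[N]}.
Notation hspan := (fun d => lspan predT (@hp K N d)).
Notation sA := (@sA K N _).
Notation ep := (@ep K N _).
Notation gphi := (@gphi K N).
Notation vertex := (@vertex K N).

(** The i-th summand of the operator multiplies a monomial of e_ka times the Vandermonde term of s
    by q^(s i) t^(fcnt i). Permuting fillings along with variables replaces s i by i, so each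
    alternant is multiplied by a number depending on its own exponents only. *)
Lemma alt_vertex_ep (F : fieldType) (f : {rmorphism K -> F}) n (x : 'I_n.+1 -> F) q t d (ka : intpart d) :
  injective x -> (forall i, x i != 0) -> q != 0 -> (d <= N)%N ->
  alt x (@delta n.+1) * phi f x (vertex q t 0 (ep ka)) =
  \sum_(T : filling d n.+1 | fok ka T)
    (f q ^+ n.+1 + (1 - f q) * \sum_(j < n.+1) f q ^+ j * f t ^+ fcnt T j) *
      alt x (fun i => fcnt T i + delta i)%N.
Proof.
move=> x_inj x0 q0 le_dN; have fq0 : f q != 0 by rewrite fmorph_eq0.
have hep : hspan d (ep ka) by apply: hspan_dop => //; apply: lspan_mem.
rewrite phi_vertex //; last exact: (@tau_bound _ _ K0 t 0 d _ le_dN hep).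
rewrite mulrDr mulr1 mulrCA alt_ep // [X in _ + X]mulrCA.
under [RHS]eq_bigr => T _ do rewrite mulrDl -[(1 - f q) * _ * _]mulrA.
rewrite big_split /= -!mulr_sumr; congr (_ + _ * _).
rewrite -alt_fillings mulr_sumr.
have E i : alt x (@delta n.+1) * (pfcoef x (f q) i * x i ^+ 0 * phi f (subst1 x i (f t * x i)) (ep ka)) =
  \sum_(T : filling d n.+1 | fok ka T) \sum_(s : 'S_n.+1)
    (-1) ^+ s * (\prod_r x r ^+ (fcnt T r + delta (s r))) * (f q ^+ s i * f t ^+ fcnt T i).
  rewrite expr0 mulr1 mulrA alt_pfcoef_det // phi_ep // mulr_sumr; apply: eq_bigr => T _.
  have -> : \prod_r subst1 x i (f t * x i) r ^+ fcnt T r = f t ^+ fcnt T i * \prod_r x r ^+ fcnt T r.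
    rewrite (bigD1 i) //= [X in _ = _ * X](bigD1 i) //= /subst1 eqxx exprMn -mulrA; congr (_ * (_ * _)).
    by apply: eq_bigr => r /negbTE ->.
  rewrite mulr_suml; apply: eq_bigr => s _.
  have -> : \prod_r x r ^+ (fcnt T r + delta (s r)) = (\prod_r x r ^+ fcnt T r) * \prod_r x r ^+ delta (s r).
    by rewrite -big_split; apply: eq_bigr => r _; rewrite exprD.
  move: (\prod_r _) (\prod_r _) (f q ^+ _) (f t ^+ _) ((-1) ^+ s) => u v a b e.
  by ring.
under eq_bigr => i _ do rewrite E.
rewrite exchange_big; apply: eq_bigr => T _; rewrite exchange_big; apply: eq_bigr => s _ /=.
rewrite -mulr_sumr; congr (_ * _); rewrite [RHS](reindex_inj (@perm_inj _ s)) /=.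
by apply: eq_bigr => i _; rewrite fcnt_perm.
Qed.

Lemma gphi_frac n (a : A) :
  phi (@tofrac {mpoly K[n]} \o @mpolyC n K) (fun i : 'I_n => tofrac ('X_i : {mpoly K[n]})) a = tofrac (gphi n a).
Proof.
rewrite /gphi /phi (spec_spec _ _ (f' := @tofrac {mpoly K[n]} \o @mpolyC n K)) //.
by apply: eq_spec => k _; rewrite rmorph_sum; apply: eq_bigr => i _; rewrite rmorphXn.
Qed.

(* the eigenvalue of [vertex q t 0] attached to [la] *)
Definition eig (q t : K) d (la : intpart d) : K :=
  1 - (1 - q) * (1 - t) * \sum_(j < d) \sum_(i < d | (i < part la j)%N) q ^+ j * t ^+ i.

Lemma eig_conj q t d (la : intpart d) : eig t q (conjp la) = eig q t la.
Proof.
rewrite /eig; congr (1 - _ * _); first by rewrite mulrC.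
rewrite (exchange_big_dep predT) //=; apply: eq_bigr => j _; apply: eq_big => i.
  by rewrite conj_gt.
by rewrite mulrC.
Qed.

(** The eigenvalue does not depend on the number of variables: expanding 1 - q^n geometrically, the
    terms of the empty rows cancel. *)
Lemma eigE q t d (la : intpart d) n : (d <= n)%N ->
  q ^+ n + (1 - q) * \sum_(j < n) q ^+ j * t ^+ part la j = eig q t la.
Proof.
move=> le_dn; have geom (y : K) k : 1 - y ^+ k = (1 - y) * \sum_(i < k) y ^+ i.
  by rewrite -opprB subrX1 -mulNr opprB.
have -> : q ^+ n = 1 - (1 - q) * \sum_(i < n) q ^+ i by rewrite -geom opprB addrC subrK.
rewrite -addrA -mulrN -mulrDr -sumrN -big_split /= /eig -mulrA -mulrN; congr (1 + _ * _).
rewrite mulr_sumr -sumrN.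
rewrite (@big_widen0 _ _ _ (fun j => - q ^+ j + q ^+ j * t ^+ part la j) d) //; last first.
  by move=> i le_di; rewrite part_big // expr0 mulr1 addNr.
apply: eq_bigr => j _; rewrite -mulr_sumr mulrCA.
rewrite (@big_ord_lt _ _ _ _ _ (fun i => t ^+ i) (part_le la j)) -geom; ring.
Qed.

(** After subtracting the eigenvalue of la, the fillings with column sums la have weight zero. By
    Gale-Ryser all others straighten to shapes strictly below la. *)
Lemma vertex_ep d (la : intpart d) q t : q != 0 -> (d + d.+1 <= N)%N ->
  lspan (fun mu => dom la mu && (mu != la)) sA
    (vertex q t 0 (ep (conjp la)) - eig q t la *: ep (conjp la)).
Proof.
move=> q0 le_N; have le_dN : (d <= N)%N by apply: leq_trans le_N; apply: leq_addr.
have hep : hspan d (ep (conjp la)) by apply: hspan_dop => //; apply: lspan_mem.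
pose w (T : filling d d.+1) := if fok (conjp la) T then
  q ^+ d.+1 + (1 - q) * (\sum_(j < d.+1) q ^+ j * t ^+ fcnt T j) - eig q t la else 0.
(* [lift_alt] asks for at least d variables; the form d + 1 allows the operator to single one
   out. *)
apply: (@lift_alt _ _ K0 d.+1 d _ (filling d d.+1) w (fun T i => fcnt T i + delta i)%N _ (leqnSn d) le_N).
- apply: lspanD; last exact/lspanN/lspanZ.
  by have := @hspan_vertex _ _ K0 q t 0 d _ le_dN hep; rewrite add0n.
- move=> T; rewrite /w; case: ifP => [ok_T _|_]; last by rewrite eqxx.
  by rewrite big_split /= (fok_sum ok_T).
- have x_inj := @frac_var_inj K d.+1; have x0 := @frac_var_neq0 K d.+1.
  have h1 := alt_vertex_ep (@tofrac {mpoly K[d.+1]} \o @mpolyC d.+1 K) t (conjp la) x_inj x0 q0 le_dN.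
  have h2 := alt_ep K0 (@tofrac {mpoly K[d.+1]} \o @mpolyC d.+1 K) (fun i : 'I_d.+1 => tofrac ('X_i : {mpoly K[d.+1]})) (conjp la) le_dN.
  apply/eqP; rewrite -tofrac_eq rmorphB rmorphM rmorphB /= gphiZ mulrBr; apply/eqP.
  rewrite /galt rmorph_alt -!gphi_frac h1 -mul_mpolyC rmorphM /= mulrCA -gphi_frac h2 mulr_sumr -sumrB.
  rewrite rmorph_sum [LHS]big_mkcond; apply: eq_bigr => T _; rewrite /w /= /galt.
  case: ifP => ok_T; last by rewrite scale0r rmorph0.
  rewrite -mulrBl -mul_mpolyC rmorphM /= rmorph_alt; congr (_ * _).
  rewrite !(rmorphB, rmorphD, rmorphM, rmorphXn, rmorph1, rmorph_sum) /=; congr (_ + _ * _ - _).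
  by apply: eq_bigr => j _; rewrite !(rmorphM, rmorphXn).
move=> T mu s wT mu_n Es; move: wT; rewrite /w; case: ifP => [ok_T wT|_]; last by rewrite eqxx.
have [dom_lm h] := straight_dom mu_n (fun I => fok_dom I ok_T) Es.
rewrite dom_lm /=; apply: contraNneq wT => Emu; have [_ Ec] := h Emu.
rewrite -(eigE q t la (leqnSn d)) subr_eq0; apply/eqP; congr (_ + _ * _).
by apply: eq_bigr => j _; rewrite Ec.
Qed.

Lemma ep_sA d (la : intpart d) : (d + d.+1 <= N)%N ->
  lspan (fun mu => dom la mu) sA (ep (conjp la)).
Proof.
move=> le_N; have le_dN : (d <= N)%N by apply: leq_trans le_N; apply: leq_addr.
apply: (@lift_alt _ _ K0 d.+1 d _ (filling d d.+1) (fun T => (fok (conjp la) T)%:R)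
  (fun T i => fcnt T i + delta i)%N _ (leqnSn d) le_N).
- by apply: hspan_dop => //; apply: lspan_mem.
- by move=> T; case ok_T: (fok _ T); rewrite ?eqxx // => _; rewrite big_split /= (fok_sum ok_T).
- rewrite /galt /gphi alt_ep // big_mkcond; apply: eq_bigr => T _.
  by case: ifP; rewrite ?scale1r ?scale0r.
move=> T mu s; case ok_T: (fok _ T); rewrite ?eqxx // => _ mu_n Es.
by have [] := straight_dom mu_n (fun I => fok_dom I ok_T) Es.
Qed.

End Macdonald.

(** * The involution omega on Schur functions *)

Section OmegaSchur.
Variables (K : fieldType) (N : nat).
Hypothesis K0 : [pchar K] =i pred0.
Notation hgen := (hgen K N).
Notation hp := (@hp K N _).
Notation sA := (@sA K N _).
Notation ep := (@ep K N _).
Notation gphi := (@gphi K N).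
Notation omegaA := (@omegaA K N).

Lemma form_disjoint d (P Q : pred (intpart d)) a b : (d + d <= N)%N ->
  lspan P sA a -> lspan Q sA b -> (forall la, P la -> ~~ Q la) -> form d a b = 0.
Proof.
move=> le_N Pa [c ->] PQ; rewrite form_sumr big1 // => la Qla.
rewrite formZr form_sym (lspan_form K0 le_N Pa) ?mulr0 //.
by apply/negP => /PQ; rewrite Qla.
Qed.

Lemma hp_sub_sA d (la : intpart d) : (d + d <= N)%N ->
  lspan (fun ka => dom ka la && (ka != la)) sA (hp la - sA la).
Proof.
move=> le_N; rewrite -opprB; apply: lspanN; apply: (lspan_trans (sA_sub_hp K N la)) => ka /andP[h1 h2].
apply: (lspan_sub _ (hp_sA K0 ka le_N)) => mu h3; rewrite (dom_trans h3 h1) /=.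
by apply: contraNneq h2 => E; rewrite -E in h1 *; rewrite (dom_anti h1 h3).
Qed.

Let w d (la : intpart d) := omegaA (sA (conjp la)).

Let w_ep d (la : intpart d) : (d + d.+1 <= N)%N ->
  lspan (fun nu => dom la nu && (nu != la)) sA (w la - ep (conjp la)).
Proof.
move=> le_N; rewrite /w /(ep _) -rmorphB; case: (sA_sub_hp K N (conjp la)) => c ->.
rewrite rmorph_sum; apply: lspan_sum => ka /andP[h1 h2] /=; rewrite omegaAZ; apply: lspanZ.
have := @ep_sA K N K0 d (conjp ka) le_N; rewrite conjK; apply: lspan_sub => mu h3.
have h4 := dom_conj h1; rewrite conjK in h4; rewrite (dom_trans h4 h3) /=.
apply: contraNneq h2 => E; rewrite E in h3.
by rewrite -(dom_anti h3 h4) conjK.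
Qed.

Let w_dom d (la : intpart d) : (d + d.+1 <= N)%N -> lspan (fun nu => dom la nu) sA (w la).
Proof.
move=> le_N; rewrite -[w la](subrK (ep (conjp la))); apply: lspanD; last exact: ep_sA.
by apply: (lspan_sub _ (w_ep la le_N)) => nu /andP[].
Qed.

(** As omega is an isometry, the [w la] are orthonormal. Being triangular in the orthonormal Schur
    basis, they are diagonal with entries of square 1, by induction along dominance. *)
Let w_diag d (la : intpart d) : (d + d.+1 <= N)%N -> exists2 e : K, w la = e *: sA la & e ^+ 2 = 1.
Proof.
move=> le_N; have le_N' : (d + d <= N)%N by apply: leq_trans le_N; rewrite addnS.
have ww (ka mu : intpart d) : form d (w ka) (w mu) = (ka == mu)%:R.
  by rewrite form_omega form_sA // (inj_eq (@conj_inj d)).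
have [n] := ubnP #|[pred ka | dom la ka]|; elim: n la => // n IHn la; rewrite ltnS => le_n.
have IH ka : dom la ka -> ka != la -> form d (w la) (sA ka) = 0.
  move=> h1 h2; have [|e Ee e2] := IHn ka.
    apply: leq_trans le_n; apply: proper_card; apply/properP; split.
      by apply/subsetP => mu; rewrite !inE; apply: dom_trans.
    exists la; rewrite !inE ?dom_refl //; apply/negP => h3.
    by move: h2; rewrite (dom_anti h3 h1) eqxx.
  have := ww la ka; rewrite Ee formZr eq_sym (negbTE h2) => /eqP.
  rewrite mulf_eq0 => /orP[/eqP e0|/eqP //].
  by move/eqP: e2; rewrite e0 expr0n eq_sym oner_eq0.
case: (w_dom la le_N) => c Ec.
have ck ka : dom la ka -> ka != la -> c ka = 0.
  by move=> h1 h2; have := IH ka h1 h2; rewrite form_sym Ec form_comb // h1 mul1r.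
have E : w la = c la *: sA la.
  rewrite Ec (bigD1 la) ?dom_refl //= big1 ?addr0 // => ka /andP[h1 h2].
  by rewrite ck // scale0r.
exists (c la) => //; have := ww la la.
by rewrite E formZr form_sym formZr form_sA // eqxx mulr1 -expr2.
Qed.

(** The remaining sign e equals the pairing of e_(la') with h_la, which counts 0-1 matrices. If e
    were -1, a natural number plus one would vanish, contrary to characteristic 0. *)
Lemma omegaA_sA d (la : intpart d) : (d + d.+1 <= N)%N -> omegaA (sA la) = sA (conjp la).
Proof.
move=> le_N; have le_N' : (d + d <= N)%N by apply: leq_trans le_N; rewrite addnS.
have le_dN : (d <= N)%N by apply: leq_trans le_N'; apply: leq_addr.
rewrite -{1}[la]conjK; move: (conjp la) => {}la; rewrite -/(w la).
have [e Ee e2] := w_diag la le_N; rewrite Ee.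
have [n En] : exists n : nat, form d (ep (conjp la)) (hp la) = n%:R.
  pose al := [multinom part la i | i < d].
  have -> : hp la = \prod_i hgen (al i) by apply: eq_bigr => i _; rewrite mnmE.
  rewrite -gphi_coef //; last by apply: hspan_dop => //; apply: lspan_mem.
  rewrite /(gphi _) phi_ep // raddf_sum /=.
  exists (\sum_(T : filling d d | fok (conjp la) T) ([multinom fcnt T i | i < d] == al))%N.
  rewrite natr_sum; apply: eq_bigr => T _; rewrite -mcoeffX mpolyXE_id; congr mcoeff.
  by apply: eq_bigr => i _; rewrite mnmE.
have E : form d (ep (conjp la)) (hp la) = e.
  rewrite -[hp la](subrK (sA la)) formDr (form_disjoint le_N' (ep_sA K0 la le_N) (hp_sub_sA la le_N')).
    rewrite add0r -[ep _](subrK (w la)) form_sym formDr.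
    have r := lspanN (w_ep la le_N); rewrite opprB in r.
    rewrite (form_disjoint (P := pred1 la) le_N' _ r).
    + by rewrite Ee formZr form_sA // eqxx mulr1 add0r.
    + by apply: lspan_mem; rewrite inE.
    by move=> nu /eqP ->; rewrite eqxx andbF.
  by move=> nu h1; apply/negP => /andP[h2 /eqP]; apply; apply: dom_anti.
have e1 : (e - 1) * (e + 1) = 0 by rewrite -subr_sqr e2 expr1n subrr.
have : e + 1 != 0 by rewrite -E En natr1; apply: natK_neq0.
move/eqP: e1; rewrite mulf_eq0 => /orP[|-> //]; rewrite subr_eq0 => /eqP -> _.
by rewrite scale1r.
Qed.

End OmegaSchur.

(** * Semistandard tableaux *)

Section Branching.
Variables (B : comNzRingType) (y : B) (c c' : nat -> B).
Hypotheses (c'0 : c' 0%N = c 0%N) (c'S : forall k, c' k.+1 = c k.+1 + y * c' k).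

(** By its hypotheses c' is the h-series c with one more variable y. Iterating h'_k = h_k + y h'_(k
    - 1) telescopes to a finite sum. *)
Lemma hz_branch i j L M : (L <= M)%N ->
  hz c' (M + j) i - y ^+ (M.+1 - L) * hz c' (L + j) i.+1 =
  \sum_(L <= k < M.+1) y ^+ (M - k) * hz c (k + j) i.
Proof.
have hzS a : hz c' a i = hz c a i + y * hz c' a i.+1.
  rewrite /hz; have [lt_ia|lt_ai|->] := ltngtP i a.
  - by rewrite subnS -subnS; have -> : (a - i = (a - i.+1).+1)%N by lia.
  - by rewrite mulr0 addr0.
  by rewrite subnn mulr0 addr0.
have hzD a : hz c' a.+1 i.+1 = hz c' a i by rewrite /hz ltnS subSS.
elim: M => [|M IHM]; first by rewrite leqn0 => /eqP ->; rewrite big_nat1 subSnn expr1 hzS mul1r addrK.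
rewrite leq_eqVlt => /predU1P[->|]; last rewrite ltnS => le_LM.
  by rewrite big_nat1 subSnn subnn expr1 hzS mul1r addrK.
rewrite big_nat_recr ?subnn ?mul1r /=; last exact: leqW.
have -> : \sum_(L <= k < M.+1) y ^+ (M.+1 - k) * hz c (k + j) i =
    y * \sum_(L <= k < M.+1) y ^+ (M - k) * hz c (k + j) i.
  rewrite mulr_sumr; apply: eq_big_nat => k /andP[_ lt_kM].
  by rewrite mulrA -exprS; congr (y ^+ _ * _); lia.
rewrite -IHM // hzS addSn hzD subSn ?exprS; last exact: leqW.
by rewrite mulrBr mulrA; ring.
Qed.

(** The skew shape la / mu is a horizontal strip. *)
Definition interlace m (la : nat -> nat) (mu : {ffun 'I_m -> 'I_m.+1}) : bool :=
  [forall i : 'I_m, (la i.+1 <= mu i <= la i)%N].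

Definition shape m (mu : {ffun 'I_m -> 'I_m.+1}) (i : nat) : nat :=
  if insub i is Some k then val (mu k) else 0%N.

Lemma shapeE m (mu : {ffun 'I_m -> 'I_m.+1}) (i : 'I_m) : shape mu i = mu i.
Proof. by rewrite /shape valK. Qed.

(* Subtracting from each row of the Jacobi-Trudi matrix in the variables x, y
   a multiple of the next row turns it into a sum of rows of the
   Jacobi-Trudi matrix in the variables x. *)
Lemma JT_branch m (la : nat -> nat) :
  (forall i, la i.+1 <= la i)%N -> (forall i, la i <= m)%N -> la m = 0%N ->
  JT c' m la = \sum_(mu : {ffun 'I_m -> 'I_m.+1} | interlace la mu)
    y ^+ (\sum_(i < m) (la i - mu i)) * JT c m (shape mu).
Proof.
move=> la_dec la_m lam0.
pose M := \matrix_(i < m, j < m) hz c' (la i + j) i.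
pose U := \matrix_(i < m, j < m) ((i == j)%:R - (i.+1 == j)%:R * y ^+ ((la i).+1 - la i.+1) : B).
have detU : \det U = 1.
  rewrite -det_tr det_trig ?big1 // => [i _|]; first by rewrite !mxE eqxx gtn_eqF // mul0r subr0.
  apply/is_trig_mxP => i j lt_ij; rewrite !mxE -val_eqE /= gtn_eqF //.
  by rewrite (_ : (j.+1 == i :> nat) = false) ?mul0r ?subr0 //; apply/eqP; lia.
transitivity (\det (U *m M)); first by rewrite det_mulmx detU mul1r.
have UM i j : (U *m M) i j = \sum_(k < m.+1 | (la i.+1 <= k <= la i)%N) y ^+ (la i - k) * hz c (k + j) i.
  have -> : (U *m M) i j = hz c' (la i + j) i - y ^+ ((la i).+1 - la i.+1) * hz c' (la i.+1 + j) i.+1.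
    rewrite mxE; under eq_bigr => k _ do rewrite !mxE mulrBl.
    rewrite sumrB; congr (_ - _).
      by rewrite (bigD1 i) //= eqxx mul1r big1 ?addr0 // => k; rewrite eq_sym => /negbTE ->; rewrite mul0r.
    have [lt_im|] := ltnP i.+1 m.
      rewrite (bigD1 (Ordinal lt_im)) //= eqxx mul1r big1 ?addr0 // => k.
      by rewrite -val_eqE /= eq_sym => /negbTE ->; rewrite !mul0r.
    move=> le_mi; have Em : i.+1 = m by apply/eqP; rewrite eqn_leq ltn_ord.
    rewrite big1 => [|k _]; last by rewrite gtn_eqF ?mul0r // Em ltn_ord.
    by rewrite Em lam0 /hz add0n leqNgt ltn_ord mulr0.
  rewrite hz_branch //.
  rewrite (big_nat_widen _ _ m.+1) ?ltnS // (big_nat_widenl _ 0%N) // big_mkord.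
  by apply: eq_bigl => k /=; rewrite ltnS andbC.
rewrite [LHS]/(determinant _).
transitivity (\sum_(s : 'S_m) \sum_(mu : {ffun 'I_m -> 'I_m.+1} | interlace la mu)
   (-1) ^+ s * \prod_(i < m) (y ^+ (la i - mu i) * hz c (mu i + s i) i)).
  apply: eq_bigr => s _; rewrite -mulr_sumr; congr (_ * _).
  under eq_bigr => i _ do rewrite UM.
  rewrite bigA_distr_big_dep; apply: eq_bigl => mu.
  by apply/familyP/forallP => h i; have := h i.
rewrite exchange_big; apply: eq_bigr => mu _; rewrite JT_expand mulr_sumr; apply: eq_bigr => s _.
rewrite big_split /= prodrXr mulrCA; congr (_ * (_ * _)).
by apply: eq_bigr => i _; rewrite shapeE.
Qed.

End Branching.

Lemma downset_card m (P : pred 'I_m) : (forall i j : 'I_m, (i <= j)%N -> P j -> P i) ->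
  forall j : 'I_m, (j < #|P|)%N = P j.
Proof.
move=> P_down j; apply/idP/idP => [lt_j|Pj].
  apply: contraTT lt_j => nPj; rewrite -leqNgt -[leqRHS](card_ord_lt (ltnW (ltn_ord j))).
  apply: subset_leq_card; apply/subsetP => i Pi; rewrite inE ltnNge.
  by apply: contra nPj => le_ji; apply: (P_down j i).
rewrite -(card_ord_lt (ltn_ord j)); apply: subset_leq_card; apply/subsetP => i.
by rewrite inE ltnS => le_ij; apply: (P_down i j).
Qed.

Lemma ltn_ord_inj m (a b : 'I_m.+1) : (forall j : 'I_m, (j < a)%N = (j < b)%N) -> a = b.
Proof.
move=> key; apply: ord_inj; apply/eqP; rewrite eqn_leq [(a <= b)%N]leqNgt [(b <= a)%N]leqNgt.
apply/andP; split; apply/negP => lt_a.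
  have lt_m : (b < m)%N by apply: leq_trans lt_a _; rewrite -ltnS.
  by have := key (Ordinal lt_m); rewrite /= lt_a ltnn.
have lt_m : (a < m)%N by apply: leq_trans lt_a _; rewrite -ltnS.
by have := key (Ordinal lt_m); rewrite /= lt_a ltnn.
Qed.

Section Tableaux.
Variable m : nat.
Notation tab N := {ffun 'I_m * 'I_m -> 'I_N.+1}.
Notation shp := {ffun 'I_m -> 'I_m.+1}.

(** The condition of [ssyt] for shapes given as functions: removing the largest entries leaves a
    shape that need not be a partition of m. *)
Definition gssyt (la : nat -> nat) N (T : tab N) : bool :=
  [forall c : 'I_m * 'I_m, (val (T c) == 0%N) == ~~ (c.2 < la c.1)%N] &&
  [forall c : 'I_m * 'I_m, forall d : 'I_m * 'I_m,
     ((d.1 == c.1 :> nat) && (d.2 == c.2.+1 :> nat) && (d.2 < la d.1)%N) ==> (T c <= T d)%N] &&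
  [forall c : 'I_m * 'I_m, forall d : 'I_m * 'I_m,
     ((d.1 == c.1.+1 :> nat) && (d.2 == c.2 :> nat) && (d.2 < la d.1)%N) ==> (T c < T d)%N].

Lemma gssytP (la : nat -> nat) N (T : tab N) : reflect
  [/\ forall i j : 'I_m, (T (i, j) == 0%N :> nat) = (la i <= j)%N,
      forall i j k : 'I_m, (j <= k)%N -> (k < la i)%N -> (T (i, j) <= T (i, k))%N &
      forall i i' j : 'I_m, (i' = i.+1 :> nat) -> (j < la i')%N -> (T (i, j) < T (i', j))%N]
  (gssyt la T).
Proof.
apply: (iffP idP) => [/andP[/andP[/forallP h1 /forallP h2] /forallP h3]|[h1 h2 h3]].
  split=> [i j|i j k|i i' j Ei lt_j]; first by rewrite leqNgt; have /eqP := h1 (i, j).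
    move=> le_jk; have [n] := ubnP (k - j); elim: n k le_jk => // n IHn k le_jk; rewrite ltnS => le_n lt_k.
    move: le_jk; rewrite leq_eqVlt => /predU1P[Ejk|lt_jk]; first by rewrite (ord_inj Ejk).
    have lt_k1 : (k.-1 < m)%N by apply: leq_ltn_trans (leq_pred _) _.
    have /forallP/(_ (i, k))/implyP/= := h2 (i, Ordinal lt_k1).
    rewrite eqxx prednK ?(leq_ltn_trans _ lt_jk) // eqxx lt_k => /(_ isT); apply: leq_trans.
    by apply: IHn => /=; lia.
  by have /forallP/(_ (i', j))/implyP/= := h3 (i, j); rewrite Ei !eqxx /= -Ei; apply.
rewrite /gssyt -andbA; apply/and3P; split.
- by apply/forallP => -[i j] /=; rewrite h1 leqNgt.
- apply/forallP => -[i j]; apply/forallP => -[i' k] /=; apply/implyP => /andP[/andP[/eqP Ei /eqP Ek] lt_k].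
  by rewrite (ord_inj Ei) in lt_k *; apply: h2 => //; rewrite Ek.
apply/forallP => -[i j]; apply/forallP => -[i' k] /=; apply/implyP => /andP[/andP[/eqP Ei /eqP Ek] lt_k].
by rewrite (ord_inj Ek) in lt_k *; apply: h3.
Qed.

(** [addmax] fills the strip between the inner shape and [la] with N + 1; [delmax] is its inverse on
    semistandard tableaux, recording the cells with entries at most N. *)
Definition addmax (la : nat -> nat) N (p : shp * tab N) : tab N.+1 :=
  [ffun c : 'I_m * 'I_m => if (c.2 < p.1 c.1)%N then inord (p.2 c) else if (c.2 < la c.1)%N then ord_max else ord0].
Definition delmax N (T : tab N.+1) : shp * tab N :=
  ([ffun i => inord #|[pred j | 0 < T (i, j) < N.+1]%N|],
   [ffun c => if (T c < N.+1)%N then inord (T c) else ord0]).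

Section Peel.
Variables (la : nat -> nat) (N : nat).
Hypotheses (la_dec : forall i, (la i.+1 <= la i)%N) (la_m : forall i, (la i <= m)%N) (lam : la m = 0%N).

Lemma delmax_shape (T : tab N.+1) : gssyt la T ->
  forall i j : 'I_m, (j < (delmax T).1 i)%N = (0 < T (i, j) < N.+1)%N.
Proof.
move=> /gssytP[h1 h2 _] i j; rewrite ffunE inordK; last first.
  by rewrite ltnS -[X in (_ <= X)%N]card_ord max_card.
apply: (downset_card (P := [pred j | 0 < T (i, j) < N.+1]%N)) => {}j k le_jk /= /andP[k_gt0 lt_k].
have lt_kla : (k < la i)%N by rewrite ltnNge -h1 -lt0n.
rewrite (leq_ltn_trans (h2 i j k le_jk lt_kla) lt_k) andbT lt0n h1 -ltnNge.
exact: leq_ltn_trans lt_kla.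
Qed.

Lemma delmaxE (T : tab N.+1) c : (delmax T).2 c = (if T c < N.+1 then T c : nat else 0)%N :> nat.
Proof. by rewrite ffunE; case: ifP => // lt_T; rewrite inordK. Qed.

Lemma addmaxE (p : shp * tab N) i j : addmax la p (i, j) =
  (if j < p.1 i then p.2 (i, j) : nat else if j < la i then N.+1 else 0)%N :> nat.
Proof.
rewrite ffunE /=; case: ifP => _; first by rewrite inordK // ltnW // ltnS.
by case: ifP.
Qed.

Lemma addmax_delmax (T : tab N.+1) : gssyt la T -> addmax la (delmax T) = T.
Proof.
move=> hT; have [h1 _ _] := gssytP _ _ hT; apply/ffunP => -[i j]; apply: val_inj.
rewrite [LHS]addmaxE delmax_shape //= delmaxE.
case: ifP => [/andP[_ ->] //|]; rewrite [(j < _)%N]ltnNge -h1 lt0n.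
by move: (ltn_ord (T (i, j))); move: (nat_of_ord (T (i, j))) => t; case: eqP => [->|] //=; lia.
Qed.

Lemma interlace_delmax (T : tab N.+1) : gssyt la T ->
  interlace la (delmax T).1 && gssyt (shape (delmax T).1) (delmax T).2.
Proof.
move=> hT; have [h1 h2 h3] := gssytP _ _ hT; have ds := delmax_shape hT; apply/andP; split.
  apply/forallP => i; apply/andP; split.
    rewrite leqNgt; apply/negP => lt_la.
    have lt_j : ((delmax T).1 i < m)%N by apply: leq_trans lt_la (la_m _).
    have lt_i : (i.+1 < m)%N.
      rewrite ltn_neqAle ltn_ord andbT; apply: contraTneq lt_la => ->.
      by rewrite lam.
    have := h3 i (Ordinal lt_i) (Ordinal lt_j) erefl lt_la.
    have := ds i (Ordinal lt_j); rewrite /= ltnn => /esym/negbT.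
    rewrite negb_and -leqNgt -leqNgt leqn0 h1 => /orP[h|h]; last first.
      by move=> /(leq_ltn_trans h); rewrite ltnNge -ltnS ltn_ord.
    by have := leq_ltn_trans h lt_la; rewrite ltnNge la_dec.
  rewrite leqNgt; apply/negP => lt_la; have lt_j : (la i < m)%N.
    by apply: leq_trans lt_la _; rewrite -ltnS.
  have := ds i (Ordinal lt_j); rewrite /= lt_la => /esym/andP[].
  by rewrite lt0n h1 /= leqnn.
apply/gssytP; split=> [i j|i j k le_jk|i i' j Ei]; rewrite ?shapeE ?delmaxE.
- by rewrite [RHS]leqNgt ds; case: ifP => h; rewrite ?andbT ?andbF // lt0n negbK.
- rewrite ds => /andP[k0 lt_k]; rewrite lt_k.
  have lt_kla : (k < la i)%N by rewrite ltnNge -h1 -lt0n.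
  by case: ifP => // _; apply: h2.
rewrite ds => /andP[j0 lt_j]; rewrite lt_j; have := h3 i i' j Ei; rewrite ltnNge -h1 -lt0n => /(_ j0).
by case: ifP.
Qed.

Lemma gssyt_addmax (p : shp * tab N) : interlace la p.1 -> gssyt (shape p.1) p.2 ->
  gssyt la (addmax la p) && (delmax (addmax la p) == p).
Proof.
case: p => mu T /= /forallP hmu /gssytP[h1 h2 h3].
have {}h1 i j : (T (i, j) == 0%N :> nat) = (mu i <= j)%N by rewrite h1 shapeE.
have hT : gssyt la (addmax la (mu, T)).
  apply/gssytP; split=> [i j|i j k le_jk lt_k|i i' j Ei lt_j]; rewrite !addmaxE /=.
  - have /andP[_ le_mu] := hmu i; case: ifP => [lt_j|]; first by rewrite h1; lia.
    by case: ifP => h _; rewrite leqNgt h.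
  - rewrite lt_k (leq_ltn_trans le_jk lt_k); case: (ltnP k (mu i)) => [lt_k'|le_k].
      by rewrite (leq_ltn_trans le_jk lt_k'); apply: h2; rewrite ?shapeE.
    by case: ifP => // _; apply: ltnW.
  have /andP[le_mu _] := hmu i; rewrite -Ei in le_mu; rewrite (leq_trans lt_j le_mu) lt_j.
  by case: ifP => // lt_j'; apply: h3; rewrite ?shapeE.
rewrite hT /=; have ds := delmax_shape hT; apply/eqP; congr (_, _).
  apply/ffunP => i; apply: ltn_ord_inj => j.
  rewrite ds addmaxE /=; case: ifP => [lt_j|_]; first by rewrite ltn_ord lt0n h1 -ltnNge lt_j.
  by case: ifP; rewrite ?ltnn ?andbF.
apply/ffunP => -[i j]; apply: val_inj; rewrite [LHS]delmaxE addmaxE /=.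
case: (ltnP j (mu i)) => [lt_j|]; first by rewrite ltn_ord.
by rewrite -h1 => /eqP ->; case: (j < la i)%N; rewrite ?ltnn.
Qed.

End Peel.

Definition tweight (B : comNzRingType) (x : nat -> B) (la : nat -> nat) N (T : tab N) : B :=
  \prod_(c : 'I_m * 'I_m | (c.2 < la c.1)%N) x (T c).-1.

Lemma tweight_addmax (B : comNzRingType) (x : nat -> B) (la : nat -> nat) N (p : shp * tab N) :
  (forall i, (la i <= m)%N) -> interlace la p.1 ->
  tweight x la (addmax la p) = x N ^+ (\sum_(i < m) (la i - p.1 i)) * tweight x (shape p.1) p.2.
Proof.
case: p => mu T /= la_m /forallP hmu; rewrite /tweight mulrC.
rewrite (bigID (fun c : 'I_m * 'I_m => (c.2 < mu c.1)%N)) /=; congr (_ * _).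
  apply: eq_big => [[i j]|[i j] /= /andP[_ lt_j]] /=.
    by rewrite shapeE; have /andP[_ le_mu] := hmu i; case: (ltnP j (mu i)); rewrite ?andbT ?andbF //; lia.
  by rewrite addmaxE /= lt_j.
rewrite (eq_bigr (fun=> x N)) => [|[i j] /= /andP[lt_j /negbTE nlt_j]]; last first.
  by rewrite addmaxE /= nlt_j lt_j.
rewrite prodr_const; congr (_ ^+ _).
rewrite -sum1_card -(pair_big_dep predT (fun i j : 'I_m => (j < la i)%N && ~~ (j < mu i)%N) (fun _ _ => 1%N)) /=.
apply: eq_bigr => i _; have /andP[_ le_mu] := hmu i.
rewrite sum1_card; have := cardsID [set j : 'I_m | j < mu i]%N [set j : 'I_m | j < la i]%N.
rewrite (setIidPr _); last by apply/subsetP => j; rewrite !inE => h; apply: leq_trans h le_mu.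
rewrite !card_ord_lt //; last by rewrite -ltnS.
move/(congr1 (subn^~ (mu i))); rewrite /= addKn => <-; apply: eq_card => j; rewrite !inE.
by rewrite -[LHS]/((j < la i)%N && ~~ (j < mu i)%N) andbC.
Qed.

Fixpoint hseq (B : comNzRingType) (x : nat -> B) n k : B :=
  if n is n'.+1 then \sum_(i < k.+1) hseq x n' i * x n' ^+ (k - i) else (k == 0%N)%:R.

Lemma hseq0 (B : comNzRingType) (x : nat -> B) n : hseq x n 0 = 1.
Proof. by elim: n => //= n IHn; rewrite big_ord1 IHn mulr1. Qed.

Lemma hseqS (B : comNzRingType) (x : nat -> B) n k :
  hseq x n.+1 k.+1 = hseq x n k.+1 + x n * hseq x n.+1 k.
Proof.
rewrite /= big_ord_recr subnn expr0 mulr1 addrC; congr (_ + _).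
rewrite mulr_sumr; apply: eq_bigr => i _ /=; rewrite mulrCA -exprS; congr (_ * _ ^+ _).
by have := ltn_ord i; lia.
Qed.

(** Induction on the number of variables: the cells with the largest entry form a horizontal strip,
    and their removal matches [JT_branch]. Without variables only the empty shape survives, and
    otherwise the first row of the determinant is zero. *)
Lemma ssyt_sum (B : comNzRingType) (x : nat -> B) N (la : nat -> nat) :
  (forall i, (la i.+1 <= la i)%N) -> (forall i, (la i <= m)%N) -> la m = 0%N ->
  \sum_(T : tab N | gssyt la T) tweight x la T = JT (hseq x N) m la.
Proof.
elim: N la => [|N IHN] la la_dec la_m lam.
  have T0 (T : tab 0) : T = [ffun=> ord0] by apply/ffunP => c; rewrite [LHS]ord1 ffunE.
  have [la0|] := eqVneq (\sum_(i < m) la i)%N 0%N.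
    have {}la0 (i : nat) : (i < m)%N -> la i = 0%N.
      move=> lt_i; apply/eqP; rewrite -leqn0 -[X in (_ <= X)%N]la0 (bigD1 (Ordinal lt_i)) //=.
      exact: leq_addr.
    rewrite (eq_JT _ la0) JT_zero // (bigD1 [ffun=> ord0]) /=; last first.
      apply/gssytP; split=> [i j|i j k _|i i' j _]; rewrite ?ffunE ?la0 //.
    rewrite big1 ?addr0; last by move=> T; rewrite (T0 T) eqxx andbF.
    by rewrite /tweight big_pred0 // => -[i j] /=; rewrite la0.
  move=> la_neq0; rewrite big_pred0; last first.
    move=> T; apply: contraNF la_neq0 => /gssytP[h1 _ _]; apply/eqP; apply: big1 => i _.
    have m0 : (0 < m)%N by apply: leq_ltn_trans (leq0n i) (ltn_ord i).
    by have := h1 i (Ordinal m0); rewrite [T]T0 ffunE /= leqn0 eqxx => /esym/eqP.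
  case: m la_neq0 {T0} la_m lam => [|k]; first by rewrite big_ord0.
  move=> la_neq0 _ _; have la0 : (0 < la 0%N)%N.
    rewrite lt0n; apply: contraNneq la_neq0 => la0; apply/eqP; apply: big1 => i _.
    by elim: (val i) => //= j IHj; have := la_dec j; lia.
  apply/esym; rewrite /JT (expand_det_row _ ord0) big1 // => j _.
  by rewrite mxE /hz leq0n subn0 /= gtn_eqF ?mul0r // ltn_addr.
rewrite (JT_branch (y := x N) (c := hseq x N)) //; [|by rewrite !hseq0|exact: hseqS].
transitivity (\sum_(mu | interlace la mu) \sum_(T : tab N | gssyt (shape mu) T)
    x N ^+ (\sum_(i < m) (la i - mu i)) * tweight x (shape mu) T); last first.
  apply: eq_bigr => mu /forallP hmu; rewrite -mulr_sumr IHN // => [i|i|].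
  - rewrite /shape; case: insubP => // k lt_k Ek; case: insubP => [l _ El|]; last by rewrite (ltnW lt_k).
    have /andP[_ h1] := hmu k; have /andP[h2 _] := hmu l; rewrite El in h2; rewrite Ek in h1.
    exact: leq_trans h1 h2.
  - by rewrite /shape; case: insubP => // k _ _; rewrite -ltnS; apply: ltn_ord.
  by rewrite /shape insubF // ltnn.
rewrite pair_big_dep /= (reindex_onto (@addmax la N) (@delmax N)); last first.
  by move=> T hT; apply: addmax_delmax.
apply: eq_big => [p|p /andP[h1 /eqP h2]].
  apply/idP/idP => [/andP[h1 /eqP h2]|/andP[h1 h2]]; last exact: gssyt_addmax.
  by have := interlace_delmax la_dec la_m lam h1; rewrite h2.
by have := interlace_delmax la_dec la_m lam h1; rewrite h2 => /andP[h3 _]; apply: tweight_addmax.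
Qed.

End Tableaux.

Section Kostka.
Variables (K : fieldType) (N : nat).
Hypothesis K0 : [pchar K] =i pred0.
Notation hgen := (hgen K N).
Notation hp := (@hp K N _).
Notation sA := (@sA K N _).
Notation gphi := (@gphi K N).

Lemma phi_hseq (F : idomainType) (f : {rmorphism K -> F}) (x : nat -> F) n k : (k <= N)%N ->
  phi f (fun i : 'I_n => x i) (hgen k) = hseq x n k.
Proof.
elim: n k => [|n IHn] k le_kN.
  rewrite /phi (eq_spec _ (pi' := fun=> 0)) => [|j _]; last by rewrite big_ord0.
  by rewrite (spec_hgen K0 f (newton_one F N)) // coef1.
rewrite /phi (eq_spec _ (pi' := fun k => \sum_(i < n) x i ^+ k + x n ^+ k)); last first.
  by move=> j _; rewrite big_ord_recr.
rewrite (spec_hgenD K0) //=; apply: eq_bigr => i _.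
have le_iN : (i <= N)%N by apply: leq_trans le_kN; rewrite -ltnS.
rewrite -[X in X * _]/(phi f (fun i : 'I_n => x i) _) IHn //; congr (_ * _).
by apply: (spec_hgen K0 f (newton_geom N (x n))); apply: leq_trans le_kN; apply: leq_subr.
Qed.

Lemma phi_ssyt (F : idomainType) (f : {rmorphism K -> F}) (x : nat -> F) n d (la : intpart d) :
  (d <= N)%N -> phi f (fun i : 'I_n => x i) (sA la) =
  \sum_(T : {ffun 'I_d * 'I_d -> 'I_n.+1} | ssyt la T) \prod_(c | incell la c) x (T c).-1.
Proof.
move=> le_dN; rewrite /(sA _) rmorph_JT /=.
rewrite (@JT_local _ _ (hseq x n)); last first.
  by move=> k; rewrite sum_part // => le_kd; apply: phi_hseq; apply: leq_trans le_kd le_dN.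
rewrite -(ssyt_sum x n) ?part_big // => i; last exact: part_le.
exact: part_mono.
Qed.

(** Pairing with h_mu extracts the coefficient of x^mu, which the tableau sum [phi_ssyt] expresses
    as a count. *)
Lemma form_kostka d (la mu : intpart d) : (d <= N)%N ->
  form d (sA la) (hp mu) =
    (#|[set T : {ffun 'I_d * 'I_d -> 'I_d.+1} | ssyt la T &&
       [forall k : 'I_d, #|[pred c | val (T c) == k.+1]| == part mu k]]|)%:R.
Proof.
move=> le_dN; pose al := [multinom part mu i | i < d].
have -> : hp mu = \prod_i hgen (al i) by apply: eq_bigr => i _; rewrite mnmE.
rewrite -gphi_coef //; last exact: hspan_sA.
pose x k : {mpoly K[d]} := if insub k is Some i then 'X_i else 0.
have -> : gphi d (sA la) = phi (@mpolyC d K) (fun i : 'I_d => x i) (sA la).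
  by apply: eq_spec => k _; apply: eq_bigr => i _; rewrite /x valK.
rewrite phi_ssyt // raddf_sum /= -sum1_card natr_sum.
under [RHS]eq_bigl => T do rewrite inE.
rewrite [RHS]big_mkcondr /=; apply: eq_bigr => T hT.
pose m := [multinom #|[pred c | val (T c) == i.+1]| | i < d].
suff -> : \prod_(c | incell la c) x (T c).-1 = 'X_[m].
  rewrite mcoeffX; set b := [forall k, _]; have -> : (m == al) = b by
    apply/eqP/forallP => [E k|E]; [have /mnmP/(_ k) := E; rewrite !mnmE => -> |
      apply/mnmP => k; rewrite !mnmE; apply/eqP/(E k)].
  by case: b.
have T0 c : (T c == 0%N :> nat) = ~~ incell la c.
  by case/andP: hT => /andP[/forallP/(_ c)/eqP].
rewrite mpolyXE_id.
have -> : \prod_(i < d) ('X_i : {mpoly K[d]}) ^+ m i =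
    \prod_(i < d) \prod_(c | incell la c) 'X_i ^+ (val (T c) == i.+1).
  apply: eq_bigr => i _; rewrite mnmE -sum1_card -prodrXr [RHS]big_mkcond.
  rewrite [LHS]big_mkcond; apply: eq_bigr => c _ /=; rewrite unfold_in /=; case: eqP => [Tc|_].
    by have := T0 c; rewrite Tc /= => /esym/negbFE ->.
  by case: ifP.
rewrite exchange_big; apply: eq_bigr => c hc.
have T_gt0 : (0 < T c)%N by rewrite lt0n T0 hc.
have lt_T : ((T c).-1 < d)%N by rewrite -ltnS prednK.
rewrite (bigD1 (Ordinal lt_T)) //= prednK // eqxx expr1 big1 ?mulr1 => [|i].
  by rewrite /x insubT.
rewrite -val_eqE /= => /negbTE ni; rewrite -[val (T c)]prednK // eqSS eq_sym ni.
by rewrite expr0.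
Qed.

End Kostka.

(** * Coordinate vectors as functionals *)

Lemma Qqt0 : [pchar Qqt] =i pred0.
Proof.
move=> p; rewrite !inE; apply/negbTE/negP => /andP[p_pr].
have -> : (p%:R : Qqt) = tofrac p%:R by rewrite rmorph_nat.
rewrite tofrac_eq0 -polyC_natr polyC_eq0 -polyC_natr polyC_eq0 Num.Theory.pnatr_eq0.
by move/eqP => p0; rewrite p0 in p_pr.
Qed.

Lemma fracE (F : fieldType) (p z w b : F) : z != 0 -> p / z * w * (z * b) = b * w * p.
Proof. by move=> z0; field. Qed.

Lemma coordsP d (B : intpart d -> sym d) v (c : intpart d -> Qqt) :
  v = \sum_la c la *: B la -> v = \sum_la coords B v la *: B la.
Proof. by move=> E; apply: (@epsilon_spec (intpart d -> Qqt) (inhabits (fun=> 0)) (fun c => v = \sum_la c la *: B la)); exists c. Qed.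

Section Bridge.
Variable N : nat.
Notation A := {mpoly Qqt[N]}.
Notation hgen := (hgen Qqt N).
Notation hspan := (fun d => lspan predT (@hp Qqt N d)).
Notation hp := (@hp Qqt N _).
Notation pp := (@pp Qqt N _).
Notation pm := (@pm N _).
Notation pr := (@pr Qqt N _).
Notation sA := (@sA Qqt N _).
Let K0 := Qqt0.

Section Degree.
Variable d : nat.
Hypothesis le_N : (d + d.+1 <= N)%N.

Let le_N' : (d + d <= N)%N. Proof. by apply: leq_trans le_N; rewrite addnS. Qed.
Let le_dN : (d <= N)%N. Proof. by apply: leq_trans le_N'; apply: leq_addr. Qed.

Lemma pr_ext (v : sym d) (g : A -> Qqt) f :
  (forall a b, g (a + b) = g a + g b) -> (forall c a, g (c *: a) = c * g a) ->
  (forall mu : intpart d, g (hp mu) = v mu) -> hspan d f -> pr v f = g f.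
Proof.
move=> gD gZ gv [c ->]; have g0 : g 0 = 0 by rewrite -(scale0r 0) gZ mul0r.
rewrite (big_morph g gD g0) pr_sum; apply: eq_bigr => mu _.
by rewrite prZ pr_hp // gZ gv.
Qed.

Lemma sym_pr_inj (v w : sym d) : (forall f, hspan d f -> pr v f = pr w f) -> v = w.
Proof. by move=> E; apply/ffunP => mu; rewrite -!(pr_hp K0 _ mu le_dN) E //; apply: lspan_mem. Qed.

Lemma pr_schur (la : intpart d) f : hspan d f -> pr (schur la) f = form d (sA la) f.
Proof.
apply: pr_ext => [a b|c a|mu]; [exact: formDr | exact: formZr |].
by rewrite form_kostka // ffunE.
Qed.

Lemma pr_scale (x : Qqt) (v : sym d) f : pr (x *: v) f = x * pr v f.
Proof.
have := @pr_suml Qqt N d bool [:: true] predT (fun=> x) (fun=> (v : intpart d -> Qqt)) f.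
by rewrite !big_seq1 => <-; apply: eq_pr => mu; rewrite big_seq1 !ffunE.
Qed.

Lemma pr_add (v w : sym d) f : pr (v + w) f = pr v f + pr w f.
Proof.
have := @pr_suml Qqt N d bool [:: true; false] predT (fun=> 1)
  (fun b => if b then (v : intpart d -> Qqt) else (w : intpart d -> Qqt)) f.
rewrite !big_cons !big_nil /= !mul1r !addr0 => <-; apply: eq_pr => mu.
by rewrite !big_cons !big_nil /= !mul1r addr0 ffunE.
Qed.

Lemma pr0 f : pr (0 : sym d) f = 0.
Proof. by have := pr_scale 0 (0 : sym d) f; rewrite scale0r mul0r. Qed.

Lemma pr_opp (v : sym d) f : pr (- v) f = - pr v f.
Proof. by rewrite -scaleN1r pr_scale mulN1r. Qed.

Lemma pr_comb (I : Type) (r : seq I) (P : pred I) (c : I -> Qqt) (v : I -> sym d) f :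
  pr (\sum_(i <- r | P i) c i *: v i : sym d) f = \sum_(i <- r | P i) c i * pr (v i) f.
Proof.
elim/big_rec2: _ => [|i y1 y2 _ IH]; first exact: pr0.
by rewrite pr_add IH pr_scale.
Qed.

Lemma schur_sA (la ka : intpart d) : pr (schur la) (sA ka) = (la == ka)%:R.
Proof. by rewrite pr_schur ?form_sA //; apply: hspan_sA. Qed.

Lemma schur_expand (v : sym d) : v = \sum_la pr v (sA la) *: schur la.
Proof.
apply: sym_pr_inj => f hf; rewrite pr_comb {1}(hspanS K0 le_N' hf) pr_sum.
by apply: eq_bigr => la _; rewrite prZ pr_schur // mulrC.
Qed.

Lemma pr_schur_comb (P : pred (intpart d)) (c : intpart d -> Qqt) ka :
  pr (\sum_(la | P la) c la *: schur la : sym d) (sA ka) = (P ka)%:R * c ka.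
Proof.
rewrite pr_comb big_mkcond (bigD1 ka) //= big1 ?addr0 => [|la /negbTE ne].
  by rewrite schur_sA eqxx mulr1; case: ifP => _; rewrite (mul1r, mul0r).
by rewrite schur_sA ne mulr0 if_same.
Qed.

Lemma coords_schur (v : sym d) la : coords (@schur d) v la = pr v (sA la).
Proof.
by rewrite {2}(coordsP (schur_expand v)) pr_schur_comb mul1r.
Qed.

(** By [schur_sA] the values on the [sA la] are the Schur coordinates, so membership in a span
    becomes vanishing of a functional. *)
Lemma in_schur_spanP (P : pred (intpart d)) (v : sym d) :
  in_schur_span P v <-> forall la, ~~ P la -> pr v (sA la) = 0.
Proof.
split=> [[c ->] la /negbTE nP|h]; first by rewrite pr_schur_comb nP mul0r.
exists (fun la => pr v (sA la)); rewrite [LHS]schur_expand (bigID P) /= [X in _ + X]big1 ?addr0 // => la nP.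
by rewrite h // scale0r.
Qed.

Lemma pr_psum (la : intpart d) f : hspan d f -> pr (psum la) f = zed Qqt (pm la) * f@_(pm la).
Proof.
apply: (pr_ext (g := fun f => zed Qqt (pm la) * f@_(pm la))) => [a b|c a|mu]; first by rewrite mcoeffD mulrDr.
  by rewrite mcoeffZ mulrCA.
by rewrite -(card_psum K0 la mu le_dN) ffunE.
Qed.

Lemma psum_expand (v : sym d) : v = \sum_la (pr v (pp la) / zed Qqt (pm la)) *: psum la.
Proof.
apply: sym_pr_inj => f hf; rewrite pr_comb {1}(hspanE K0 le_dN hf) pr_sum.
apply: eq_bigr => la _; rewrite prZ pr_psum // mulrA divfK ?zed_neq0 //; exact: mulrC.
Qed.

Lemma coords_psum (v : sym d) la : coords (@psum d) v la = pr v (pp la) / zed Qqt (pm la).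
Proof.
rewrite {2}(coordsP (psum_expand v)) pr_comb (bigD1 la) //= big1 ?addr0 => [|ka /negbTE ne].
  by rewrite (pr_psum _ (hspan_pp K0 _ le_dN)) (pp_coef _ _ _ le_dN) eqxx mulr1 mulfK // zed_neq0.
by rewrite (pr_psum _ (hspan_pp K0 _ le_dN)) (pp_coef _ _ _ le_dN) eq_sym ne !mulr0.
Qed.

(** The plethysm is diagonal in the power sums, hence self-adjoint, and can be moved from the
    functional to its argument. *)
Lemma pr_pleth1m (z : Qqt) (v : sym d) f : hspan d f -> pr (pleth1m z v) f = pr v (theta z f).
Proof.
move=> hf; rewrite pr_comb {2}(hspanE K0 le_dN hf) rmorph_sum pr_sum.
apply: eq_bigr => la _; rewrite coords_psum pr_psum //= thetaE dopZ prZ dopX prZ.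
rewrite (dweight_pm le_dN) mulrA; move: (\prod_(i < d | _) _) => w.
exact/fracE/zed_neq0.
Qed.

Lemma pr_omega (v : sym d) (la : intpart d) : pr (omega v) (sA la) = pr v (sA (conjp la)).
Proof.
rewrite pr_comb (bigD1 (conjp la)) //= big1 ?addr0 => [|ka ne].
  by rewrite coords_schur schur_sA conjK eqxx mulr1.
rewrite schur_sA; case: eqP => [E|_]; last by rewrite mulr0.
by rewrite -E conjK eqxx in ne.
Qed.

(** Pairing with e_d, which is multiplicative: its h-series is 1 + X, so h_mu is sent to 1 exactly
    if all parts are at most 1. *)
Definition ev_elem : A -> Qqt := spec idfun (fun k => (-1) ^+ k.-1).
HB.instance Definition _ := GRing.RMorphism.on ev_elem.

Lemma ev_elem_hgen k : (k <= N)%N -> ev_elem (hgen k) = (k <= 1)%N%:R.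
Proof.
move=> le_kN; rewrite /ev_elem (spec_hgen K0 idfun (c := fun k => (1 - (-1) *: 'X : {poly Qqt})`_k)) //.
  by rewrite scaleN1r opprK coefD coef1 coefX; case: k {le_kN} => [|[|k]] /=; rewrite ?addr0 ?add0r.
apply: eq_newton (newton_linear N (-1)) => -[|j] // _; by rewrite exprS mulN1r opprK.
Qed.

Lemma pr_elem f : hspan d f -> pr (elem d) f = ev_elem f.
Proof.
apply: pr_ext => [a b|c a|mu]; [by rewrite rmorphD | by rewrite /ev_elem specZ |].
rewrite /(hp _) rmorph_prod /=.
rewrite (eq_bigr (fun i : 'I_d => (part mu i <= 1)%N%:R)) => [|i _]; last first.
  by apply: ev_elem_hgen; apply: leq_trans le_dN; apply: part_le.
have -> : elem d mu = [forall i : 'I_d, part mu i <= 1]%N%:R.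
  rewrite /elem sum_ffunE big_mkcond (bigD1 mu) //= big1 ?addr0 => [|la /negbTE ne]; last first.
    by case: ifP => // _; rewrite ffunE eq_sym ne.
  by case: ifP => // _; rewrite ffunE eqxx.
case: forallP => [h|/forallP]; first by rewrite big1 // => i _; rewrite h.
rewrite negb_forall => /existsP[i /negbTE h].
by rewrite (bigD1 i) //= h mul0r.
Qed.

End Degree.
End Bridge.

(** * Existence of Macdonald functionals *)

(** Recursion along dominance: iterating [F] as often as there are partitions reaches a fixed point,
    whatever the starting value. *)
Lemma dom_rec (T : Type) (x0 : T) d (F : (intpart d -> T) -> intpart d -> T) :
  (forall G G' la, (forall ka, dom la ka -> ka != la -> G ka = G' ka) -> F G la = F G' la) ->
  exists G, forall la, G la = F G la.
Proof.
move=> hF; pose G n := iter n F (fun=> x0).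
suff h n la : (#|[pred ka | dom la ka]| <= n)%N -> G n la = G n.+1 la.
  by exists (G #|{: intpart d}|) => la; apply: h; apply: max_card.
elim: n la => [|n IHn] la.
  by rewrite leqn0 => /eqP/card0_eq/(_ la); rewrite !inE dom_refl.
move=> le_n; apply: hF => ka h1 h2; apply: IHn.
rewrite -ltnS; apply: leq_trans le_n; apply: proper_card; apply/properP; split.
  by apply/subsetP => mu; rewrite !inE; apply: dom_trans.
exists la; rewrite !inE ?dom_refl //; apply/negP => h3.
by move: h2; rewrite (dom_anti h3 h1) eqxx.
Qed.

Lemma dom_ind d (P : intpart d -> Prop) :
  (forall la, (forall ka, dom la ka -> ka != la -> P ka) -> P la) -> forall la, P la.
Proof.
move=> hP la; have [n] := ubnP #|[pred ka | dom la ka]|; elim: n la => // n IHn la.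
rewrite ltnS => le_n; apply: hP => ka h1 h2; apply: IHn.
apply: leq_trans le_n; apply: proper_card; apply/properP; split.
  by apply/subsetP => mu; rewrite !inE; apply: dom_trans.
exists la; rewrite !inE ?dom_refl //; apply/negP => h3.
by move: h2; rewrite (dom_anti h3 h1) eqxx.
Qed.

Lemma linear_comb (K : fieldType) (V : lmodType K) (g : V -> K) (I : Type) (r : seq I) (P : pred I)
    (c : I -> K) (F : I -> V) :
  (forall u v, g (u + v) = g u + g v) -> (forall x u, g (x *: u) = x * g u) ->
  g (\sum_(i <- r | P i) c i *: F i) = \sum_(i <- r | P i) c i * g (F i).
Proof.
move=> gD gZ; have g0 : g 0 = 0 by rewrite -(scale0r 0) gZ mul0r.
by rewrite (big_morph g gD g0); apply: eq_bigr => i _; apply: gZ.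
Qed.

Section Macdonald.
Variables (K : fieldType) (N : nat).
Hypothesis K0 : [pchar K] =i pred0.
Notation A := {mpoly K[N]}.
Notation hgen := (hgen K N).
Notation pgen := (pgen K N).
Notation hspan := (fun d => lspan predT (@hp K N d)).
Notation hp := (@hp K N _).
Notation sA := (@sA K N _).
Notation ep := (@ep K N _).
Notation pr := (@pr K N _).
Notation vertex := (@vertex K N).
Notation omegaA := (@omegaA K N).
Notation theta := (@theta K N).

Definition thinv (t : K) : A -> A := dop (fun k => (1 - t ^+ k)^-1).
HB.instance Definition _ t := GRing.RMorphism.on (thinv t).

Definition generic (t : K) := forall k, (0 < k)%N -> 1 - t ^+ k != 0.

Lemma thinvK t : generic t -> cancel (thinv t) (theta t).
Proof.
move=> gt a; rewrite thetaE /thinv dop_comp dop1 // => k /andP[k_gt0 _].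
by rewrite divff // gt.
Qed.

Lemma thetaK t : generic t -> cancel (theta t) (thinv t).
Proof.
move=> gt a; rewrite thetaE /thinv dop_comp dop1 // => k /andP[k_gt0 _].
by rewrite mulVf // gt.
Qed.

Lemma thinvZ t c a : thinv t (c *: a) = c *: thinv t a.
Proof. exact: dopZ. Qed.

(* [mop q t] is symmetric in q and t and conjugate to the Macdonald operator
   [vertex q t 0] by [theta t], hence also to [vertex t q 0] by [theta q]. *)
Definition mop (q t : K) (g : A) : A :=
  \sum_(k < N.+1) theta q (theta t (hgen k)) * (tau 0 g)`_k.

Lemma theta_comm q t a : theta q (theta t a) = theta t (theta q a).
Proof. by rewrite !thetaE !dop_comp; apply: eq_dop => k _; apply: mulrC. Qed.

Lemma mopC q t g : mop q t g = mop t q g.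
Proof. by apply: eq_bigr => k _; rewrite theta_comm. Qed.

(** Both sides send p_k to (1 - t^k) (p_k - u^k). *)
Lemma tau_theta t a : tau 0 (theta t a) = map_poly (theta t) (tau t a).
Proof.
have hC c : map_poly (theta t) (@poly_const K N c) = @poly_const K N c.
  by rewrite /poly_const /= map_polyC /= thetaC.
have tC y c : tau y c%:MP = poly_const N c by exact: specC.
have tp y k : (0 < k <= N)%N -> tau y (pgen k) = (pgen k)%:P - poly_const N (1 - y ^+ k) * 'X^k.
  exact: spec_pgen.
apply: (@rmorph_mpoly_eq K N {poly A} (tau 0 \o theta t) (map_poly (theta t) \o tau t)) => [c|k kN] /=.
  by rewrite thetaC !tC hC.
rewrite theta_pgen // tauZ !tp // expr0n; case/andP: (kN) => k_gt0 _.
rewrite eqn0Ngt k_gt0 subr0 [poly_const N 1]rmorph1 mul1r (rmorphB (map_poly (theta t))) (rmorphM (map_poly (theta t))) /= hC map_polyXn map_polyC /=.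
by rewrite theta_pgen // -mul_mpolyC polyCM -mul_polyC mulrBr.
Qed.

Lemma mop_theta q t g : mop q t (theta t g) = theta t (vertex q t 0 g).
Proof.
rewrite /mop /vertex [RHS](big_morph _ (rmorphD (theta t)) (rmorph0 (theta t))); apply: eq_bigr => k _.
by rewrite rmorphM /= theta_comm tau_theta coef_map add0n.
Qed.

Section Degree.
Variable d : nat.
Hypothesis le_N : (d + d.+1 <= N)%N.

Let le_N' : (d + d <= N)%N. Proof. by apply: leq_trans le_N; rewrite addnS. Qed.
Let le_dN : (d <= N)%N. Proof. by apply: leq_trans le_N'; apply: leq_addr. Qed.

Notation E la := (ep (conjp la)).

Lemma lfree_ep : lfree (fun la : intpart d => E la).
Proof.
move=> c Ec la; have : \sum_(ka : intpart d) c (conjp ka) *: hp ka = 0.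
  rewrite (reindex_inj (@conj_inj d)) /=; have := congr1 omegaA Ec.
  rewrite (rmorph0 omegaA) (rmorph_sum omegaA) => E0; apply: etrans E0; apply: eq_bigr => ka _.
  by rewrite /= omegaAZ /(ep _) omegaAK conjK.
by move/(lfree_hp K0 le_dN)/(_ (conjp la)); rewrite conjK.
Qed.

Lemma sA_ep (la : intpart d) : lspan (fun mu => dom la mu) (fun mu => E mu) (sA la).
Proof. by apply: domC_closed_lspan lfree_ep la => la; apply: ep_sA. Qed.

Lemma hspan_E (f : A) : hspan d f -> lspan predT (fun la : intpart d => E la) f.
Proof.
move=> hf; rewrite (hspanS K0 le_N' hf); apply: lspan_sum => la _; apply: lspanZ.
by apply: (lspan_sub _ (sA_ep la)).
Qed.

Lemma vertex_E (la : intpart d) q t : q != 0 ->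
  lspan (fun mu => dom la mu && (mu != la)) (fun mu => E mu)
    (vertex q t 0 (E la) - eig q t la *: E la).
Proof.
move=> q0; apply: (lspan_trans (vertex_ep K0 la t q0 le_N)) => mu /andP[h1 h2].
apply: (lspan_sub _ (sA_ep mu)) => ka h3; rewrite (dom_trans h1 h3) /=.
by apply: contraNneq h2 => Eka; rewrite Eka in h3; rewrite (dom_anti h3 h1).
Qed.

(** A left eigenvector of Macdonald's operator with the eigenvalue of mu, moved through [theta t],
    is an eigenfunctional of [mop q t]. Its support gives the first triangularity; the symmetry of
    [mop] in q and t, under which mu turns into its conjugate, gives the second. *)
Lemma ex_macdonald q t (mu : intpart d) : q != 0 -> t != 0 -> generic q -> generic t ->
  injective (@eig K q t d) ->
  exists v : intpart d -> K,
    [/\ forall la, ~~ dom la mu -> pr v (theta t (sA la)) = 0,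
        forall la, ~~ dom la (conjp mu) -> pr v (theta q (sA la)) = 0 &
        exists2 f, hspan d f & pr v f != 0].
Proof.
move=> q0 t0 gq gt eig_inj.
pose isa la (a : intpart d -> K) := vertex q t 0 (E la) - eig q t la *: E la =
  \sum_(ka | dom la ka && (ka != la)) a ka *: E ka.
pose a la := epsilon (inhabits (fun=> 0)) (isa la).
have aP la : isa la (a la) by apply: epsilon_spec; apply: vertex_E.
(* The left eigenvector equations solved along dominance, with support above mu. The denominators
   are nonzero as the eigenvalues are distinct. *)
pose rec (G : intpart d -> K) la := if la == mu then 1 else if dom la mu then
  (eig q t mu - eig q t la)^-1 * \sum_(ka | dom la ka && (ka != la)) a la ka * G ka else 0.
have [G hG] : exists G, forall la, G la = rec G la.
  apply: (dom_rec 0) => G G' la E'; rewrite /rec; case: ifP => // _; case: ifP => // _.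
  by congr (_ * _); apply: eq_bigr => ka /andP[h1 h2]; rewrite E'.
have G0 la : ~~ dom la mu -> G la = 0.
  move=> nd; rewrite hG /rec (negbTE nd); case: eqP => // E'.
  by rewrite E' dom_refl in nd.
have G1 : G mu = 1 by rewrite hG /rec eqxx.
have Gr la : \sum_(ka | dom la ka && (ka != la)) a la ka * G ka = (eig q t mu - eig q t la) * G la.
  have [-> | ne] := eqVneq la mu.
    rewrite subrr mul0r big1 // => ka /andP[h1 h2]; rewrite G0 ?mulr0 //.
    by apply/negP => h3; move: h2; rewrite (dom_anti h3 h1) eqxx.
  have [h|h] := boolP (dom la mu); last first.
    rewrite (G0 la h) mulr0 big1 // => ka /andP[h1 h2]; rewrite G0 ?mulr0 //.
    by apply: contra h; apply: dom_trans.
  rewrite [in RHS]hG /rec (negbTE ne) h mulVKf // subr_eq0.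
  by apply: contra_neq ne => /eig_inj ->.
have [Gf [GD GZ GE]] : exists Gf : A -> K,
    [/\ forall f g, Gf (f + g) = Gf f + Gf g, forall c f, Gf (c *: f) = c * Gf f &
        forall la, Gf (E la) = G la].
  exists (fun f => pr (fun ka : intpart d => G (conjp ka)) (omegaA f)).
  split=> [f g|c f|la]; first by rewrite rmorphD prD.
    by rewrite omegaAZ prZ.
  by rewrite /(ep _) omegaAK pr_hp // conjK.
have hE (la : intpart d) : hspan d (E la) by apply: hspan_dop => //; apply: lspan_mem.
have Gvertex f : hspan d f -> Gf (vertex q t 0 f) = eig q t mu * Gf f.
  move=> /hspan_E[c ->].
  have -> : vertex q t 0 (\sum_(la : intpart d) c la *: E la) = \sum_la c la *: vertex q t 0 (E la).
    elim/big_rec2: _ => [|la f1 f2 _ IH]; last by rewrite vertexD IH vertexZ.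
    by have := vertexZ q t 0 0 (0 : A); rewrite !scale0r.
  rewrite !linear_comb // mulr_sumr; apply: eq_bigr => la _; rewrite mulrCA; congr (_ * _).
  rewrite -[vertex _ _ _ _](subrK (eig q t la *: E la)) (aP la) GD linear_comb // GZ GE.
  under eq_bigr => ka _ do rewrite GE.
  by rewrite Gr -mulrDl subrK.
have [H [HD HZ HtE Hmop]] : exists H : A -> K,
    [/\ forall f g, H (f + g) = H f + H g, forall c f, H (c *: f) = c * H f,
        forall la, H (theta t (E la)) = G la &
        forall f, hspan d f -> H (mop q t f) = eig q t mu * H f].
  exists (fun f => Gf (thinv t f)); split=> [f g|c f|la|f hf]; first by rewrite rmorphD GD.
  - by rewrite thinvZ GZ.
  - by rewrite thetaK // GE.
  have E1 := thinvK gt f; rewrite -{1}E1 mop_theta (thetaK gt) Gvertex //.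
  exact: hspan_dop.
pose v (ka : intpart d) := H (hp ka).
have vH f : hspan d f -> pr v f = H f.
  by move=> [c ->]; rewrite (linear_comb _ _ _ _ HD HZ) pr_sum; apply: eq_bigr => ka _; rewrite prZ pr_hp.
have hsp z (la : intpart d) : hspan d (theta z (sA la)).
  by rewrite thetaE; apply: hspan_dop => //; apply: hspan_sA.
have thetaS z (I : Type) (r : seq I) (P : pred I) (c : I -> K) (F : I -> A) :
    theta z (\sum_(i <- r | P i) c i *: F i) = \sum_(i <- r | P i) c i *: theta z (F i).
  by rewrite (rmorph_sum (theta z)); apply: eq_bigr => i _; apply: thetaZ.
have thetaD z (f g : A) : theta z (f + g) = theta z f + theta z g by exact: rmorphD.
(* On the [theta q (E la)] the same operator is triangular with eigenvalues [eig t q la], the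
   eigenvalue of the conjugate of la. Unless this is the one of mu, an eigenfunctional vanishes
   there, given the shapes below. *)
have Hq : forall la : intpart d, ~~ dom la (conjp mu) -> H (theta q (E la)) = 0.
  apply: dom_ind => la IH nd.
  have Em : mop q t (theta q (E la)) = theta q (vertex t q 0 (E la)) by rewrite mopC mop_theta.
  have := Hmop (theta q (E la)); rewrite Em -[vertex _ _ _ _](subrK (eig t q la *: E la)).
  have [b ->] := vertex_E la q t0; rewrite thetaD thetaS thetaZ HD linear_comb // big1; last first.
    by move=> ka /andP[h1 h2]; rewrite IH ?mulr0 //; apply: contra nd; apply: dom_trans.
  have hth : hspan d (theta q (E la)) by rewrite thetaE; apply: hspan_dop.
  rewrite add0r HZ => /(_ hth)/eqP.
  rewrite -subr_eq0 -mulrBl mulf_eq0 subr_eq0 => /orP[|/eqP //].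
  rewrite -[la in eig t q la]conjK eig_conj => /eqP/eig_inj Ec.
  by rewrite -Ec conjK dom_refl in nd.
exists v; split=> [la nd|la nd|].
- rewrite vH //; case: (sA_ep la) => c ->; rewrite thetaS linear_comb // big1 // => ka h.
  by rewrite HtE G0 ?mulr0 //; apply: contra nd; apply: dom_trans.
- rewrite vH //; have [c ->] := sA_ep la; rewrite thetaS linear_comb // big1 // => ka h.
  by rewrite Hq ?mulr0 //; apply: contra nd; exact: dom_trans.
have hth : hspan d (theta t (E mu)) by rewrite thetaE; apply: hspan_dop.
by exists (theta t (E mu)); rewrite // vH // HtE G1 oner_eq0.
Qed.

End Degree.
End Macdonald.

(** * Hall-Littlewood raising operators *)

Lemma alt_mul_subsets (B : comNzRingType) n (y : 'I_n -> B) (be : 'I_n -> nat) (c : nat -> B) :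
  alt y be * \sum_(S : {ffun 'I_n -> bool}) c (\sum_i S i)%N * \prod_i y i ^+ S i =
  \sum_(S : {ffun 'I_n -> bool}) c (\sum_i S i)%N * alt y (fun i => be i + S i)%N.
Proof.
under [RHS]eq_bigr => S _ do rewrite altE mulr_sumr.
rewrite altE mulr_suml [RHS]exchange_big; apply: eq_bigr => s _ /=.
have s_inj : injective (fun S : {ffun 'I_n -> bool} => [ffun i => S (s i)]).
  by move=> S S' /ffunP E; apply/ffunP => i; have := E ((s^-1)%g i); rewrite !ffunE permKV.
rewrite (reindex_inj s_inj) mulr_sumr; apply: eq_bigr => S _ /=.
have -> : (\sum_i [ffun i0 => S (s i0)] i = \sum_i S i)%N.
  by rewrite [RHS](reindex_inj (@perm_inj _ s)) /=; apply: eq_bigr => i _; rewrite ffunE.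
rewrite mulrCA -mulrA; congr (_ * (_ * _)); rewrite -big_split; apply: eq_bigr => i _ /=.
by rewrite ffunE exprD.
Qed.

Section Raising.
Variables (n d r : nat) (ka : intpart d).
Hypotheses (le_dn : (d <= n)%N) (ka_r : (part ka 0 <= r)%N) (r_gt0 : (0 < r)%N).
Implicit Types S : {ffun 'I_n -> bool}.

(* the exponents of the alternants in [alt_vertex_sA]: the new row comes first,
   and [S] marks the rows of [ka] that gain a box at its expense *)
Definition bex S (i : 'I_n.+1) : nat :=
  if unlift ord0 i is Some j then (part ka j + delta j + S j)%N else (r + (n - \sum_j S j))%N.

Lemma bex0 S : bex S ord0 = (r + (n - \sum_j S j))%N.
Proof. by rewrite /bex unlift_none. Qed.

Lemma bexS S j : bex S (lift ord0 j) = (part ka j + delta j + S j)%N.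
Proof. by rewrite /bex liftK. Qed.

Lemma sum_bool_le S : (\sum_j S j <= n)%N.
Proof.
rewrite -[X in (_ <= X)%N]card_ord -sum1_card; apply: leq_sum => i _; exact: leq_b1.
Qed.

Variable rk : intpart (r + d).
Hypotheses (rk0 : part rk 0 = r) (rkS : forall i, part rk i.+1 = part ka i).

Let ka_le i : (part ka i <= r)%N.
Proof. exact: leq_trans (part_mono ka (leq0n i)) ka_r. Qed.

Lemma plen_ka : (plen ka <= n)%N.
Proof. exact: leq_trans (plen_le ka) le_dn. Qed.

Lemma sum_bex S : (\sum_i bex S i = r + d + \sum_(i < n.+1) delta i)%N.
Proof.
rewrite !big_ord_recl bex0 /= (eq_bigr _ (fun i _ => bexS S i)).
rewrite !big_split /= (sum_part ka le_dn) [delta ord0](_ : _ = n); last by rewrite /delta subSS subn0.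
have -> : (\sum_(i < n) delta (lift ord0 i) = \sum_(i < n) delta i)%N.
  by apply: eq_bigr => i _; rewrite /delta.
have := sum_bool_le S; move: (\sum_j S j)%N (\sum_(i < n) delta i)%N => a b; lia.
Qed.

Definition pre j : {ffun 'I_n -> bool} := [ffun i : 'I_n => (i < j)%N].

Lemma sum_pre j : (j <= n)%N -> (\sum_i pre j i = j)%N.
Proof.
move=> le_jn; under eq_bigr => i _ do rewrite ffunE.
apply: etrans (card_ord_lt le_jn); rewrite -sum1_card [RHS]big_mkcond /=.
by apply: eq_bigr => i _; rewrite inE; case: (i < j)%N.
Qed.

Let m := mult ka r.

Lemma part_eq_r (i : 'I_n) : (part ka i == r) = (i < m)%N.
Proof.
have -> : m = #|[pred i : 'I_n | part ka i == r]|.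
  rewrite /m mult_sum // -sum1_card [RHS]big_mkcond /=.
  transitivity (\sum_(i < n) (part ka i == r))%N.
    apply/esym/(@big_widen0 _ _ _ (fun i => part ka i == r : nat)) => // j le_j.
    by rewrite part_big // ltn_eqF.
  by apply: eq_bigr => j _; rewrite unfold_in /=; case: (_ == _).
rewrite (downset_card (P := [pred i : 'I_n | part ka i == r])) // => {}i j le_ij /= /eqP Ej.
by rewrite eqn_leq ka_le -{1}Ej part_mono.
Qed.

Lemma le_mn : (m <= n)%N.
Proof.
apply: leq_trans le_dn; rewrite /m mult_sum // -[X in (_ <= X)%N]card_ord -sum1_card.
by apply: leq_sum => i _; apply: leq_b1.
Qed.

(** Marking one more of the leading rows of length r exchanges its exponent with that of the new
    row: a transposition for each marked row. *)
Lemma alt_pre (B : comNzRingType) (x : 'I_n.+1 -> B) j : (j <= m)%N ->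
  alt x (bex (pre j)) = (-1) ^+ j * alt x (fun i => part rk i + delta i)%N.
Proof.
elim: j => [|j IHj] le_j.
  rewrite mul1r; apply: eq_alt => // i; case: (unliftP ord0 i) => [k|] ->.
    by rewrite bexS ffunE ltn0 addn0 lift0 rkS /delta.
  by rewrite bex0 sum_pre // rk0 /delta subSS !subn0.
have lt_jn : (j < n)%N by apply: leq_trans le_j le_mn.
rewrite exprS -mulrA -IHj; last exact: ltnW.
pose k := lift ord0 (Ordinal lt_jn).
have -> : -1 = (-1) ^+ (tperm ord0 k : 'S_n.+1) :> B by rewrite odd_tperm neq_lift expr1.
rewrite -alt_perm; apply: eq_alt => // i; case: tpermP => [->|->|/eqP i0 /eqP ik].
- rewrite bex0 bexS ffunE ltnn sum_pre //= addn0 /delta /=.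
  by have /eqP -> : part ka (Ordinal lt_jn) == r by rewrite part_eq_r.
- rewrite bex0 bexS ffunE ltnSn /= sum_pre ?(ltnW lt_jn) // /delta /=.
  have /eqP -> : part ka (Ordinal lt_jn) == r by rewrite part_eq_r.
  lia.
case: (unliftP ord0 i) i0 ik => [l ->|->]; last by rewrite eqxx.
rewrite (inj_eq lift_inj) -val_eqE /= => _ lj; rewrite !bexS !ffunE ltnS leq_eqVlt.
by have -> : (l == j :> nat) = false by apply/negbTE.
Qed.

Definition good S := (S == pre (\sum_i S i)) && (\sum_i S i <= m)%N.

(** Let j be the position of the new row after sorting. By induction the rows before it must be the
    first j rows of ka in order, all of length r and marked; comparing exponents at j shows that
    nothing else is marked. *)
Lemma bex_good S (s : 'S_n.+1) : (forall i : 'I_n.+1, part rk i + delta i = bex S (s i))%N -> good S.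
Proof.
move=> Es; pose j := ((s^-1)%g ord0 : 'I_n.+1).
have sj : s j = ord0 by rewrite permKV.
have key i (lt_in : (i < n)%N) : (i < j)%N ->
   [/\ s (widen_ord (leqnSn n) (Ordinal lt_in)) = lift ord0 (Ordinal lt_in), part ka i = r & S (Ordinal lt_in)].
  elim/ltn_ind: i lt_in => i IH lt_in lt_ij.
  set wi := widen_ord _ _; have rki : part rk i = r.
    case: i IH {wi} lt_in lt_ij => // i IH lt_in lt_ij; rewrite rkS.
    by have [] := IH i (ltnSn i) (ltnW lt_in) (ltnW lt_ij).
  have [t Et] : exists t, s wi = lift ord0 t.
    case: (unliftP ord0 (s wi)) => [t ->|E0]; first by exists t.
    by move: lt_ij; rewrite /j -E0 permK ltnn.
  have := Es wi; rewrite Et bexS /= rki /delta => E1.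
  have Ewi : wi = i :> nat by []. have lt_tn : (t < n)%N := ltn_ord t.
  rewrite Ewi in E1; clearbody wi.
  have le_t : (t <= i)%N.
    by move: E1 (ka_le t) (leq_b1 (S t)); move: (part ka t) (S t : nat) (nat_of_ord t) lt_tn => a b c; lia.
  have Eti : t = i :> nat.
    apply/eqP; rewrite eqn_leq le_t leqNgt; apply/negP => lt_ti.
    have [E2 _ _] := IH t lt_ti (ltn_trans lt_ti lt_in) (ltn_trans lt_ti lt_ij).
    have : wi = widen_ord (leqnSn n) (Ordinal (ltn_trans lt_ti lt_in)).
      by apply: (@perm_inj _ s); rewrite E2 Et; congr lift; apply: val_inj.
    by move/(congr1 val); rewrite /= Ewi => E3; move: (lt_ti); rewrite -E3 ltnn.
  have Et' : t = Ordinal lt_in by apply: val_inj.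
  have [E5 E6] : part ka i = r /\ S t.
    move: E1 (ka_le i); rewrite Eti; move: (part ka i) => a.
    by case: (S t) => /=; [split=> // |]; lia.
  by rewrite -Et'.
have le_jn : (j <= n)%N by rewrite -ltnS.
have rkj : part rk j = r.
  case Ej: (val j) => [|i] //; rewrite rkS.
  have lt_in : (i < n)%N by rewrite -ltnS -Ej; apply: ltn_ord.
  by have [] := key i lt_in; rewrite ?Ej.
have := Es j; rewrite sj bex0 rkj /delta => E1.
have {E1} sumS : (\sum_i S i = j)%N by have := sum_bool_le S; lia.
have Spre (i : 'I_n) : (i < j)%N -> S i.
  by move=> lt_ij; have [_ _] := key i (ltn_ord i) lt_ij; rewrite (_ : Ordinal _ = i) //; apply: val_inj.
rewrite /good sumS; apply/andP; split; last first.
  case: (posnP j) => [-> //|j_gt0]; have lt_j : (j.-1 < n)%N by rewrite -ltnS prednK.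
  rewrite -(prednK j_gt0) -(part_eq_r (Ordinal lt_j)) /=.
  by have [|_ -> _] := key j.-1 lt_j; rewrite ?prednK.
have sumE : (\sum_i S i = \sum_i pre j i)%N by rewrite sum_pre.
have leS (i : 'I_n) : (pre j i <= S i)%N by rewrite ffunE; case: ltnP => // /Spre ->.
apply/eqP/ffunP => i.
have le' : (\sum_(k | k != i) pre j k <= \sum_(k | k != i) S k)%N by apply: leq_sum => k _.
move: sumE (leS i); rewrite (bigD1 i) //= [X in _ = X -> _](bigD1 i) //=.
move: le'; move: (\sum_(k | k != i) pre j k)%N (\sum_(k | k != i) S k)%N => a b.
by case: (S i); case: (pre j i) => //=; lia.
Qed.

Let aux1 u p b X A D t : (b <= p -> X <= A + D -> t <= b ->
  u + (p - b) + (X + t) <= u + A + (p + D))%N.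
Proof. lia. Qed.

Let aux2 X A D t c R G : (X <= A + D -> t <= c -> A <= R -> D + c <= G -> X + t <= R + G)%N.
Proof. lia. Qed.

Lemma bex_dom S (mu : intpart (r + d)) (s : 'S_n.+1) :
  (forall i : 'I_n.+1, part mu i + delta i = bex S (s i))%N -> (plen mu <= n.+1)%N ->
  dom rk mu && ((mu == rk) ==> good S).
Proof.
move=> Es le_mu; apply/andP; split; last first.
  by apply/implyP => /eqP E; apply: (bex_good (s := s)) => i; rewrite -E.
suff key k : (k <= n.+1)%N -> (\sum_(i < k) part mu i <= \sum_(i < k) part rk i)%N.
  apply/domP => k; have [le_k|lt_k] := leqP k n.+1; first exact: key.
  have part0 (la : intpart (r + d)) : (plen la <= n.+1)%N -> forall i, (n.+1 <= i)%N -> part la i = 0%N.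
    move=> le_la i le_i; apply/eqP; rewrite -leqn0 -(eqP (_ : part la n.+1 == 0)%N) -?leq_plen //.
    exact: part_mono.
  rewrite (@big_widen0 _ _ _ (part mu) n.+1 k (ltnW lt_k)); last exact: part0.
  rewrite (@big_widen0 _ _ _ (part rk) n.+1 k (ltnW lt_k)); first exact: key.
  apply: part0; rewrite leq_plen rkS -leq_plen; exact: plen_ka.
move=> le_k; pose I := [set s i | i in [set i : 'I_n.+1 | (i < k)%N]].
have cardI : #|I| = k by rewrite card_imset ?card_ord_lt //; apply: perm_inj.
have sumI : (\sum_(i in I) bex S i = \sum_(i < k) part mu i + \sum_(i < k) (n - i))%N.
  rewrite big_imset /=; last by move=> i j _ _; apply: perm_inj.
  under eq_bigr => i _ do rewrite -Es.
  have EI (F : 'I_n.+1 -> nat) : (\sum_(i in [set i : 'I_n.+1 | (i < k)%N]) F i = \sum_(i < n.+1 | (i < k)%N) F i)%N.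
    by apply: eq_bigl => i; rewrite inE.
  rewrite EI big_split /=.
  rewrite (sum_ord_lt (part mu) le_k); congr (_ + _)%N.
  rewrite -(sum_ord_lt (fun i => (n - i)%N) le_k).
  by apply: eq_bigr => i _; rewrite /delta subSS.
rewrite -(leq_add2r (\sum_(i < k) (n - i))) -sumI.
pose I' := [set j | lift ord0 j \in I].
have cI : (k = (ord0 \in I) + #|I'|)%N.
  rewrite -cardI -sum1_card big_mkcond big_ord_recl -[#|I'|]sum1_card [in RHS]big_mkcond /=.
  congr (_ + _)%N; last by apply: eq_bigr => i _; rewrite inE.
have le_I' : (\sum_(j in I') (part ka j + delta j) <= \sum_(j < #|I'|) (part ka j + (n - j.+1)))%N.
  apply: (sum_set_le (s := 1%g) (f := fun j => part ka j + (n - j.+1))%N) => [i j le_ij|i].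
    by rewrite leq_add ?part_mono //; lia.
  by rewrite perm1.
have SI' : (\sum_(j in I') S j <= #|I'|)%N by rewrite -sum1_card; apply: leq_sum => i _; apply: leq_b1.
have SS : (\sum_(j in I') S j <= \sum_j S j)%N.
  by rewrite [X in (_ <= X)%N](bigID (mem I')) /= leq_addr.
have -> : (\sum_(i in I) bex S i = (ord0 \in I) * (r + (n - \sum_j S j)) +
    (\sum_(j in I') (part ka j + delta j) + \sum_(j in I') S j))%N.
  rewrite big_mkcond big_ord_recl bex0 -big_split /=.
  congr (_ + _)%N; first by case: (ord0 \in I); rewrite ?mul1n ?mul0n.
  by rewrite [RHS]big_mkcond; apply: eq_bigr => i _; rewrite inE bexS.
rewrite [leqRHS]big_split /= in le_I'; have le_S := sum_bool_le S.
(* If the new row is among the k rows, it has given away at least the boxes that the others gained;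
   if not, each gain of a box is paid for by the shift of the staircase. *)
have [hI|hI] := boolP (ord0 \in I).
  rewrite hI add1n in cI; rewrite cI mul1n.
  have -> : (\sum_(i < #|I'|.+1) part rk i = r + \sum_(j < #|I'|) part ka j)%N.
    by rewrite big_ord_recl rk0; congr (_ + _)%N; apply: eq_bigr => i _; rewrite lift0 rkS.
  have -> : (\sum_(i < #|I'|.+1) (n - i) = n + \sum_(j < #|I'|) (n - j.+1))%N.
    by rewrite big_ord_recl subn0; congr (_ + _)%N; apply: eq_bigr => i _; rewrite lift0.
  exact: aux1 le_S le_I' SS.
rewrite (negbTE hI) add0n in cI.
have h1 : (\sum_(j < #|I'|) part ka j <= \sum_(i < k) part rk i)%N.
  rewrite cI; apply: leq_sum => i _; case: (val i) => [|j]; first by rewrite rk0.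
  by rewrite rkS part_mono.
have h2 : (\sum_(j < #|I'|) (n - j.+1) + #|I'| <= \sum_(i < k) (n - i))%N.
  have : (#|I'| <= n)%N by rewrite -[X in (_ <= X)%N]card_ord max_card.
  rewrite cI; move: #|I'| => c le_cn.
  apply: (@leq_trans (\sum_(j < c) (n - j.+1 + 1))%N).
    by rewrite big_split /= sum_nat_const card_ord muln1.
  by apply: leq_sum => j _; have := ltn_ord j; lia.
exact: aux2 le_I' SI' h1 h2.
Qed.

End Raising.

Section HallLittlewood.
Variables (K : fieldType) (N : nat).
Hypothesis K0 : [pchar K] =i pred0.
Notation sA := (@sA K N _).
Notation gphi := (@gphi K N).
Notation vertex := (@vertex K N).

(** With y = 0 the i-th summand drops the variable x_i from s_ka. The factor \prod_j (x_i - z x_j)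
    is expanded over the sets S of indices that contribute - z x_j, and the sum over i is then the
    expansion of an alternant along its first column. *)
Lemma alt_vertex_sA (F : fieldType) (f : {rmorphism K -> F}) n (x : 'I_n.+1 -> F) z r d (ka : intpart d) :
  injective x -> (forall i, x i != 0) -> (0 < r)%N -> (d <= n)%N -> (d + n <= N)%N -> (r + d <= N)%N ->
  alt x (@delta n.+1) * phi f x (vertex z 0 r (sA ka)) =
  (1 - f z) * \sum_(S : {ffun 'I_n -> bool}) (- f z) ^+ (\sum_i S i) * alt x (bex r ka S).
Proof.
move=> x_inj x0 r_gt0 le_dn le_N le_rd.
rewrite phi_vertex //; last exact: (@tau_bound _ _ K0 0 r d _ le_rd (hspan_sA K N ka)).
rewrite eqn0Ngt r_gt0 mulr0 mul0r add0r mulrCA; congr (_ * _).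
pose y (i : 'I_n.+1) (j : 'I_n) := x (lift i j).
have E (i : 'I_n.+1) : alt x (@delta n.+1) *
    (pfcoef x (f z) i * x i ^+ r * phi f (subst1 x i (f 0 * x i)) (sA ka)) =
  \sum_(S : {ffun 'I_n -> bool}) (- f z) ^+ (\sum_j S j) * x i ^+ (r + (n - \sum_j S j)) *
     ((-1) ^+ i * alt (y i) (fun j => part ka j + delta j + S j)%N).
  have -> : phi f (subst1 x i (f 0 * x i)) (sA ka) = phi f (y i) (sA ka).
    apply: eq_spec => k /andP[k_gt0 _]; rewrite (bigD1_ord i) //= /subst1 eqxx rmorph0 mul0r expr0n.
    rewrite eqn0Ngt k_gt0 add0r; apply: eq_bigr => j _.
    by rewrite eq_sym (negbTE (neq_lift i j)).
  have hy := @alt_sA K N K0 F f n (y i) d ka (leq_trans (plen_le ka) le_dn) le_N.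
  have := alt_pfcoef i x_inj (f z); rewrite -/(y i) => hpf.
  rewrite mulrA [X in X * _]mulrA hpf.
  have -> : \prod_(j < n) (x i - f z * x (lift i j)) =
      \sum_(S : {ffun 'I_n -> bool}) (- f z) ^+ (\sum_j S j) * x i ^+ (n - \sum_j S j) * \prod_j y i j ^+ S j.
    have -> : \prod_(j < n) (x i - f z * x (lift i j)) =
       \prod_(j < n) \sum_(b : bool) (if b then - f z * y i j else x i).
      by apply: eq_bigr => j _; rewrite big_bool /= mulNr addrC.
    rewrite bigA_distr_bigA; apply: eq_bigr => S _ /=.
    have -> : (n - \sum_j S j = \sum_j ~~ S j)%N.
      rewrite -[X in (X - _)%N]card_ord -sum1_card (eq_bigr (fun j => ~~ S j + S j)%N) => [|j _]; last by case: (S j).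
      by rewrite big_split /= addnK.
    rewrite -!prodrXr -!big_split; apply: eq_bigr => j _ /=.
    by case: (S j); rewrite ?expr1 ?expr0 ?mulr1 ?mul1r.
  pose c k := (- f z) ^+ k * x i ^+ (n - k).
  have := alt_mul_subsets (y i) (fun j => part ka j + delta j)%N c.
  rewrite /c hy => h.
  transitivity ((-1) ^+ i * x i ^+ r * (alt (y i) (@delta n) * phi f (y i) (sA ka) *
     \sum_(S : {ffun 'I_n -> bool}) (- f z) ^+ (\sum_j S j) * x i ^+ (n - \sum_j S j) * \prod_j y i j ^+ S j)).
    move: (alt (y i) _) (phi f (y i) _) (\sum_S _) ((-1) ^+ i) (x i ^+ r) => a b e g k; ring.
  rewrite h mulr_sumr; apply: eq_bigr => S _; rewrite exprD.
  move: (alt _ _) ((-1) ^+ i) (x i ^+ r) (x i ^+ _) ((- f z) ^+ _) => a b e g k; ring.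
rewrite mulr_sumr; under eq_bigr => i _ do rewrite E.
rewrite exchange_big; apply: eq_bigr => S _ /=.
rewrite /alt (expand_det_col _ ord0) mulr_sumr; apply: eq_bigr => i _.
rewrite mxE bex0 /cofactor addn0 -mulrA; congr (_ * (_ * (_ * \det _))).
by apply/matrixP => j k; rewrite !mxE bexS.
Qed.

(** The good sets mark the first j <= m rows of length r, with m the multiplicity of r. The two
    signs (-1)^j cancel, so the coefficient of s_rk is (1 - z) (1 + z + ... + z^m). *)
Lemma vertex_sA z r d (ka : intpart d) (rk : intpart (r + d)) :
  (0 < r)%N -> (part ka 0 <= r)%N -> part rk 0 = r -> (forall i, part rk i.+1 = part ka i) ->
  (r + d + (r + d).+1 <= N)%N ->
  lspan (fun mu => dom rk mu && (mu != rk)) sA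
    (vertex z 0 r (sA ka) - (1 - z ^+ (mult ka r).+1) *: sA rk).
Proof.
move=> r_gt0 ka_r rk0 rkS le_N; pose n := (r + d)%N.
have le_dn : (d <= n)%N by apply: leq_addl.
have le_rdN : (r + d <= N)%N by apply: leq_trans le_N; apply: leq_addr.
have le_dnN : (d + n <= N)%N by apply: leq_trans le_N; rewrite /n; lia.
pose w (S : {ffun 'I_n -> bool}) : K := if good r ka S then 0 else (1 - z) * (- z) ^+ (\sum_i S i).
apply: (@lift_alt _ _ K0 n.+1 (r + d) _ {ffun 'I_n -> bool} w (bex r ka) _ (leqnSn n) le_N).
- apply: lspanD; last exact/lspanN/lspanZ/hspan_sA.
  exact: hspan_vertex le_rdN (hspan_sA K N ka).
- by move=> S _; apply: (sum_bex le_dn ka_r r_gt0 rk0).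
- have h1 := @alt_vertex_sA _ (@tofrac {mpoly K[n.+1]} \o @mpolyC n.+1 K) n
    (fun i : 'I_n.+1 => tofrac ('X_i : {mpoly K[n.+1]})) z r d ka
    (@frac_var_inj K n.+1) (@frac_var_neq0 K n.+1) r_gt0 le_dn le_dnN le_rdN.
  have le_rk : (plen rk <= n.+1)%N by apply: leq_trans (plen_le rk) (leqnSn n).
  have h2 : galt K (@delta n.+1) * gphi n.+1 (vertex z 0 r (sA ka)) =
      \sum_(S : {ffun 'I_n -> bool}) ((1 - z) * (- z) ^+ (\sum_i S i)) *: galt K (bex r ka S).
    apply/eqP; rewrite -tofrac_eq rmorphM /= /galt rmorph_alt -gphi_frac h1 rmorph_sum mulr_sumr; apply/eqP.
    apply: eq_bigr => S _; rewrite -mul_mpolyC rmorphM /= rmorph_alt mulrA; congr (_ * _).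
    by rewrite !(rmorphM, rmorphB, rmorphXn, rmorphN, rmorph1).
  rewrite rmorphB mulrBr h2 /= gphiZ -scalerAr -gphi_sA // (bigID (good r ka)) /=.
  have -> : \sum_(S | good r ka S) ((1 - z) * (- z) ^+ (\sum_i S i)) *: galt K (bex r ka S) =
      (1 - z ^+ (mult ka r).+1) *: galt K (fun i : 'I_n.+1 => part rk i + delta i)%N.
    have le_m := @le_mn n d r ka le_dn r_gt0.
    rewrite (reindex_onto (fun j : 'I_(mult ka r).+1 => pre n j) (fun S => inord (\sum_i S i))) /=; last first.
      by move=> S /andP[/eqP E le_S]; rewrite inordK.
    have sp (j : 'I_(mult ka r).+1) : (\sum_i pre n j i = j)%N.
      by rewrite sum_pre //; apply: leq_trans le_m; rewrite -ltnS.
    transitivity (\sum_(j < (mult ka r).+1) ((1 - z) * z ^+ j) *: galt K (fun i : 'I_n.+1 => part rk i + delta i)%N).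
      apply: eq_big => j; first by rewrite /good sp inord_val !eqxx -ltnS ltn_ord.
      move=> _; rewrite sp /galt (alt_pre le_dn ka_r r_gt0 rk0 rkS); last by rewrite -ltnS.
      have -> : (-1) ^+ j = ((-1) ^+ j)%:MP :> {mpoly K[n.+1]} by rewrite rmorphXn rmorphN1.
      by rewrite mul_mpolyC scalerA -mulrA -exprMn mulrN mulr1 opprK.
    rewrite -scaler_suml -mulr_sumr; congr (_ *: _).
    by rewrite -[1 - z]opprB mulNr -subrX1 opprB.
  rewrite addrAC subrr add0r [LHS]big_mkcond; apply: eq_bigr => S _; rewrite /w.
  by case: (good r ka S); rewrite /= ?scale0r.
move=> S mu s; rewrite /w; case: ifP => [_|nS _]; first by rewrite eqxx.
move=> le_mu Es; have /andP[h1 /implyP h2] := bex_dom le_dn ka_r r_gt0 rk0 rkS Es le_mu.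
by rewrite h1 /=; apply/negP => /h2; rewrite nS.
Qed.

End HallLittlewood.

(** * Hall-Littlewood functions *)

Section HallLittlewood.
Variables (K : fieldType) (N : nat).
Hypothesis K0 : [pchar K] =i pred0.
Notation A := {mpoly K[N]}.
Notation hgen := (hgen K N).
Notation hspan := (fun d => lspan predT (@hp K N d)).
Notation hp := (@hp K N _).
Notation vertex := (@vertex K N).
Notation theta := (@theta K N).
Notation thinv := (@thinv K N).

Lemma tauD y (a b : A) : tau y (a + b) = tau y a + tau y b.
Proof. exact: rmorphD. Qed.

Lemma vertex_theta z r g : generic z ->
  thinv z (vertex z 0 r (theta z g)) = \sum_(k < N.+1) hgen (r + k) * (tau z g)`_k.
Proof.
move=> gz; rewrite -[RHS](thetaK gz); congr (thinv z _).
rewrite [RHS](big_morph _ (rmorphD (theta z)) (rmorph0 (theta z))); apply: eq_bigr => k _.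
by rewrite [RHS](rmorphM (theta z)) tau_theta coef_map.
Qed.

(** Each term moves f_i boxes from row i of ga into the new row. Moving boxes to the top row and
    sorting only increase partial sums. *)
Lemma raise_hp z r d (ga al : intpart d) (rl : intpart (r + d)) : (r + d <= N)%N ->
  dom ga al -> part rl 0 = r -> (forall i, part rl i.+1 = part al i) ->
  lspan (fun mu => dom mu rl) hp (\sum_(k < N.+1) hgen (r + k) * (tau z (hp ga))`_k).
Proof.
move=> le_N ga_al rl0 rlS; have le_dN : (d <= N)%N by apply: leq_trans le_N; apply: leq_addl.
pose R (f : {ffun 'I_d -> 'I_d.+1}) := [forall i : 'I_d, f i <= part ga i]%N.
pose c f : K := \prod_(i < d) wcoef z (f i : 'I_d.+1).
have E : tau z (hp ga) = \sum_(f : {ffun 'I_d -> 'I_d.+1} | R f)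
    poly_const N (c f) * 'X^(\sum_i f i) * (\prod_(i < d) hgen (part ga i - f i))%:P.
  rewrite [LHS](rmorph_prod (tau z)).
  rewrite (eq_bigr (fun i : 'I_d => \sum_(j < d.+1 | (j <= part ga i)%N)
      poly_const N (wcoef z j) * 'X^j * (hgen (part ga i - j))%:P)) => [|i _]; last first.
    rewrite /= tau_hgen //; last by apply: leq_trans le_dN; apply: part_le.
    rewrite [LHS](big_ord_widen d.+1 (fun j => poly_const N (wcoef z j) * 'X^j * (hgen (part ga i - j))%:P)) //.
    by rewrite ltnS part_le.
  rewrite bigA_distr_big_dep; apply: eq_big => [f|f _].
    by apply/familyP/forallP => h i; have := h i.
  rewrite !big_split /= prodrXr -!rmorph_prod; congr (_ * _ * _).
rewrite E.
under eq_bigr => k _ do rewrite coef_sum mulr_sumr.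
rewrite exchange_big; apply: lspan_sum => f /forallP Rf /=.
have le_f : (\sum_i f i <= d)%N.
  by rewrite -[X in (_ <= X)%N](sum_part ga (leqnn d)); apply: leq_sum => i _; apply: Rf.
have lt_f : (\sum_i f i < N.+1)%N by rewrite ltnS; apply: leq_trans le_dN.
have -> : \sum_(k < N.+1) hgen (r + k) * (poly_const N (c f) * 'X^(\sum_i f i) *
      (\prod_(i < d) hgen (part ga i - f i))%:P)`_k =
    c f *: (hgen (r + \sum_i f i) * \prod_(i < d) hgen (part ga i - f i)).
  move: (\prod_(i < d) _) lt_f (c f); move: (\sum_i f i)%N => sf a lt_f x.
  rewrite (bigD1 (Ordinal lt_f)) //= big1 ?addr0 => [|k]; last first.
    rewrite -val_eqE /= => /negbTE ne; rewrite /poly_const coefMC coefCM coefXn ne.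
    by rewrite mulr0 mul0r mulr0.
  by rewrite /poly_const coefMC coefCM coefXn eqxx mulr1 mulrCA mul_mpolyC.
apply: lspanZ.
pose be (i : 'I_d.+1) := if unlift ord0 i is Some j then (part ga j - f j)%N else (r + \sum_i f i)%N.
have be0 : be ord0 = (r + \sum_i f i)%N by rewrite /be unlift_none.
have beS j : be (lift ord0 j) = (part ga j - f j)%N by rewrite /be liftK.
have sum_f : (\sum_i f i + \sum_(i < d) (part ga i - f i) = d)%N.
  rewrite -big_split /= -[RHS](sum_part ga (leqnn d)); apply: eq_bigr => i _.
  by rewrite subnKC.
have sum_be : (\sum_i be i = r + d)%N.
  rewrite big_ord_recl be0 (eq_bigr _ (fun i _ => beS i)).
  by rewrite -addnA sum_f.
have [rho [s [Es rho0]]] := sort_part sum_be.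
have -> : hgen (r + \sum_i f i) * \prod_(i < d) hgen (part ga i - f i) = hp rho.
  rewrite /(hp _) -(prod_sort_part (hgen0 K N) Es rho0) big_ord_recl be0; congr (_ * _).
  by apply: eq_bigr => i _; rewrite beS.
apply: lspan_mem; apply/domP => k; case: k => [|k]; first by rewrite !big_ord0.
have -> : (\sum_(i < k.+1) part rl i = r + \sum_(i < k) part al i)%N.
  by rewrite big_ord_recl rl0; congr (_ + _)%N; apply: eq_bigr => i _; rewrite lift0 rlS.
apply: (@leq_trans (r + \sum_(i < k) part ga i)%N).
  by rewrite leq_add2l; apply: (domP _ _ ga_al).
have [le_kd|lt_dk] := leqP k d; last first.
  have -> : (\sum_(i < k.+1) part rho i = r + d)%N.
    rewrite (@big_widen0 _ _ _ (part rho) d.+1) ?ltnS ?(ltnW lt_dk) //.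
    transitivity (\sum_i be i)%N; last exact: sum_be.
    by rewrite [RHS](reindex_inj (@perm_inj _ s)); apply: eq_bigr => i _; rewrite Es.
  by rewrite leq_add2l leq_psum.
pose I := [set i : 'I_d.+1 | (i < k.+1)%N].
have cI : #|I| = k.+1 by rewrite /I card_ord_lt.
have := @sum_set_le d.+1 be (part rho) s I (fun i j h => part_mono rho h) (fun i => esym (Es i)).
rewrite cI; apply: leq_trans.
rewrite /I [leqRHS]big_mkcond big_ord_recl inE /= be0 -addnA leq_add2l.
rewrite -(sum_ord_lt (part ga) le_kd) [leqLHS]big_mkcond /=.
rewrite -big_split /=; apply: leq_sum => i _; rewrite inE lift0 ltnS beS /=.
by case: ifP => // _; rewrite subnKC.
Qed.

Lemma spec_homog (c : K) (pi : nat -> K) d f : (d <= N)%N -> hspan d f ->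
  spec idfun (fun k => c ^+ k * pi k) f = c ^+ d * spec idfun pi (f : A).
Proof.
move=> le_dN hf.
have hh k : (k <= N)%N -> spec idfun (fun k => c ^+ k * pi k) (hgen k) = c ^+ k * spec idfun pi (hgen k).
  apply: (spec_hgen K0 idfun (c := fun k => c ^+ k * spec idfun pi (hgen k))).
  have [h0 hS] := spec_newton N K0 idfun pi; split=> [|l lt_lN]; first by rewrite h0 mulr1.
  rewrite mulrCA hS // mulr_sumr; apply: eq_bigr => i _.
  have -> : c ^+ l.+1 = c ^+ i.+1 * c ^+ (l - i).
    by rewrite -exprD; congr (_ ^+ _); have := ltn_ord i; lia.
  by rewrite mulrACA.
case: hf => a ->; rewrite !rmorph_sum mulr_sumr; apply: eq_bigr => mu _ /=.
rewrite !specZ mulrCA; congr (_ * _); rewrite !rmorph_prod /=.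
rewrite (eq_bigr (fun i : 'I_d => c ^+ part mu i * spec idfun pi (hgen (part mu i)))) => [|i _]; last first.
  by apply: hh; apply: leq_trans le_dN; apply: part_le.
by rewrite big_split /= prodrXr sum_part.
Qed.

Definition pspec (z u : K) : A -> K := spec idfun (fun k => (1 - u ^+ k) / (1 - z ^+ k)).
HB.instance Definition _ z u := GRing.RMorphism.on (pspec z u).

Lemma pspecZ z u c f : pspec z u (c *: f) = c * pspec z u f.
Proof. exact: specZ. Qed.

(** After [theta z] the alphabet is 1 - u, on which every h_k with k > 0 equals 1 - u. What remains
    is [tau 0 f] at 1, and removing a variable 1 from (1 - u) / (1 - z) leaves z (1 - u / z) / (1 -
    z). *)
Lemma pspec_vertex z u r d f : generic z -> z != 0 -> (0 < r)%N -> (r + d <= N)%N -> hspan d f ->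
  pspec z u (vertex z 0 r f) = (1 - u) * z ^+ d * pspec z (u / z) f.
Proof.
move=> gz z0 r_gt0 le_N hf; have le_dN : (d <= N)%N by apply: leq_trans le_N; apply: leq_addl.
rewrite /(vertex _ _ _ _) (rmorph_sum (pspec z u)).
pose P := map_poly (pspec z u) (tau 0 f).
have sizeP : (size P <= N.+1)%N.
  apply/leq_sizeP => j lt_Nj; rewrite coef_map /= (@tau_bound _ _ K0 0 r d f le_N hf) ?rmorph0 //.
  by apply: leq_trans lt_Nj (leq_addl _ _).
have P1 : P.[1] = z ^+ d * pspec z (u / z) f.
  rewrite /P horner_tau -spec_homog //; apply: eq_spec => k /andP[k_gt0 _].
  rewrite /= expr0n eqn0Ngt k_gt0 subr0 expr1n mulr1 expr_div_n.
  by have := gz k k_gt0; move: (z ^+ k) (expf_neq0 k z0) (u ^+ k) => a a0 b a1; field; rewrite a1 a0.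
rewrite -mulrA -P1 (horner_coef_wide _ sizeP) mulr_sumr; apply: eq_bigr => k _.
rewrite expr1n mulr1 rmorphM /= coef_map /=.
have [le_rk|lt_rk] := leqP (r + k) N; last by rewrite (@tau_bound _ _ K0 0 r d f le_N hf) // rmorph0 !mulr0.
congr (_ * _); rewrite /pspec thetaE /dop (spec_spec _ _ (f' := idfun)) => [|c]; last exact: specC.
rewrite (eq_spec _ (pi' := fun k => 1 - u ^+ k)); last first.
  move=> j hj; rewrite /= specZ spec_pgen //= mulrCA divff ?mulr1 //.
  by apply: gz; case/andP: hj.
have := newton_conv (newton_geom N (1 : K)) (newton_linear N u).
move/(eq_newton (pi' := fun k => 1 - u ^+ k)) => h.
rewrite (spec_hgen K0 idfun (h _) le_rk) => [|j _]; last by rewrite expr1n.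
have {le_rk} : (0 < r + k)%N by rewrite addn_gt0 r_gt0.
rewrite /conv; case: (r + k)%N => [|j] // _.
rewrite big_ord_recr big_ord_recr /= big1 => [|i _]; last first.
  rewrite coefB coef1 coefZ coefX.
  have -> : (j.+1 - i == 0)%N = false by have := ltn_ord i; lia.
  have -> : (j.+1 - i == 1)%N = false by have := ltn_ord i; lia.
  by rewrite mulr0 subr0 mulr0.
rewrite !expr1n subSnn subnn !mul1r !coefB !coef1 !coefZ !coefX /= mulr0 subr0 mulr1.
by rewrite add0r sub0r addrC.
Qed.

End HallLittlewood.

Lemma ex_tail r d (la : intpart (r + d)) : part la 0 = r ->
  exists al : intpart d, forall i, part al i = part la i.+1.
Proof.
move=> la0; apply: (@ex_partn (r + d)) => [i j le_ij|i le_di|].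
- exact: part_mono.
- by rewrite part_big // ltnW.
have := sum_part la (leqnSn (r + d)); rewrite big_ord_recl la0 => /addnI E.
by apply: etrans E; apply: eq_bigr => i _; rewrite lift0.
Qed.

(** * Removing the first row of a partition *)

Section Tail.
Variables (r d : nat) (la : intpart (r + d)) (al : intpart d).
Hypotheses (la0 : part la 0 = r) (laS : forall i, part la i.+1 = part al i).

Lemma plen_tail : (0 < r)%N -> plen la = (plen al).+1.
Proof.
move=> r_gt0; apply/eqP; rewrite eqn_leq leq_plen laS -leq_plen leqnn /= ltnNge leq_plen.
case Ea: (plen al) => [|k]; first by rewrite la0 -lt0n.
by rewrite laS -lt0n part_gt0 Ea.
Qed.

Lemma bstat_tail : bstat la = (d + bstat al)%N.
Proof.
transitivity (\sum_(i < (r + d).+1) i * part la i)%N.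
  apply/esym/(@big_widen0 _ _ _ (fun i => i * part la i)%N) => // i le_i.
  by rewrite part_big ?muln0.
rewrite big_ord_recl mul0n add0n (eq_bigr (fun i : 'I_(r + d) => part al i + i * part al i)%N); last first.
  by move=> i _; rewrite lift0 laS mulSn.
rewrite big_split /= sum_part ?leq_addl //; congr (_ + _)%N.
rewrite (@big_widen0 _ _ _ (fun i => i * part al i)%N d) ?leq_addl // => i le_i.
by rewrite part_big ?muln0.
Qed.

Lemma mult_tail i : (0 < i)%N -> mult la i = ((r == i) + mult al i)%N.
Proof.
move=> i_gt0; rewrite !mult_sum //.
rewrite -(@big_widen0 _ _ _ (fun j => part la j == i : nat) _ (r + d).+1) //; last first.
  by move=> j le_j; rewrite part_big // ltn_eqF.
rewrite big_ord_recl la0; congr (_ + _)%N.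
rewrite -(@big_widen0 _ _ _ (fun j => part al j == i : nat) d (r + d)) ?leq_addl //; last first.
  by move=> j le_j; rewrite part_big // ltn_eqF.
by apply: eq_bigr => j _; rewrite lift0 laS.
Qed.

End Tail.

Lemma mult_big d (al : intpart d) i : (d < i)%N -> mult al i = 0%N.
Proof.
move=> lt_di; rewrite mult_sum; last exact: leq_ltn_trans lt_di.
by apply: big1 => j _; rewrite ltn_eqF //; apply: leq_ltn_trans lt_di; apply: part_le.
Qed.

Section HallLittlewood.
Variables (K : fieldType) (N : nat).
Hypothesis K0 : [pchar K] =i pred0.
Notation A := {mpoly K[N]}.
Notation hgen := (hgen K N).
Notation hp := (@hp K N _).
Notation sA := (@sA K N _).
Notation vertex := (@vertex K N).
Notation thinv := (@thinv K N).
Notation pspec := (@pspec K N).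

(** Macdonald's b_la(z), the ratio between the Hall-Littlewood functions Q_la and P_la. *)
Definition vfac (z : K) d (la : intpart d) : K :=
  \prod_(i < d) \prod_(j < mult la i.+1) (1 - z ^+ j.+1).

Lemma vfac_neq0 z d (la : intpart d) : generic z -> vfac z la != 0.
Proof. by move=> gz; apply/prodf_neq0 => i _; apply/prodf_neq0 => j _; apply: gz. Qed.

Lemma vfac_tail z r d (la : intpart (r + d)) (al : intpart d) :
  part la 0 = r -> (forall i, part la i.+1 = part al i) -> (0 < r)%N ->
  vfac z la = (1 - z ^+ (mult al r).+1) * vfac z al.
Proof.
move=> la0 laS r_gt0; pose g m : K := \prod_(j < m) (1 - z ^+ j.+1).
have -> : vfac z al = \prod_(i < r + d) g (mult al i.+1).
  apply/esym/(@big_widen0 _ _ _ (fun i => g (mult al i.+1))); first exact: leq_addl.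
  by move=> i le_di; rewrite mult_big ?ltnS // /g big_ord0.
have lt_r : (r.-1 < r + d)%N by rewrite prednK // leq_addr.
rewrite /vfac (bigD1 (Ordinal lt_r)) //= [in RHS](bigD1 (Ordinal lt_r)) //= mulrA; congr (_ * _).
  rewrite prednK // (mult_tail la0 laS) // eqxx add1n big_ord_recr /=; exact: mulrC.
apply: eq_bigr => i; rewrite -val_eqE /= => ne; rewrite (mult_tail la0 laS) //.
by rewrite (_ : (r == i.+1) = false) //; apply: contraNF ne => /eqP/(congr1 predn)/= ->.
Qed.

Lemma vertex_comb z y r (I : Type) (s : seq I) (P : pred I) (c : I -> K) (F : I -> A) :
  vertex z y r (\sum_(i <- s | P i) c i *: F i) = \sum_(i <- s | P i) c i *: vertex z y r (F i).
Proof.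
elim/big_rec2: _ => [|i a b _ IH]; last by rewrite vertexD IH vertexZ.
by have := vertexZ z y r 0 (0 : A); rewrite !scale0r.
Qed.

Lemma ex_row_al r d (al : intpart d) : (part al 0 <= r)%N ->
  exists la : intpart (r + d), part la 0 = r /\ forall i, part la i.+1 = part al i.
Proof.
move=> le_r; pose f i := if i is j.+1 then part al j else r.
have [|||la E] := @ex_partn d.+1 (r + d) f; last by exists la; split=> [|i]; rewrite E.
- case=> [|i] [|j] //= le_ij; last exact: part_mono.
  by apply: leq_trans le_r; apply: part_mono.
- by case=> // i le_i; rewrite /= part_big.
by rewrite big_ord_recl /= (eq_bigr (fun i : 'I_d => part al i)) ?sum_part // => i _; rewrite lift0.
Qed.

Lemma dom_row r d (al be : intpart d) (la mu : intpart (r + d)) :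
  part la 0 = r -> (forall i, part la i.+1 = part al i) ->
  part mu 0 = r -> (forall i, part mu i.+1 = part be i) ->
  dom al be -> dom la mu.
Proof.
move=> la0 laS mu0 muS /domP h; apply/domP => -[|k]; first by rewrite !big_ord0.
rewrite !big_ord_recl la0 mu0 leq_add2l.
rewrite (eq_bigr (fun i : 'I_k => part be i)) => [|i _]; last by rewrite lift0 muS.
have -> : (\sum_(i < k) part la (lift ord0 i) = \sum_(i < k) part al i)%N.
  by apply: eq_bigr => i _; rewrite lift0 laS.
exact: h.
Qed.

(** The factor 1 - z^(m + 1) of [vertex_sA] is the quotient of the two [vfac]. For the second
    property, conjugation by [theta z] turns the vertex operator into the multiplications by h_(r +
    k) of [raise_hp]. *)
Lemma hl_raise z r d (al : intpart d) (la : intpart (r + d)) (Q : A) : z != 0 -> generic z ->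
  (0 < r)%N -> part la 0 = r -> (forall i, part la i.+1 = part al i) ->
  (r + d + (r + d).+1 <= N)%N ->
  lspan (fun mu => dom al mu && (mu != al)) sA (Q - vfac z al *: sA al) ->
  lspan (fun ga => dom ga al) hp (thinv z Q) ->
  [/\ lspan (fun mu => dom la mu && (mu != la)) sA (vertex z 0 r Q - vfac z la *: sA la),
      lspan (fun ga => dom ga la) hp (thinv z (vertex z 0 r Q)) &
      forall u, pspec z u (vertex z 0 r Q) = (1 - u) * z ^+ d * pspec z (u / z) Q].
Proof.
move=> z0 gz r_gt0 la0 laS le_N hQ1 hQ2.
have le_rdN : (r + d <= N)%N by apply: leq_trans le_N; apply: leq_addr.
have al_r : (part al 0 <= r)%N by have := part_mono la (leq0n 1); rewrite laS la0.
split.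
- case: hQ1 => c /eqP; rewrite subr_eq => /eqP ->.
  rewrite vertexD vertexZ vertex_comb (vfac_tail z la0 laS r_gt0) -addrA.
  apply: lspanD; last first.
    rewrite mulrC -scalerA -scalerBr; apply: lspanZ.
    exact: (vertex_sA K0).
  apply: lspan_sum => ka /andP[h1 h2]; apply: lspanZ.
  have ka_r : (part ka 0 <= r)%N.
    by apply: leq_trans al_r; have := domP _ _ h1 1%N; rewrite !big_ord1.
  have [rk [rk0 rkS]] := ex_row_al ka_r.
  have h3 : dom la rk by apply: (dom_row la0 laS rk0 rkS).
  have ne : rk != la.
    apply: contraNneq h2 => E; apply/eqP/partP => i.
    by rewrite -rkS -laS E.
  rewrite -[vertex _ _ _ _](subrK ((1 - z ^+ (mult ka r).+1) *: sA rk)).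
  apply: lspanD; last by apply/lspanZ/lspan_mem; rewrite h3.
  apply: (lspan_sub _ (vertex_sA K0 z r_gt0 ka_r rk0 rkS le_N)) => mu /andP[h4 h5].
  rewrite (dom_trans h3 h4) /=; apply: contraNneq h5 => E.
  by rewrite E in h4 *; rewrite (dom_anti h3 h4).
- case: hQ2 => c Ec; rewrite -[Q](thinvK gz) Ec vertex_theta //.
  have -> : \sum_(k < N.+1) hgen (r + k) * (tau z (\sum_(ga | dom ga al) c ga *: hp ga))`_k =
      \sum_(ga | dom ga al) c ga *: (\sum_(k < N.+1) hgen (r + k) * (tau z (hp ga))`_k).
    rewrite (big_morph (tau z) (@tauD K N z) (rmorph0 (tau z))).
    under [LHS]eq_bigr => k _ do rewrite coef_sum mulr_sumr.
    rewrite exchange_big; apply: eq_bigr => ga _; rewrite scaler_sumr; apply: eq_bigr => k _.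
    by rewrite tauZ coefZ mulrCA mul_mpolyC.
  apply: lspan_sum => ga h; apply: lspanZ.
  exact: raise_hp le_rdN h la0 laS.
move=> u; apply: pspec_vertex => //.
case: hQ1 => c /eqP; rewrite subr_eq => /eqP ->.
apply: lspanD; last exact/lspanZ/hspan_sA.
by apply: lspan_sum => ka _; apply/lspanZ/hspan_sA.
Qed.

(** Q_la is built from the empty partition by adding rows on top. Each row shifts u to u / z and
    contributes z to the size of the partition below it, whence the product and the power
    z^b(la). *)
Lemma ex_hlQ z d (la : intpart d) : z != 0 -> generic z -> (d + d.+1 <= N)%N ->
  exists Q : A,
    [/\ lspan (fun mu => dom la mu && (mu != la)) sA (Q - vfac z la *: sA la),
        lspan (fun ga => dom ga la) hp (thinv z Q) &
        forall u, pspec z u Q = z ^+ bstat la * \prod_(i < plen la) (1 - u / z ^+ i)].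
Proof.
move=> z0 gz; move Ek: (plen la) => k; elim: k d la Ek => [|k IHk] d la Ek le_N.
  have d0 : d = 0%N.
    rewrite -(sum_part la (leqnn d)); apply: big1 => i _; apply/eqP; rewrite -leqn0 leqNgt part_gt0 Ek //.
  subst d; exists 1; split=> [||u].
  - have -> : vfac z la = 1 by rewrite /vfac big_ord0.
    have -> : sA la = 1 by rewrite /(sA _) /JT det_mx00.
    by rewrite scale1r subrr; apply: lspan0.
  - rewrite rmorph1; have -> : 1 = hp la :> A by rewrite /(hp _) big_ord0.
    by apply: lspan_mem; apply: dom_refl.
  by rewrite rmorph1 big_ord0 /bstat big_ord0 expr0 mulr1.
have [r Er] : exists r, part la 0 = r by exists (part la 0).
have r_gt0 : (0 < r)%N by rewrite -Er part_gt0 Ek.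
have [d' Ed] : exists d', d = (r + d')%N by exists (d - r)%N; rewrite subnKC // -Er part_le.
subst d; have [al Eal] := ex_tail Er.
have Ek' : plen al = k by have := plen_tail Er (fun i => esym (Eal i)) r_gt0; rewrite Ek => -[].
have le_N' : (d' + d'.+1 <= N)%N by apply: leq_trans le_N; lia.
have [Q [h1 h2 h3]] := IHk d' al Ek' le_N'.
have [g1 g2 g3] := hl_raise z0 gz r_gt0 Er (fun i => esym (Eal i)) le_N h1 h2.
exists (vertex z 0 r Q); split=> // u; rewrite g3 h3 (bstat_tail (fun i => esym (Eal i))) exprD.
rewrite big_ord_recl expr0 divr1.
have -> : \prod_(i < k) (1 - u / z ^+ lift ord0 i) = \prod_(i < k) (1 - u / z / z ^+ i).
  by apply: eq_bigr => i _; rewrite lift0 exprS invfM mulrA.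
by move: (z ^+ d') (z ^+ _) (\prod_(i < k) _) => a b c; ring.
Qed.

Lemma ex_hl z d (la : intpart d) : z != 0 -> generic z -> (d + d.+1 <= N)%N ->
  exists P : A,
    [/\ lspan (fun mu => dom la mu && (mu != la)) sA (P - sA la),
        lspan (fun ga => dom ga la) hp (thinv z P) &
        forall u, pspec z u P = z ^+ bstat la / vfac z la * \prod_(i < plen la) (1 - u / z ^+ i)].
Proof.
move=> z0 gz le_N; have [Q [h1 h2 h3]] := ex_hlQ la z0 gz le_N; have v0 := vfac_neq0 la gz.
exists ((vfac z la)^-1 *: Q); split=> [||u].
- have := lspanZ (vfac z la)^-1 h1; rewrite scalerBr scalerA mulVf // scale1r; exact.
- by rewrite thinvZ; apply: lspanZ.
by rewrite pspecZ h3 mulrA [_^-1 * _]mulrC.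
Qed.

End HallLittlewood.

(** * Dual Hall-Littlewood functions *)

Section Dual.
Variables (K : fieldType) (N : nat).
Hypothesis K0 : [pchar K] =i pred0.
Notation A := {mpoly K[N]}.
Notation hgen := (hgen K N).
Notation hspan := (fun d => lspan predT (@hp K N d)).
Notation hp := (@hp K N _).
Notation pr := (@pr K N _).
Notation sA := (@sA K N _).
Notation theta := (@theta K N).
Notation thinv := (@thinv K N).
Notation pspec := (@pspec K N).

(* the Hall-Littlewood function P_la with parameter [z] *)
Definition hl z d (la : intpart d) : A := epsilon (inhabits 0) (fun P : A =>
    [/\ lspan (fun mu => dom la mu && (mu != la)) sA (P - sA la),
        lspan (fun ga => dom ga la) hp (thinv z P) &
        forall u, pspec z u P = z ^+ bstat la / vfac z la * \prod_(i < plen la) (1 - u / z ^+ i)]).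

Section Degree.
Variables (z : K) (d : nat).
Hypotheses (z0 : z != 0) (gz : generic z) (le_N : (d + d.+1 <= N)%N).
Implicit Types la mu : intpart d.

Let le_N' : (d + d <= N)%N. Proof. by apply: leq_trans le_N; rewrite addnS. Qed.
Let le_dN : (d <= N)%N. Proof. by apply: leq_trans le_N'; apply: leq_addr. Qed.

Let hlP la : [/\ lspan (fun mu => dom la mu && (mu != la)) sA (hl z la - sA la),
        lspan (fun ga => dom ga la) hp (thinv z (hl z la)) &
        forall u, pspec z u (hl z la) = z ^+ bstat la / vfac z la * \prod_(i < plen la) (1 - u / z ^+ i)].
Proof. exact: (epsilon_spec _ _ (ex_hl K0 la z0 gz le_N)). Qed.

Lemma pspec_hl u la : pspec z u (hl z la) =
  z ^+ bstat la / vfac z la * \prod_(i < plen la) (1 - u / z ^+ i).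
Proof. by have [_ _] := hlP la. Qed.

Lemma hl_sA la : lspan (fun mu => dom la mu) sA (hl z la).
Proof.
have [h _ _] := hlP la; rewrite -[hl z la](subrK (sA la)); apply: lspanD.
  by apply: (lspan_sub _ h) => mu /andP[].
by apply: lspan_mem; apply: dom_refl.
Qed.

Lemma sA_hl la : lspan (fun mu => dom la mu) (hl z (d := d)) (sA la).
Proof.
elim/(@dom_ind d): la => la IH; have [h _ _] := hlP la.
rewrite -[sA la](subKr (hl z la)); apply: lspanD; first by apply: lspan_mem; apply: dom_refl.
apply/lspanN/(lspan_trans h) => mu /andP[h1 h2].
by apply: (lspan_sub _ (IH mu h1 h2)) => ka; apply: dom_trans.
Qed.

Lemma thinv_hl la : lspan (fun ka => dom ka la) sA (thinv z (hl z la)).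
Proof.
have [_ h _] := hlP la; apply: (lspan_trans h) => ga h1.
by apply: (lspan_sub _ (hp_sA K0 ga le_N')) => mu h2; apply: dom_trans h1.
Qed.

Lemma lfree_hl : lfree (fun la : intpart d => hl z la).
Proof.
have h la : lspan predT (hl z (d := d)) (sA la) by apply: (lspan_sub _ (sA_hl la)).
exact: (lspan_swapT h (lfree_sA K0 le_N')).2.
Qed.

Lemma hspan_hl la : hspan d (hl z la).
Proof. by apply: (lspan_trans (hl_sA la)) => mu _; apply: hspan_sA. Qed.

Lemma lspan_hl f : hspan d f -> lspan predT (fun la : intpart d => hl z la) f.
Proof.
move=> hf; rewrite (hspanS K0 le_N' hf); apply: lspan_sum => la _; apply: lspanZ.
by apply: (lspan_sub _ (sA_hl la)).
Qed.

Lemma thinv_sA la : lspan (fun mu => dom mu la) (fun mu => thinv z (hl z mu)) (sA la).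
Proof.
apply: dom_closed_lspan la => [la|]; first exact: thinv_hl.
move=> c Ec; apply: lfree_hl => //; have := congr1 (theta z) Ec.
rewrite (rmorph0 (theta z)) => E0; rewrite -[RHS]E0 (big_morph _ (rmorphD (theta z)) (rmorph0 (theta z))).
by apply: eq_bigr => la _; rewrite [RHS]thetaZ thinvK.
Qed.

(* the basis dual to [hl z], that is, the dual Hall-Littlewood functions *)
Definition hld (mu : intpart d) : intpart d -> K := fun ka =>
  epsilon (inhabits (fun=> 0)) (fun c : intpart d -> K => hp ka = \sum_(la | predT la) c la *: hl z la) mu.

Lemma hld_hl mu la : pr (hld mu) (hl z la) = (mu == la)%:R.
Proof.
have E (ka : intpart d) : hp ka = \sum_mu hld mu ka *: hl z mu.
  have := @lspan_hl (hp ka) (lspan_mem _ isT).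
  exact: (@epsilon_spec (intpart d -> K) (inhabits (fun=> 0)) (fun c => hp ka = \sum_(la | predT la) c la *: hl z la)).
have [c Ec] := hspan_hl la.
have : \sum_mu pr (hld mu) (hl z la) *: hl z mu = \sum_mu (mu == la)%:R *: hl z mu.
  rewrite [RHS](bigD1 la) //= eqxx scale1r [X in _ = _ + X]big1 ?addr0 => [|ka /negbTE ->]; last by rewrite scale0r.
  rewrite [RHS]Ec; under [RHS]eq_bigr => ka _ do rewrite E scaler_sumr.
  rewrite [RHS]exchange_big; apply: eq_bigr => nu _; rewrite Ec pr_sum scaler_suml.
  by apply: eq_bigr => ka _; rewrite prZ pr_hp // scalerA.
by move/(lfree_uniq lfree_hl)/(_ mu).
Qed.

Lemma pr_hl (v : intpart d -> K) f : hspan d f ->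
  pr v f = \sum_mu pr v (hl z mu) * pr (hld mu) f.
Proof.
case/lspan_hl => c ->; rewrite pr_sum; apply: eq_bigr => mu _; rewrite prZ mulrC; congr (_ * _).
rewrite pr_sum (bigD1 mu) //= prZ hld_hl eqxx mulr1 big1 ?addr0 // => la ne.
by rewrite prZ hld_hl eq_sym (negbTE ne) mulr0.
Qed.

Lemma hl_expand f : hspan d f -> f = \sum_mu pr (hld mu) f *: hl z mu.
Proof.
case/lspan_hl => c ->; apply: eq_bigr => mu _; congr (_ *: _).
rewrite pr_sum (bigD1 mu) //= prZ hld_hl eqxx mulr1 big1 ?addr0 // => la ne.
by rewrite prZ hld_hl eq_sym (negbTE ne) mulr0.
Qed.

Lemma hld_sA mu la : ~~ dom la mu -> pr (hld mu) (sA la) = 0.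
Proof.
move=> nd; have [c ->] := sA_hl la; rewrite pr_sum big1 // => ka h.
rewrite prZ hld_hl; case: eqP => [E|_]; last by rewrite mulr0.
by rewrite E h in nd.
Qed.

Lemma hld_theta_sA mu la : ~~ dom mu la -> pr (hld mu) (theta z (sA la)) = 0.
Proof.
move=> nd; have [c ->] := thinv_sA la.
rewrite (big_morph _ (rmorphD (theta z)) (rmorph0 (theta z))) pr_sum big1 // => ka h.
rewrite /= thetaZ thinvK // prZ hld_hl; case: eqP => [E|_]; last by rewrite mulr0.
by rewrite E h in nd.
Qed.

Lemma hld_sAmu mu : pr (hld mu) (sA mu) = 1.
Proof.
have [h _ _] := hlP mu; have := hld_hl mu mu; rewrite eqxx -[hl z mu](subrK (sA mu)) prD.
case: h => c ->; rewrite pr_sum big1 ?add0r // => ka /andP[h1 h2].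
by rewrite prZ hld_sA ?mulr0 //; apply/negP => h3; move: h2; rewrite (dom_anti h3 h1) eqxx.
Qed.

(** Both conditions together kill P_ka for ka != mu: if mu dominates ka, its Schur expansion runs
    over shapes not above mu; otherwise its expansion in the [theta z (sA la)] runs over shapes not
    below mu. *)
Lemma hld_uniq (v : intpart d -> K) mu f :
  (forall la, ~~ dom la mu -> pr v (sA la) = 0) ->
  (forall la, ~~ dom mu la -> pr v (theta z (sA la)) = 0) -> hspan d f ->
  pr v f = pr v (sA mu) * pr (hld mu) f.
Proof.
move=> h1 h2 hf; have v0 ka : ka != mu -> pr v (hl z ka) = 0.
  move=> ne; have [h|h] := boolP (dom mu ka).
    have [c ->] := hl_sA ka; rewrite pr_sum big1 // => la h3; rewrite prZ h1 ?mulr0 //.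
    by apply/negP => h4; move: ne; rewrite (dom_anti (dom_trans h3 h4) h) eqxx.
  rewrite -[hl z ka](thinvK gz); have [c ->] := thinv_hl ka.
  rewrite (big_morph _ (rmorphD (theta z)) (rmorph0 (theta z))) pr_sum big1 // => la h3.
  by rewrite /= thetaZ prZ h2 ?mulr0 //; apply: contra h => h4; apply: dom_trans h3.
have E g : hspan d g -> pr v g = pr v (hl z mu) * pr (hld mu) g.
  by move=> hg; rewrite (pr_hl v hg) (bigD1 mu) //= big1 ?addr0 // => ka ne; rewrite v0 ?mul0r.
by rewrite E // [pr v (sA mu)]E ?hld_sAmu ?mulr1 //; apply: hspan_sA.
Qed.

Lemma form_hgen f : hspan d f -> form d f (hgen d) = spec idfun (fun=> 1) f.
Proof.
case=> c ->; rewrite form_sym form_sumr rmorph_sum; apply: eq_bigr => mu _.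
rewrite formZr /= specZ; congr (_ * _); rewrite form_sym.
pose al := [multinom d | i < 1].
have -> : hgen d = \prod_(i < 1) hgen (al i) by rewrite big_ord1 mnmE.
rewrite -gphi_coef //; last exact: lspan_mem.
have h1 (F : idomainType) (g : {rmorphism K -> F}) (y : F) k : (k <= N)%N ->
    spec g (fun k => y ^+ k) (hgen k) = y ^+ k.
  by move=> le_kN; apply: (spec_hgen K0 g (newton_geom N y)).
rewrite /(hp _) !rmorph_prod /=.
rewrite [RHS]big1 => [|i _]; last first.
  rewrite (eq_spec _ (pi' := fun k => 1 ^+ k)) => [|k _]; last by rewrite expr1n.
  by rewrite h1 ?expr1n // (leq_trans (part_le _ _)).
rewrite (eq_bigr (fun i : 'I_d => ('X_ord0 : {mpoly K[1]}) ^+ part mu i)) => [|i _]; last first.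
  rewrite /gphi /phi (eq_spec _ (pi' := fun k => ('X_ord0 : {mpoly K[1]}) ^+ k)) => [|k _]; last by rewrite big_ord1.
  by rewrite h1 // (leq_trans (part_le _ _)).
rewrite prodrXr sum_part // mpolyXn mcoeffX (_ : (_ == _) = true) //.
by apply/eqP/mnmP => i; rewrite mulmnE mnm1E !ord1 mnmE mul1n.
Qed.

(** Pairing with [thinv z (hl z mu)] satisfies the conditions of [hld_uniq], hence is a multiple of
    [hld mu]. Its value at h_d is the principal specialization of P_mu at u = 0, which is
    nonzero. *)
Lemma hld_hgen_neq0 mu : pr (hld mu) (hgen d) != 0.
Proof.
pose v (ka : intpart d) := form d (hp ka) (thinv z (hl z mu)).
have vE f : hspan d f -> pr v f = form d f (thinv z (hl z mu)).
  case=> c ->; rewrite pr_sum form_sym form_sumr; apply: eq_bigr => ka _.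
  by rewrite prZ pr_hp // formZr form_sym.
have hsp (la : intpart d) : hspan d (theta z (sA la)) by rewrite thetaE; apply: hspan_dop => //; apply: hspan_sA.
have hg := hspan_hgen K N d.
have E : pr v (hgen d) = pr v (sA mu) * pr (hld mu) (hgen d).
  apply: hld_uniq => // [la nd|la nd].
    by rewrite vE ?(lspan_form K0 le_N' (thinv_hl mu)) //; apply: hspan_sA.
  rewrite vE // thetaE form_dop -thetaE thinvK //.
  by rewrite (lspan_form K0 le_N' (hl_sA mu)).
have : pr v (hgen d) != 0.
  rewrite vE // form_sym form_hgen; last by apply: hspan_dop => //; apply: hspan_hl.
  have -> : spec idfun (fun=> 1) (thinv z (hl z mu)) = pspec z 0 (hl z mu).
    rewrite /(thinv _) /dop (spec_spec _ _ (f' := idfun)) => [|c]; last exact: specC.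
    apply: eq_spec => k hk; rewrite /= specZ spec_pgen // mulr1; case/andP: hk => k_gt0 _.
    by rewrite expr0n eqn0Ngt k_gt0 subr0 mul1r.
  rewrite pspec_hl big1 ?mulr1 => [|i _]; last by rewrite mul0r subr0.
  by rewrite mulf_neq0 ?invr_eq0 ?vfac_neq0 ?expf_neq0.
by apply: contraNneq => E0; rewrite E E0 mulr0.
Qed.

End Degree.
End Dual.

(** * The q-series identity *)

Section QBinomial.
Variables (K : fieldType) (q : K).
Hypotheses (q0 : q != 0) (gq : generic q).

Definition qpoch r : K := \prod_(i < r) (1 - q ^+ i.+1).

Definition qfalling r u : K := \prod_(i < r) (1 - u / q ^+ i).

(* the coefficient of prod_(i < r) (1 - u q^-i) in prod_(i < k) (1 - u q^i) *)
Fixpoint qconn k r : K := if k is k'.+1 then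
  (1 - q ^+ (k' + r)) * qconn k' r + (if r is r'.+1 then q ^+ (k' + r') * qconn k' r' else 0)
  else (r == 0%N)%:R.

Lemma qconn_big k r : (k < r)%N -> qconn k r = 0.
Proof.
elim: k r => [|k IHk] [|r] //= lt_kr.
by rewrite !IHk ?mulr0 ?addr0 // ltnW.
Qed.

Lemma qconn0 k : qconn k.+1 0 = 0.
Proof.
elim: k => [|k IHk]; first by rewrite /= subrr mul0r addr0.
by rewrite [LHS]/= -/(qconn k.+1 0) IHk mulr0 addr0.
Qed.

Lemma qfallingS r u : (1 - u / q ^+ r) * qfalling r u = qfalling r.+1 u.
Proof. by rewrite /qfalling big_ord_recr mulrC. Qed.

Lemma qraising_expand k n u : (k <= n)%N ->
  \prod_(i < k) (1 - u * q ^+ i) = \sum_(r < n.+1) qconn k r * qfalling r u.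
Proof.
elim: k => [|k IHk] le_kn.
  rewrite big_ord0 big_ord_recl /= /qfalling big_ord0 mulr1 big1 ?addr0 // => i _.
  by rewrite mul0r.
rewrite big_ord_recr /= IHk ?(ltnW le_kn) // mulr_suml.
(* Origin of the recursion of [qconn]: 1 - u q^k is q^(k + r) (1 - u q^-r) plus the constant 1 -
   q^(k + r). *)
have E r : (1 - u * q ^+ k) * qfalling r u =
    q ^+ (k + r) * qfalling r.+1 u + (1 - q ^+ (k + r)) * qfalling r u.
  rewrite -qfallingS mulrA -mulrDl; congr (_ * _); rewrite exprD.
  by have := expf_neq0 r q0; move: (q ^+ k) (q ^+ r) => a b b0; field.
under [LHS]eq_bigr => r _ do rewrite -mulrA [X in _ * X]mulrC E mulrDr.
under [RHS]eq_bigr => r _ do rewrite mulrDl.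
rewrite [LHS]big_split /= [LHS]addrC [RHS]big_split /=; congr (_ + _).
  by apply: eq_bigr => r _; rewrite mulrA [_ * qconn _ _]mulrC.
rewrite big_ord_recr /= qconn_big // mul0r addr0 big_ord_recl mul0r add0r.
by apply: eq_bigr => r _; rewrite lift0 mulrA [_ * qconn _ _]mulrC.
Qed.

Lemma qfalling_shift j k : qfalling j.+1 (q ^+ k.+1) = (1 - q ^+ k.+1) * qfalling j (q ^+ k).
Proof.
rewrite /qfalling big_ord_recl expr0 divr1; congr (_ * _); apply: eq_bigr => i _.
by rewrite lift0 !exprS -mulf_div divff // mul1r.
Qed.

Lemma qpochS r : qpoch r.+1 = qpoch r * (1 - q ^+ r.+1).
Proof. by rewrite /qpoch big_ord_recr. Qed.

(** Closed form of the connection coefficients, checked against their recursion. Its dependence on k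
    is [qfalling j (q ^+ k)], the same shape as the specialization of s_nu, which makes the final
    sum collapse. *)
Lemma qconnE k j : qconn k.+1 j.+1 * qpoch j * qpoch j.+1 =
  q ^+ (j * j.+1) * qpoch k.+1 * qfalling j (q ^+ k).
Proof.
elim: k j => [|k IHk] j.
  case: j => [|j].
    have -> : qconn 1 1 = 1 by rewrite /= mulr0 add0r expr0 mulr1.
    by rewrite /qfalling /qpoch !big_ord0 mul0n expr0 !mul1r !mulr1.
  have -> : qconn 1 j.+2 = 0 by rewrite /= mulr0 add0r mulr0.
  by rewrite !mul0r /qfalling big_ord_recl !expr0 divr1 subrr mul0r mulr0.
have -> : qconn k.+2 j.+1 = (1 - q ^+ (k.+1 + j.+1)) * qconn k.+1 j.+1 + q ^+ (k.+1 + j) * qconn k.+1 j by [].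
case: j => [|j].
  rewrite qconn0 mulr0 addr0 -!mulrA [qconn _ _ * _]mulrA IHk addn1 mul0n expr0 !mul1r.
  by rewrite /qfalling !big_ord0 !mulr1 (qpochS k.+1) mulrC.
rewrite qfalling_shift (qpochS k.+1).
have h1 := IHk j.+1; have h2 := IHk j.
rewrite -qfallingS in h1.
rewrite mulrDl mulrDl.
have -> : (1 - q ^+ (k.+1 + j.+2)) * qconn k.+1 j.+2 * qpoch j.+1 * qpoch j.+2 =
   (1 - q ^+ (k.+1 + j.+2)) * (qconn k.+1 j.+2 * qpoch j.+1 * qpoch j.+2) by rewrite !mulrA.
have -> : q ^+ (k.+1 + j.+1) * qconn k.+1 j.+1 * qpoch j.+1 * qpoch j.+2 =
   q ^+ (k.+1 + j.+1) * (1 - q ^+ j.+1) * (1 - q ^+ j.+2) * (qconn k.+1 j.+1 * qpoch j * qpoch j.+1).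
  rewrite (qpochS j.+1) {1}(qpochS j).
  by move: (qpoch j.+1) (qpoch j) (qconn _ _) (q ^+ (k.+1 + _)) (q ^+ j.+1) (q ^+ j.+2) => a b c e g h; ring.
rewrite h1 h2.
have -> : q ^+ (j.+1 * j.+2) = q ^+ (j * j.+1) * (q ^+ j * q * (q ^+ j * q)).
  by rewrite -exprSr -!exprD; congr (_ ^+ _); lia.
rewrite !addSn !addnS !exprS exprD.
move: (q ^+ (j * j.+1)) (qpoch k.+1) (qfalling j _) (expf_neq0 j q0); move: (q ^+ j) (q ^+ k) => J Q a b c J0.
by field.
Qed.

(** Evaluation at u = q^M is triangular: [qfalling r] vanishes there for r > M, and does not for r =
    M. *)
Lemma qfalling_indep n (a : nat -> K) :
  (forall u, \sum_(r < n.+1) a r * qfalling r u = 0) -> forall r, (r <= n)%N -> a r = 0.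
Proof.
move=> h; elim/ltn_ind => M IH le_Mn; have := h (q ^+ M).
have lt_M : (M < n.+1)%N by [].
rewrite (bigD1 (Ordinal lt_M)) //= big1 ?addr0 => [|r].
  move/eqP; rewrite mulf_eq0 => /orP[/eqP //|/eqP E0]; exfalso.
  have : qfalling M (q ^+ M) != 0.
    apply/prodf_neq0 => i _; rewrite -expfB // gq // subn_gt0; exact: ltn_ord.
  by rewrite E0 eqxx.
rewrite -val_eqE /= neq_ltn => /orP[lt_r|lt_r]; first by rewrite IH ?mul0r // (leq_trans (ltnW lt_r)).
rewrite [qfalling _ _](_ : _ = 0) ?mulr0 // /qfalling (bigD1 (Ordinal lt_r)) //=.
by rewrite divff ?expf_neq0 // subrr mul0r.
Qed.

End QBinomial.

Lemma genericV (K : fieldType) (q : K) : q != 0 -> generic q -> generic q^-1.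
Proof.
move=> q0 gq k k_gt0; rewrite exprVn -(mulfV (expf_neq0 k q0)) -[X in _ - X]mul1r -mulrBl.
by rewrite mulf_neq0 ?invr_eq0 ?expf_neq0 // -opprB oppr_eq0 gq.
Qed.

Section Identity.
Variables (K : fieldType) (N : nat).
Hypothesis K0 : [pchar K] =i pred0.
Notation A := {mpoly K[N]}.
Notation pr := (@pr K N _).
Notation hspan := (fun d => lspan predT (@hp K N d)).
Notation sA := (@sA K N _).
Notation pspec := (@pspec K N).
Notation omegaA := (@omegaA K N).
Notation hl := (@hl K N).
Notation hld := (@hld K N).

Definition hlcoef (z : K) d (f : A) r : K :=
  \sum_(mu : intpart d | plen mu == r) z ^+ bstat mu / vfac z mu * pr (hld z mu) f.

Lemma pspec_hlcoef (z : K) d (f : A) u : z != 0 -> generic z -> (d + d.+1 <= N)%N -> hspan d f ->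
  pspec z u f = \sum_(r < d.+1) hlcoef z d f r * \prod_(i < r) (1 - u / z ^+ i).
Proof.
move=> z0 gz le_N hf; rewrite {1}(hl_expand K0 z0 gz le_N hf) (rmorph_sum (pspec z u)).
rewrite (partition_big (fun mu : intpart d => inord (plen mu) : 'I_d.+1) predT) //=.
apply: eq_bigr => r _; rewrite /hlcoef mulr_suml.
apply: eq_big => mu; first by rewrite -val_eqE /= inordK // ltnS plen_le.
move/eqP => <-; rewrite inordK ?ltnS ?plen_le // pspecZ (pspec_hl K0 z0 gz le_N) mulrA; congr (_ * _).
exact: mulrC.
Qed.

(** Since (-1)^(k - 1) / (1 - q^-k) = (- q)^k / (1 - q^k), omega exchanges the parameters q and 1/q
    up to a factor of degree d. *)
Lemma pspec_omega (q : K) d (f : A) u : q != 0 -> generic q -> (d <= N)%N -> hspan d f ->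
  pspec q^-1 u (omegaA f) = (- q) ^+ d * pspec q u f.
Proof.
move=> q0 gq le_dN hf; rewrite /(omegaA _) /dop (spec_spec _ _ (f' := idfun)) => [|c]; last exact: specC.
rewrite /pspec -spec_homog //; apply: eq_spec => k hk; rewrite /= pspecZ /pspec spec_pgen //.
case/andP: hk => k_gt0 _; have := gq k k_gt0; have := genericV q0 gq k_gt0.
rewrite exprVn -[in RHS]mulN1r exprMn; case: k k_gt0 => // k _ /=.
rewrite [(-1) ^+ k.+1]exprS; have := expf_neq0 k.+1 q0.
move: (q ^+ k.+1) (u ^+ k.+1) ((-1) ^+ k) => a b e a0 h1 h2; field.
by rewrite a0 h2 /= -opprB oppr_eq0.
Qed.

(** The quotient (1 - z^-k) / (1 - z^k) is - z^-k, so the pairing with e_d is the principal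
    specialization at u = 1 / z, rescaled by - z. *)
Lemma elem_pspec (z : K) d (f : A) : z != 0 -> generic z -> (d <= N)%N -> hspan d f ->
  spec idfun (fun k => (-1) ^+ k.-1) f = (- z) ^+ d * pspec z z^-1 f.
Proof.
move=> z0 gz le_dN hf; rewrite /pspec -spec_homog //; apply: eq_spec => k /andP[k_gt0 _].
have := gz k k_gt0; rewrite exprVn -[in RHS]mulN1r exprMn; case: k k_gt0 => // k _ /=.
rewrite [(-1) ^+ k.+1]exprS; have := expf_neq0 k.+1 z0.
by move: (z ^+ k.+1) ((-1) ^+ k) => a e a0 h1; field; rewrite h1 a0.
Qed.

Variables (q : K) (n : nat) (f : A).
Hypotheses (q0 : q != 0) (gq : generic q) (n_gt0 : (0 < n)%N) (le_N : (n + n.+1 <= N)%N).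
Hypothesis hf : hspan n f.

Let le_dN : (n <= N)%N. Proof. by apply: leq_trans le_N; apply: leq_addr. Qed.
Let q0' : q^-1 != 0. Proof. by rewrite invr_eq0. Qed.
Let gq' := genericV q0 gq.
Let D := hlcoef q n f.
Let E := hlcoef q^-1 n (omegaA f).

Let hspan_of : hspan n (omegaA f). Proof. exact: hspan_dop. Qed.

Let plen_gt0 (mu : intpart n) : (0 < plen mu)%N.
Proof.
rewrite lt0n; apply: contraL n_gt0 => /eqP E0; rewrite -leqNgt -(sum_part mu (leqnn n)).
rewrite big1 // => i _; apply/eqP; rewrite -leqn0 leqNgt part_gt0 E0 //.
Qed.

(** Two expansions of one polynomial in u: that of f with parameter q, and that of omega f with
    parameter 1/q, whose products [qconn] rewrites. The coefficients agree by [qfalling_indep]. *)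
Lemma hlcoef_conn r : (- q) ^+ n * D r = \sum_(k < n.+1) E k * qconn q k r.
Proof.
have [le_rn|lt_nr] := leqP r n; last first.
  rewrite [D r]big_pred0 ?mulr0 => [|mu]; last first.
    by apply/negbTE; rewrite neq_ltn (leq_ltn_trans (plen_le mu) lt_nr).
  by rewrite big1 // => k _; rewrite qconn_big ?mulr0 //; apply: leq_ltn_trans lt_nr; rewrite -ltnS.
apply/eqP; rewrite -subr_eq0; apply/eqP.
apply: (qfalling_indep q0 gq (a := fun r => (- q) ^+ n * D r - \sum_(k < n.+1) E k * qconn q k r)) le_rn => u.
under eq_bigr => i _ do rewrite mulrBl -mulrA.
rewrite sumrB -mulr_sumr -(pspec_hlcoef u q0 gq le_N hf) -pspec_omega //.
rewrite (pspec_hlcoef u q0' gq' le_N hspan_of).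
apply/eqP; rewrite subr_eq0; apply/eqP.
under [RHS]eq_bigr => i _ do rewrite mulr_suml.
rewrite exchange_big; apply: eq_bigr => k _ /=.
under [RHS]eq_bigr => i _ do rewrite -mulrA.
have le_kn : (k <= n)%N by rewrite -ltnS.
rewrite -mulr_sumr -(qraising_expand q0 u le_kn); congr (_ * _).
by apply: eq_bigr => i _; rewrite exprVn invrK.
Qed.

Lemma hlcoef_sum j : \sum_(k < n.+1) qpoch q k * qfalling q j (q ^+ k / q) * E k =
  (- q) ^+ n / q ^+ (j * j.+1) * qpoch q j * qpoch q j.+1 * D j.+1.
Proof.
have -> : (- q) ^+ n / q ^+ (j * j.+1) * qpoch q j * qpoch q j.+1 * D j.+1 =
   qpoch q j * qpoch q j.+1 / q ^+ (j * j.+1) * ((- q) ^+ n * D j.+1).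
  by move: (q ^+ _)^-1 (D _) (qpoch q j) (qpoch q j.+1) ((- q) ^+ n) => a b c e g; ring.
rewrite hlcoef_conn mulr_sumr; apply: eq_bigr => -[[|k] lt_k] _ /=.
  (* As n > 0, no partition of n has length 0; this spares the case k = 0, where q^(k - 1) would not
     match [qconnE]. *)
  have -> : E 0%N = 0; last by rewrite !mul0r !mulr0.
  by apply: big_pred0 => mu; rewrite gtn_eqF ?plen_gt0.
rewrite exprSr mulfK //.
have h := qconnE q0 k j; have h0 := expf_neq0 (j * j.+1) q0.
have -> : qpoch q k.+1 * qfalling q j (q ^+ k) = qconn q k.+1 j.+1 * qpoch q j * qpoch q j.+1 / q ^+ (j * j.+1).
  by rewrite h -[q ^+ _ * _ * _]mulrA mulrAC divff // mul1r.
rewrite -/(qconn q k.+1 j.+1).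
by move: (q ^+ _)^-1 (E _) (qpoch q j) (qpoch q j.+1) (qconn _ _ _) => a b c e g; ring.
Qed.

(** The factor in parentheses is s_nu(q, ..., q^(l(mu) - 1)). Expanding it in the products
    [qfalling j] and grouping mu by length k leaves for each j the sum computed in [hlcoef_sum]. *)
Lemma hl_identity m (nu : intpart m) : (m + m.+1 <= N)%N ->
  \sum_(mu : intpart n) spec idfun (fun k => (-1) ^+ k.-1) (hl q^-1 mu) *
     (q ^+ m * pspec q (q ^+ plen mu / q) (sA nu)) * pr (hld q^-1 mu) (omegaA f) =
  \sum_(j < m.+1) q ^+ m / q ^+ (j * j.+1) * qpoch q j * qpoch q j.+1 *
     hlcoef q m (sA nu) j * hlcoef q n f j.+1.
Proof.
move=> le_mN; have q1 : (- q^-1) ^+ n * (- q) ^+ n = 1.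
  by rewrite -exprMn mulrNN mulVf // expr1n.
transitivity (\sum_(j < m.+1) q ^+ m * hlcoef q m (sA nu) j * (- q^-1) ^+ n *
    \sum_(k < n.+1) qpoch q k * qfalling q j (q ^+ k / q) * E k); last first.
  apply: eq_bigr => j _; rewrite hlcoef_sum.
  have -> : q ^+ m / q ^+ (j * j.+1) * qpoch q j * qpoch q j.+1 * hlcoef q m (sA nu) j * hlcoef q n f j.+1 =
     (- q^-1) ^+ n * (- q) ^+ n * (q ^+ m / q ^+ (j * j.+1) * qpoch q j * qpoch q j.+1 * hlcoef q m (sA nu) j * D j.+1).
    by rewrite q1 mul1r.
  move: (q ^+ _)^-1 (D _) (qpoch q j) (qpoch q j.+1) ((- q) ^+ n) ((- q^-1) ^+ n) (q ^+ m) (hlcoef _ _ _ _).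
  by move=> a b c e g h i k; ring.
rewrite (partition_big (fun mu : intpart n => inord (plen mu) : 'I_n.+1) predT) //=.
under [RHS]eq_bigr => j _ do rewrite mulr_sumr.
rewrite [RHS]exchange_big; apply: eq_bigr => k _ /=.
transitivity ((- q^-1) ^+ n * qpoch q k * (q ^+ m * pspec q (q ^+ k / q) (sA nu)) * E k).
  rewrite mulr_sumr; apply: eq_big => mu; first by rewrite -val_eqE /= inordK // ltnS plen_le.
  move/eqP => <-; rewrite inordK ?ltnS ?plen_le //.
  rewrite (elem_pspec q0' gq' le_dN (hspan_hl K0 q0' gq' le_N mu)) (pspec_hl K0 q0' gq' le_N).
  (* Pairing with e_n is specialization at u = 1 / z; for z = 1/q this is u = q, and the factors
     become 1 - q^(i + 1). *)
  have -> : \prod_(i < plen mu) (1 - q^-1^-1 / q^-1 ^+ i) = qpoch q (plen mu).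
    by apply: eq_bigr => i _; rewrite invrK exprVn invrK -exprS.
  move: (qpoch q _) (pspec q _ _) (pr _ _) (q^-1 ^+ _) (vfac _ _)^-1 ((- q^-1) ^+ n) (q ^+ m).
  by move=> a b c e g h i; ring.
rewrite (pspec_hlcoef _ q0 gq le_mN (hspan_sA K N nu)) [q ^+ m * _]mulr_sumr [_ * qpoch _ _ * _]mulr_sumr [LHS]mulr_suml; apply: eq_bigr => j _.
rewrite -/(qfalling q j _).
move: (qpoch q _) (qfalling q _ _) (E _) (hlcoef _ _ _ _) ((- q^-1) ^+ n) (q ^+ m).
by move=> a b c e g h; ring.
Qed.

End Identity.

(** * Specialization at t = 0 *)

Section FracAux.
Variable F : fieldType.
Implicit Types a b c d x y : F.

Lemma frac_addf a b c d : b != 0 -> d != 0 -> a / b + c / d = (a * d + c * b) / (b * d).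
Proof. by move=> b0 d0; field; rewrite b0 d0. Qed.

Lemma eval_addf x y a b c d : x * b = a -> y * d = c -> (x + y) * (b * d) = a * d + c * b.
Proof. by move=> <- <-; ring. Qed.

Lemma eval_invf y b a : y != 0 -> y * b = a -> y^-1 * a = b.
Proof. by move=> y0 <-; rewrite mulKf. Qed.

Lemma cancel_factor x y a : x != 0 -> y / x * (a * x) = y * a.
Proof. by move=> x0; rewrite mulrACA mulVf ?mulr1. Qed.

End FracAux.

Notation sp := at_t0_eq.
Notation c0 := (fun a : {poly rat} => tofrac (a%:P : {poly {poly rat}}) : Qqt).

Lemma spD x y x' y' : sp x x' -> sp y y' -> sp (x + y) (x' + y').
Proof.
case=> [n [d [d0 -> E]]] [m [e [e0 -> E']]].
exists (n * e + m * d), (d * e); split.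
- by rewrite coef0M mulf_neq0.
- have dn0 : d != 0 by apply: contraNneq d0 => ->; rewrite coef0.
  have en0 : e != 0 by apply: contraNneq e0 => ->; rewrite coef0.
  by rewrite rmorphD !rmorphM frac_addf // tofrac_eq0.
rewrite coef0M coefD !coef0M polyCD !polyCM rmorphD !rmorphM.
exact: eval_addf.
Qed.

Lemma spM x y x' y' : sp x x' -> sp y y' -> sp (x * y) (x' * y').
Proof.
case=> [n [d [d0 -> E]]] [m [e [e0 -> E']]].
exists (n * m), (d * e); split; first by rewrite coef0M mulf_neq0.
  by rewrite !rmorphM mulf_div.
by rewrite !coef0M !polyCM !rmorphM mulrACA; congr (_ * _).
Qed.

Lemma spV x x' : x' != 0 -> sp x x' -> sp x^-1 x'^-1.
Proof.
move=> x'0 [n [d [d0 -> E]]]; exists d, n; split; last exact: eval_invf.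
  apply: contra_neq x'0 => n0; move/eqP: E; rewrite n0 polyC0 rmorph0 mulf_eq0 => /orP[/eqP //|].
  by rewrite tofrac_eq0 polyC_eq0 (negbTE d0).
by rewrite invf_div.
Qed.

Lemma sp_poly (p : {poly {poly rat}}) : sp (tofrac p) (c0 p`_0).
Proof.
exists p, 1; split; first by rewrite coefC oner_eq0.
  by rewrite rmorph1 divr1.
by rewrite coefC polyC1 rmorph1 mulr1.
Qed.

Lemma sp_c0 a : sp (c0 a) (c0 a).
Proof. by have := sp_poly a%:P; rewrite coefC. Qed.

Lemma sp0 : sp 0 0. Proof. by have := sp_c0 0; rewrite polyC0 rmorph0. Qed.
Lemma sp1 : sp 1 1. Proof. by have := sp_c0 1; rewrite polyC1 rmorph1. Qed.
Lemma sp_qq : sp qq qq. Proof. exact: sp_c0. Qed.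
Lemma sp_tt : sp tt 0.
Proof. by have := sp_poly 'X; rewrite coefX polyC0 rmorph0. Qed.

Lemma spN x y : sp x y -> sp (- x) (- y).
Proof.
move=> h; rewrite -mulN1r -[- y]mulN1r; apply: spM h.
by have := sp_c0 (-1); rewrite polyCN polyC1 rmorphN rmorph1.
Qed.

Lemma spX x y k : sp x y -> sp (x ^+ k) (y ^+ k).
Proof. by move=> h; elim: k => [|k IHk]; [exact: sp1 | rewrite !exprS; apply: spM]. Qed.

Lemma sp_nat k : sp k%:R k%:R.
Proof. by elim: k => [|k IHk]; [exact: sp0 | rewrite -!natr1; apply: spD IHk sp1]. Qed.

Lemma sp_sum (I : Type) (r : seq I) (P : pred I) (F G : I -> Qqt) :
  (forall i, P i -> sp (F i) (G i)) -> sp (\sum_(i <- r | P i) F i) (\sum_(i <- r | P i) G i).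
Proof. by move=> h; apply: (big_ind2 sp) => //; [exact: sp0 | move=> *; apply: spD]. Qed.

Lemma sp_prod (I : Type) (r : seq I) (P : pred I) (F G : I -> Qqt) :
  (forall i, P i -> sp (F i) (G i)) -> sp (\prod_(i <- r | P i) F i) (\prod_(i <- r | P i) G i).
Proof. by move=> h; apply: (big_ind2 sp) => //; [exact: sp1 | move=> *; apply: spM]. Qed.

Lemma sp_lim x y : sp x y -> sp y y.
Proof.
case=> n [d [d0 _ E]]; exists (n`_0)%:P, (d`_0)%:P; rewrite !coefC /=; split=> //.
by rewrite -E mulfK // tofrac_eq0 polyC_eq0.
Qed.

Lemma sp0_inj y : sp 0 y -> y = 0.
Proof.
case=> n [d [d0 E1 E]]; have dn0 : d != 0 by apply: contraNneq d0 => ->; rewrite coef0.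
have n0 : n = 0.
  by move/eqP: E1; rewrite eq_sym mulf_eq0 invr_eq0 !tofrac_eq0 (negbTE dn0) orbF => /eqP.
move/eqP: E; rewrite n0 coef0 polyC0 rmorph0 mulf_eq0 tofrac_eq0 polyC_eq0 (negbTE d0) orbF.
by move/eqP.
Qed.

Lemma sp_neq0 x y : sp x y -> y != 0 -> x != 0.
Proof. by move=> h; apply: contraNneq => x0; rewrite x0 in h; rewrite (sp0_inj h). Qed.

Lemma fraction_rep (R : idomainType) (x : {fraction R}) : exists n d, d != 0 /\ x = tofrac n / tofrac d.
Proof.
elim/quotW: x => r; exists (\n_r), (\d_r); have dr := denom_ratioP r; split=> //.
apply: (canRL (mulfK _)); first by rewrite tofrac_eq0.
rewrite -[LHS]/(FracField.mul _ _) /FracField.tofrac; unlock.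
rewrite !piE; apply/eqmodP; rewrite /= FracField.equivfE /FracField.mulf.
by rewrite !numden_Ratio ?mulr1 ?oner_eq0 ?mul1r // mulrC.
Qed.

(* [g] clears the denominators and the common power of t. *)
Lemma sp_primitive (I : finType) (x : I -> Qqt) : (exists i, x i != 0) ->
  exists (g : Qqt) (y : I -> Qqt), (forall i, sp (g * x i) (y i)) /\ exists i, y i != 0.
Proof.
move=> [i0 xi0]; pose nd i := constructive_indefinite_description _ (fraction_rep (x i)).
pose n i := sval (nd i); pose dd i := constructive_indefinite_description _ (svalP (nd i)).
pose d i := sval (dd i).
have [d0 Ex] : (forall i, d i != 0) /\ forall i, x i = tofrac (n i) / tofrac (d i).
  by split=> i; have [] := svalP (dd i).
pose p i := n i * \prod_(j | j != i) d j.
have Ep i : tofrac (\prod_j d j) * x i = tofrac (p i).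
  rewrite Ex (bigD1 i) //= !rmorphM mulrC mulrA divfK ?tofrac_eq0 //.
suff [g [q [hg [i hi]]]] : exists (g : Qqt) (q : I -> {poly {poly rat}}),
    (forall i, g * tofrac (p i) = tofrac (q i)) /\ exists i, (q i)`_0 != 0.
  exists (g * tofrac (\prod_j d j)), (fun i => c0 (q i)`_0); split=> [k|].
    by rewrite -mulrA Ep hg; apply: sp_poly.
  by exists i; rewrite tofrac_eq0 polyC_eq0.
have : p i0 != 0.
  rewrite mulf_neq0 //; last by apply/prodf_neq0.
  by apply: contraNneq xi0 => n0; rewrite Ex n0 rmorph0 mul0r.
clear Ep; move: p => {n dd d nd d0 Ex} p.
have [k] := ubnP (size (p i0)); elim: k p => // k IHk p; rewrite ltnS => le_k p0.
have [/existsP[i hi]|/existsPn h] := boolP [exists i, (p i)`_0 != 0].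
  by exists 1, p; split=> [j|]; [rewrite mul1r | exists i].
(* All constant terms vanish, so t divides every [p i]; dividing lowers the size of the nonzero
   [p i0]. *)
pose p' i := \poly_(j < (size (p i)).-1) (p i)`_j.+1.
have Ep i : p i = p' i * 'X.
  apply/polyP => -[|j]; rewrite coefMX /= ?coef_poly; first by apply/eqP; have := h i; rewrite negbK.
  case: ltnP => // le_j; apply: nth_default.
  by case: (size (p i)) le_j => //.
have p'0 : p' i0 != 0 by apply: contraNneq p0 => E; rewrite Ep E mul0r.
have [|g [q [hg hq]]] := IHk p' _ p'0.
  by move: le_k; rewrite Ep size_mulX // ltnS.
have t0 : tt != 0 by rewrite tofrac_eq0 polyX_eq0.
exists (g / tt), q; split=> // i; rewrite Ep rmorphM -hg.
exact: cancel_factor t0.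
Qed.

Lemma qq_neq0 : qq != 0.
Proof. by rewrite tofrac_eq0 polyC_eq0 polyX_eq0. Qed.

Lemma tt_neq0 : tt != 0.
Proof. by rewrite tofrac_eq0 polyX_eq0. Qed.

Lemma one_subX_neq0 (R : nzRingType) k : (0 < k)%N -> 1 - 'X^k != 0 :> {poly R}.
Proof.
move=> k_gt0; apply/eqP => /(congr1 (fun p : {poly R} => p`_0)) /eqP.
by rewrite coefB coef1 coefXn coef0 (ltn_eqF k_gt0) subr0 oner_eq0.
Qed.

Lemma generic_qq : generic qq.
Proof.
move=> k k_gt0; have -> : 1 - qq ^+ k = tofrac ((1 - 'X^k)%:P : {poly {poly rat}}).
  by rewrite polyCB polyC1 rmorphB rmorph1 polyC_exp rmorphXn.
by rewrite tofrac_eq0 polyC_eq0 one_subX_neq0.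
Qed.

Lemma generic_tt : generic tt.
Proof.
move=> k k_gt0; have -> : 1 - tt ^+ k = tofrac (1 - 'X^k : {poly {poly rat}}).
  by rewrite rmorphB rmorph1 rmorphXn.
by rewrite tofrac_eq0 one_subX_neq0.
Qed.

(** The eigenvalue determines the generating polynomial of the cells, whose coefficients spell out
    the diagram. *)
Lemma eig_inj d : injective (@eig _ qq tt d).
Proof.
pose p (la : intpart d) : {poly {poly rat}} :=
  \sum_(j < d) \sum_(i < d | (i < part la j)%N) 'X%:P ^+ j * 'X^i.
have Ep la : eig qq tt la = 1 - (1 - qq) * (1 - tt) * tofrac (p la).
  rewrite /eig; congr (1 - _ * _); rewrite rmorph_sum; apply: eq_bigr => j _ /=.
  rewrite rmorph_sum; apply: eq_bigr => i _ /=.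
  by rewrite rmorphM !rmorphXn.
have q1 : (1 - qq) * (1 - tt) != 0.
  by rewrite mulf_neq0 //; [exact: (generic_qq (ltn0Sn 0)) | exact: (generic_tt (ltn0Sn 0))].
have co la (i j : 'I_d) : (p la)`_i`_j = (i < part la j)%N%:R.
  rewrite coef_sum coef_sum (bigD1 j) //= coef_sum coef_sum [X in _ + X]big1 => [|k].
    rewrite addr0; have c1 (l : 'I_d) : ('X%:P ^+ j * 'X^l : {poly {poly rat}})`_i`_j = (i == l)%:R.
      by rewrite -polyC_exp coefCM coefXn val_eqE; case: eqP => _; rewrite ?mulr1n ?mulr0n ?mulr1 ?mulr0 ?coef0 // coefXn eqxx.
    rewrite big_mkcond (bigD1 i) //= c1 eqxx [X in _ + X]big1 ?addr0 => [|l]; first by case: ifP.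
    by rewrite eq_sym => /negbTE ne; rewrite c1 -val_eqE /= in ne *; rewrite ne if_same.
  rewrite eq_sym => /negbTE ne; rewrite coef_sum coef_sum big1 // => l _.
  by rewrite -polyC_exp coefCM coefXn; case: eqP => _; rewrite ?mulr1 ?coefXn ?mulr0 ?coef0 // -val_eqE in ne *; rewrite ne.
move=> la mu; rewrite !Ep => /(addrI 1)/oppr_inj/(mulfI q1)/eqP; rewrite tofrac_eq => /eqP E.
apply: partP => j; have [lt_j|le_j] := ltnP j d; last by rewrite !part_big.
have := @ltn_ord_inj d (inord (part la j)) (inord (part mu j)).
move=> h; have {h} /(congr1 val) : inord (part la j) = inord (part mu j) :> 'I_d.+1.
  apply: h => i; rewrite !inordK ?ltnS ?part_le //.
  have := co la i (Ordinal lt_j); rewrite E co /= => /eqP.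
  by case: (i < part mu j)%N; case: (i < part la j)%N; rewrite // ?oner_eq0 // eq_sym oner_eq0.
by rewrite /= !inordK ?ltnS ?part_le.
Qed.

Section Orthonormal.
Variables (K : fieldType) (N : nat).
Hypothesis K0 : [pchar K] =i pred0.
Variable d : nat.
Hypothesis le_N : (d + d <= N)%N.
Notation sA := (@sA K N d).

Lemma form_sA_sum (y : intpart d -> K) la : \sum_ka form d (sA ka) (sA la) * y ka = y la.
Proof.
rewrite (bigD1 la) //= form_sA // eqxx mul1r big1 ?addr0 // => ka /negbTE ne.
by rewrite form_sA // ne mul0r.
Qed.

End Orthonormal.

Section Limits.
Variable N : nat.
Notation A := {mpoly Qqt[N]}.
Notation hgen := (hgen Qqt N).
Notation pgen := (pgen Qqt N).
Notation hspan := (fun d => lspan predT (@hp Qqt N d)).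
Notation hp := (@hp Qqt N _).
Notation pr := (@pr Qqt N _).
Notation sA := (@sA Qqt N _).
Let K0 := Qqt0.

(* [sp], coefficient by coefficient in the power sum basis *)
Definition spA (a b : A) := forall m, sp a@_m b@_m.

Lemma spA0 : spA 0 0.
Proof. by move=> m; rewrite mcoeff0; apply: sp0. Qed.

Lemma spA_D a b a' b' : spA a a' -> spA b b' -> spA (a + b) (a' + b').
Proof. by move=> h h' m; rewrite !mcoeffD; apply: spD. Qed.

Lemma spA_M a b a' b' : spA a a' -> spA b b' -> spA (a * b) (a' * b').
Proof. by move=> h h' m; rewrite !mcoeffM; apply: sp_sum => k _; apply: spM. Qed.

Lemma spA_Z x x' a a' : sp x x' -> spA a a' -> spA (x *: a) (x' *: a').
Proof. by move=> h h' m; rewrite !mcoeffZ; apply: spM. Qed.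

Lemma spA1 : spA 1 1.
Proof. by move=> m; rewrite mcoeff1; apply: sp_nat. Qed.

Lemma spA_sum (I : Type) (r : seq I) (P : pred I) (F G : I -> A) :
  (forall i, P i -> spA (F i) (G i)) -> spA (\sum_(i <- r | P i) F i) (\sum_(i <- r | P i) G i).
Proof. by move=> h; apply: (big_ind2 spA) => //; [exact: spA0 | move=> *; apply: spA_D]. Qed.

Lemma spA_prod (I : Type) (r : seq I) (P : pred I) (F G : I -> A) :
  (forall i, P i -> spA (F i) (G i)) -> spA (\prod_(i <- r | P i) F i) (\prod_(i <- r | P i) G i).
Proof. by move=> h; apply: (big_ind2 spA) => //; [exact: spA1 | move=> *; apply: spA_M]. Qed.

Lemma spA_pgen k : spA (pgen k) (pgen k).
Proof. by apply: spA_sum => i _ m; rewrite mcoeffX; apply: sp_nat. Qed.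

Lemma spA_hgen k : spA (hgen k) (hgen k).
Proof.
elim/ltn_ind: k => -[_|k IH]; first exact: spA1.
have k0 : k.+1%:R != 0 :> Qqt by apply: natK_neq0.
have -> : hgen k.+1 = k.+1%:R^-1 *: \sum_(i < k.+1) pgen i.+1 * hgen (k - i).
  by rewrite -hgenS // scalerA mulVf // scale1r.
apply: spA_Z; first by apply: spV => //; apply: sp_nat.
apply: spA_sum => i _; apply: spA_M; first exact: spA_pgen.
by apply: IH; rewrite ltnS leq_subr.
Qed.

Lemma spA_hp d (mu : intpart d) : spA (hp mu) (hp mu).
Proof. by apply: spA_prod => i _; apply: spA_hgen. Qed.

Lemma spA_sA d (la : intpart d) : spA (sA la) (sA la).
Proof.
rewrite /(sA _) JT_expand; apply: spA_sum => s _; apply: spA_M.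
  have -> : (-1) ^+ s = ((-1) ^+ s) *: 1 :> A by rewrite -mul_mpolyC mulr1 rmorphXn rmorphN1.
  by apply: spA_Z spA1; apply/spX/spN/sp1.
apply: spA_prod => i _; rewrite /hz; case: ifP => _; [exact: spA_hgen | exact: spA0].
Qed.

Lemma spA_dop c c' a a' : (forall k, (0 < k)%N -> sp (c k) (c' k)) -> spA a a' -> spA (dop c a) (dop c' a').
Proof.
move=> h ha m; have hw : sp (dweight c m) (dweight c' m).
  by apply: sp_prod => i _; apply: spX; apply: h.
by have := spM hw (ha m); rewrite -!dop_coef.
Qed.

Lemma sp_form d a a' b b' : spA a a' -> spA b b' -> sp (form d a b) (form d a' b').
Proof.
move=> ha hb; apply: sp_sum => rho _; apply: spM => //; apply: spM => //.
by apply: sp_prod => i _; apply: spM; [apply: spX; apply: sp_nat | apply: sp_nat].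
Qed.

Section Degree.
Variable d : nat.
Hypothesis le_N : (d + d.+1 <= N)%N.

Let le_N' : (d + d <= N)%N. Proof. by apply: leq_trans le_N; rewrite addnS. Qed.
Let le_dN : (d <= N)%N. Proof. by apply: leq_trans le_N'; apply: leq_addr. Qed.

Lemma pr_scalel (c : Qqt) (v : intpart d -> Qqt) f : pr (fun mu => c * v mu) f = c * pr v f.
Proof.
have := @pr_suml Qqt N d bool [:: true] predT (fun=> c) (fun=> v) f.
by rewrite !big_seq1 => <-; apply: eq_pr => mu; rewrite big_seq1.
Qed.

Lemma pr_sA (v : intpart d -> Qqt) f : hspan d f ->
  pr v f = \sum_(la : intpart d) form d (sA la) f * pr v (sA la).
Proof.
move=> hf; rewrite {1}(hspanS K0 le_N' hf) pr_sum; apply: eq_bigr => la _.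
by rewrite prZ.
Qed.

(** A functional with limits on the Schur basis has a limit functional: Schur functions do not
    involve t, so Schur coordinates of f tend to those of f'. *)
Lemma sp_functional (v y : intpart d -> Qqt) : (forall la, sp (pr v (sA la)) (y la)) ->
  exists2 w : intpart d -> Qqt, forall la, pr w (sA la) = y la &
    forall f f', hspan d f -> hspan d f' -> spA f f' -> sp (pr v f) (pr w f').
Proof.
move=> h; pose w (ka : intpart d) := \sum_(la : intpart d) form d (sA la) (hp ka) * y la.
have wE f : hspan d f -> pr w f = \sum_la form d (sA la) f * y la.
  case=> c ->; rewrite pr_sum; under [RHS]eq_bigr => la _ do rewrite form_sumr mulr_suml.
  rewrite [RHS]exchange_big; apply: eq_bigr => ka _ /=; rewrite prZ pr_hp // mulr_sumr.
  by apply: eq_bigr => la _; rewrite formZr mulrA.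
exists w => [la|f f' hf hf' ff'].
  rewrite wE; last exact: hspan_sA.
  exact: (form_sA_sum K0 le_N').
rewrite pr_sA // wE //; apply: sp_sum => la _; apply: spM; last exact: h.
by apply: sp_form => //; apply: spA_sA.
Qed.

End Degree.
End Limits.

(** * Limits of modified Macdonald polynomials *)

Section OneRow.
Variables (K : fieldType) (N d : nat).

Lemma hp_row (la : intpart d) : part la 0 = d -> hp K N la = hgen K N d.
Proof.
rewrite /hp; case: d la => [|e] la la0; first by rewrite big_ord0.
have := sum_part la (leqnn e.+1); rewrite !big_ord_recl la0 -[RHS]addn0 => /addnI/eqP.
rewrite sum_nat_eq0 => /forallP h; rewrite big1 ?mulr1 // => i _.
by have := h i; rewrite implyTb => /eqP ->.
Qed.

Lemma ex_row : exists la : intpart d, part la 0 = d.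
Proof.
have [|||la Ela] := @ex_part d (fun i => if i == 0%N then d else 0%N).
- by move=> [|i] [|j].
- by move=> [|i] //; rewrite leqn0 => /eqP.
- by case: d => [|e]; rewrite ?big_ord0 // big_ord_recl /= big1 ?addn0.
by exists la; rewrite Ela.
Qed.

End OneRow.

Lemma factor_neq0 (F : fieldType) (x y a b : F) : x = a * b -> x = y -> y != 0 -> a != 0.
Proof. by move=> -> <-; rewrite mulf_eq0 negb_or => /andP[]. Qed.

Lemma factor_cancelr (F : fieldType) (a b : F) : a != 0 -> a * b * a^-1 = b.
Proof. by move=> a0; rewrite mulrAC mulfV ?mul1r. Qed.

Section MacdonaldLimit.
Variables (N d : nat).
Hypothesis le_N : (d + d.+1 <= N)%N.
Notation A := {mpoly Qqt[N]}.
Notation pr := (@pr Qqt N _).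
Notation hspan := (fun d => lspan predT (@hp Qqt N d)).
Notation sA := (@sA Qqt N _).
Notation hld := (@hld Qqt N qq^-1 d).
Notation hn := (hgen Qqt N d).
Let K0 := Qqt0.
Let le_N' : (d + d <= N)%N. Proof. by apply: leq_trans le_N; rewrite addnS. Qed.
Let le_dN : (d <= N)%N. Proof. by apply: leq_trans le_N'; apply: leq_addr. Qed.

Lemma qqV_neq0 : qq^-1 != 0.
Proof. by rewrite invr_eq0 qq_neq0. Qed.

Lemma generic_qqV : generic qq^-1.
Proof. exact: genericV qq_neq0 generic_qq. Qed.

Lemma spA_theta_tt (a : A) : spA a a -> spA (theta tt a) a.
Proof.
move=> ha; have E : dop (fun=> 1) a = a by apply: dop1.
rewrite thetaE -[X in spA _ X]E; apply: spA_dop ha => k k_gt0.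
have := spD sp1 (spN (spX k sp_tt)); rewrite expr0n eqn0Ngt k_gt0 /= oppr0 addr0.
exact.
Qed.

Lemma spA_theta_qq (a : A) : spA a a -> spA (theta qq a) (theta qq a).
Proof.
move=> ha; rewrite thetaE; apply: spA_dop ha => k _.
exact: spD sp1 (spN (spX k sp_qq)).
Qed.

Lemma hspan_theta z (f : A) : hspan d f -> hspan d (theta z f).
Proof. by move=> hf; rewrite thetaE; apply: hspan_dop. Qed.

(* The limit of a rescaled [v] satisfies the triangularity conditions that
   characterise the dual Hall-Littlewood functional with parameter [qq^-1]. *)
Lemma macdonald_limit (mu : intpart d) (v : intpart d -> Qqt) :
  (forall la, ~~ dom la mu -> pr v (theta tt (sA la)) = 0) ->
  (forall la, ~~ dom la (conjp mu) -> pr v (theta qq (sA la)) = 0) ->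
  (exists2 f, hspan d f & pr v f != 0) ->
  exists g : Qqt, forall f f', hspan d f -> hspan d f' -> spA f f' -> sp (g * pr v f) (pr (hld mu) f').
Proof.
move=> vt vq [f0 hf0 nz].
have ex : exists la : intpart d, pr v (sA la) != 0.
  have [/existsP //|/existsPn h] := boolP [exists la : intpart d, pr v (sA la) != 0].
  case/negP: nz; apply/eqP; rewrite pr_sA // big1 // => la _.
  by have := h la; rewrite negbK => /eqP ->; rewrite mulr0.
have [g [y [Hy [i yi]]]] := sp_primitive ex.
have [|w wE wL] := @sp_functional N d le_N (fun ka => g * v ka) y.
  by move=> la; rewrite pr_scalel; apply: Hy.
(* At t = 0 the operator [theta tt] becomes the identity. *)
have w_t la : ~~ dom la mu -> pr w (sA la) = 0.
  move=> nd; apply: sp0_inj.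
  have := wL _ _ (hspan_theta tt (hspan_sA Qqt N la)) (hspan_sA Qqt N la) (spA_theta_tt (@spA_sA N d la)).
  by rewrite pr_scalel vt // mulr0.
have w_q la : ~~ dom la (conjp mu) -> pr w (theta qq (sA la)) = 0.
  move=> nd; apply: sp0_inj; have hs := hspan_theta qq (hspan_sA Qqt N la).
  have := wL _ _ hs hs (spA_theta_qq (@spA_sA N d la)).
  by rewrite pr_scalel vq // mulr0.
(* [thetaV] trades q for 1/q at the cost of omega, which conjugates the shape and so reverses
   dominance. *)
have w_V la : ~~ dom mu la -> pr w (theta qq^-1 (sA la)) = 0.
  move=> nd; rewrite (thetaV K0 le_dN qq_neq0 (hspan_sA Qqt N la)) (omegaA_sA K0) // prZ w_q ?mulr0 //.
  by rewrite dom_conjE.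
have wU f : hspan d f -> pr w f = pr w (sA mu) * pr (hld mu) f.
  by move=> hf; have := hld_uniq K0 qqV_neq0 generic_qqV le_N w_t w_V hf.
(* The rescaling was chosen so that the limit functional is nonzero, hence so is its factor of
   proportionality to [hld mu]. *)
have c0 := factor_neq0 (wU _ (hspan_sA Qqt N i)) (wE i) yi.
exists ((pr w (sA mu))^-1 * g) => f f' hf hf' ff'.
have := wL f f' hf hf' ff'; rewrite pr_scalel wU // => h.
have h1 : sp (pr w (sA mu)) (pr w (sA mu)) by have := Hy mu; rewrite -wE; apply: sp_lim.
have := spM (spV c0 h1) h; rewrite mulKf // -mulrA; exact.
Qed.

Lemma Htilde_eqP (mu : intpart d) (H : sym d) : is_Htilde mu H <->
  [/\ forall la, ~~ dom la mu -> pr H (theta tt (sA la)) = 0,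
      forall la, ~~ dom la (conjp mu) -> pr H (theta qq (sA la)) = 0 & pr H hn = 1].
Proof.
have [row row0] := ex_row d.
have E la : part la 0 = d -> pr H hn = H la.
  by move=> la0; rewrite -(hp_row Qqt N la0) pr_hp.
have [T1 T2] := in_schur_spanP le_N (fun la => dom la mu) (pleth1m tt H).
have [Q1 Q2] := in_schur_spanP le_N (fun la => dom la (conjp mu)) (pleth1m qq H).
have TE (la : intpart d) : pr (pleth1m tt H) (sA la) = pr H (theta tt (sA la)).
  by rewrite (pr_pleth1m le_N) //; apply: hspan_sA.
have QE (la : intpart d) : pr (pleth1m qq H) (sA la) = pr H (theta qq (sA la)).
  by rewrite (pr_pleth1m le_N) //; apply: hspan_sA.
split=> [[h1 h2 h3]|[h1 h2 h3]]; split.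
- by move=> la nd; rewrite -TE; apply: T1.
- by move=> la nd; rewrite -QE; apply: Q1.
- by rewrite (E row) // h3.
- by apply: T2 => la nd; rewrite TE h1.
- by apply: Q2 => la nd; rewrite QE h2.
by move=> la la0; rewrite -(E la).
Qed.

(** The normalisation requires the functional of [ex_macdonald] to be nonzero at h_n; a multiple of
    it has the nonzero limit of [hld_hgen_neq0]. *)
Lemma HtildeP (mu : intpart d) : is_Htilde mu (Htilde mu).
Proof.
apply: epsilon_spec.
have [v [v1 v2 v3]] :=
  ex_macdonald Qqt0 le_N mu qq_neq0 tt_neq0 generic_qq generic_tt (@eig_inj d).
have [g hg] := macdonald_limit v1 v2 v3.
have hh := hspan_hgen Qqt N d.
have nz : pr v hn != 0.
  have := hg _ _ hh hh (@spA_hgen N d).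
  move/sp_neq0 => /(_ (hld_hgen_neq0 Qqt0 qqV_neq0 generic_qqV le_N mu)).
  by rewrite mulf_eq0 negb_or => /andP[].
pose H : sym d := [ffun ka => (pr v hn)^-1 * v ka].
have HE f : pr H f = (pr v hn)^-1 * pr v f.
  by rewrite -pr_scalel; apply: eq_pr => ka; rewrite ffunE.
exists H; apply/Htilde_eqP; split=> [la nd|la nd|]; rewrite HE.
- by rewrite (v1 _ nd) mulr0.
- by rewrite (v2 _ nd) mulr0.
- exact: mulVf nz.
Qed.

(** Dividing by the limit at h_n, where [Htilde mu] has value 1, eliminates the unknown
    rescaling. *)
Lemma Htilde_limit (mu : intpart d) f f' : hspan d f -> hspan d f' -> spA f f' ->
  sp (pr (Htilde mu) f) (pr (hld mu) f' / pr (hld mu) hn).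
Proof.
have /Htilde_eqP[H1 H2 H3] := HtildeP mu => hf hf' ff'.
have hh := hspan_hgen Qqt N d.
have nz := hld_hgen_neq0 Qqt0 qqV_neq0 generic_qqV le_N mu.
have [|g hg] := macdonald_limit H1 H2.
  by exists hn; [exact: hh | rewrite H3 oner_eq0].
have hc := hg _ _ hh hh (@spA_hgen N d); rewrite H3 mulr1 in hc.
have := spM (hg f f' hf hf' ff') (spV nz hc).
by rewrite (factor_cancelr _ (sp_neq0 hc nz)).
Qed.

End MacdonaldLimit.

(** * Limits of solutions of linear systems *)

Section LimitSystem.
Variables (F : fieldType) (lim : F -> F -> Prop).
Hypotheses (lim0 : lim 0 0) (lim1 : lim 1 1).
Hypothesis limD : forall x y x' y', lim x x' -> lim y y' -> lim (x + y) (x' + y').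
Hypothesis limN : forall x y, lim x y -> lim (- x) (- y).
Hypothesis limM : forall x y x' y', lim x x' -> lim y y' -> lim (x * y) (x' * y').
Hypothesis limV : forall x x', x' != 0 -> lim x x' -> lim x^-1 x'^-1.
Hypothesis lim_neq0 : forall x y, lim x y -> y != 0 -> x != 0.

Lemma lim_det k (A B : 'M[F]_k) : (forall i j, lim (A i j) (B i j)) -> lim (\det A) (\det B).
Proof.
move=> h; apply: (big_ind2 lim) => // [*|s _]; first exact: limD.
apply: limM.
  by case: (s : bool); rewrite ?expr1 ?expr0 //; apply: limN.
by apply: (big_ind2 lim) => // *; apply: limM.
Qed.

Lemma lim_mulmx k l p (A A' : 'M[F]_(k, l)) (B B' : 'M_(l, p)) :
  (forall i j, lim (A i j) (A' i j)) -> (forall i j, lim (B i j) (B' i j)) ->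
  forall i j, lim ((A *m B) i j) ((A' *m B') i j).
Proof. by move=> h h' i j; rewrite !mxE; apply: (big_ind2 lim) => // *; [apply: limD | apply: limM]. Qed.

Lemma lim_invmx k (A B : 'M[F]_k) : (forall i j, lim (A i j) (B i j)) -> B \in unitmx ->
  A \in unitmx /\ forall i j, lim (invmx A i j) (invmx B i j).
Proof.
move=> h uB; have hd := lim_det h; have uA : A \in unitmx.
  by move: uB; rewrite !unitmxE !unitfE; apply: lim_neq0.
split=> // i j; rewrite /invmx uA uB !mxE; apply: limM.
  by apply: limV => //; rewrite -unitfE -unitmxE.
rewrite /cofactor; apply: limM; last by apply: lim_det => a b; rewrite !mxE.
by elim: (j + i)%N => [|l IHl]; rewrite ?expr0 // !exprS; apply: limM => //; apply: limN.
Qed.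

(** The determinant of M has a nonzero limit, so M is invertible, and inverses pass to the limit
    through cofactors. Existence of a solution is included because [coords] is meaningful only if an
    expansion exists. *)
Lemma lim_system (I : finType) (M Mb B : I -> I -> F) (r rb : I -> F) :
  (forall i j, lim (M i j) (Mb i j)) -> (forall j, lim (r j) (rb j)) ->
  (forall i k, \sum_j Mb i j * B j k = (i == k)%:R) ->
  (exists c, forall j, \sum_i c i * M i j = r j) /\
  forall c, (forall j, \sum_i c i * M i j = r j) -> forall i, lim (c i) (\sum_j rb j * B j i).
Proof.
move=> hM hr hB; pose mx (f : I -> I -> F) := \matrix_(i < #|I|, j < #|I|) f (enum_val i) (enum_val j).
pose rv (f : I -> F) := \row_(j < #|I|) f (enum_val j).
have sumI (f : I -> F) : \sum_i f i = \sum_(k < #|I|) f (enum_val k).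
  by rewrite (reindex (@enum_val I I)) //; apply: onW_bij; apply: enum_val_bij.
have MB : mx Mb *m mx B = 1%:M.
  apply/matrixP => i k; rewrite !mxE; under eq_bigr => j _ do rewrite !mxE.
  by rewrite -(sumI (fun j => Mb (enum_val i) j * B j (enum_val k))) hB (inj_eq enum_val_inj).
have [uMb _] := mulmx1_unit MB.
have iMb : invmx (mx Mb) = mx B by rewrite -[LHS]mulmx1 -MB mulKmx.
have [|uM hV] := @lim_invmx _ (mx M) (mx Mb) _ uMb; first by move=> i j; rewrite !mxE.
have sysE c : (forall j, \sum_i c i * M i j = r j) <-> rv c *m mx M = rv r.
  split=> [h|/rowP h j].
    apply/rowP => j; rewrite !mxE -h sumI; apply: eq_bigr => i _; by rewrite !mxE.
  have := h (enum_rank j); rewrite !mxE enum_rankK => <-; rewrite sumI.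
  by apply: eq_bigr => i _; rewrite !mxE enum_rankK.
split=> [|c /sysE h i].
  exists (fun i => (rv r *m invmx (mx M)) 0 (enum_rank i)); apply/sysE.
  rewrite -[RHS](mulmxKV uM); congr (_ *m _); apply/rowP => j; by rewrite mxE enum_valK.
have : rv c = rv r *m invmx (mx M) by rewrite -h mulmxK.
move/rowP/(_ (enum_rank i)); rewrite mxE enum_rankK => ->.
have := @lim_mulmx _ _ _ (rv r) (rv rb) (invmx (mx M)) (mx B) _ _ 0 (enum_rank i).
rewrite [X in lim _ X]mxE sumI.
under [X in lim _ X]eq_bigr => k _ do rewrite !mxE enum_rankK.
apply; first by move=> a b; rewrite !mxE.
by move=> a b; have := hV a b; rewrite iMb.
Qed.

End LimitSystem.

Lemma geometric_tail (F : fieldType) (z : F) n l k : z != 0 -> 1 - z ^+ k != 0 -> (0 < l <= n)%N ->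
  \sum_(i < n | (0 < i)%N && (i < l)%N) z ^+ (i * k) = z ^+ k * ((1 - (z ^+ l / z) ^+ k) / (1 - z ^+ k)).
Proof.
move=> z0 zk /andP[l0 le_ln].
rewrite -(big_ord_widen_cond n (fun i => 0 < i)%N (fun i => z ^+ (i * k)) le_ln).
case: l l0 {le_ln} => // l _; rewrite big_mkcond big_ord_recl /= add0r exprSr mulfK //.
have -> : 1 - z ^+ l ^+ k = (1 - z ^+ k) * \sum_(i < l) (z ^+ k) ^+ i.
  by rewrite -exprM mulnC exprM -[1 - _]opprB subrX1 -mulNr opprB.
rewrite [(1 - _) * _]mulrC mulfK // mulr_sumr; apply: eq_bigr => i _.
by rewrite -exprM -exprD /bump /= add1n mulSn mulnC.
Qed.

Section Limits.
Variable N : nat.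
Notation A := {mpoly Qqt[N]}.
Notation sA := (@sA Qqt N _).
Let K0 := Qqt0.

Lemma sp_spec (x y : nat -> Qqt) (f : A) : spA f f ->
  (forall k, (0 < k)%N -> sp (x k) (y k)) -> sp (spec idfun x f) (spec idfun y f).
Proof.
move=> hf h; apply: sp_sum => m _; apply: spM; first exact: hf.
by apply: sp_prod => i _; apply: spX; apply: h.
Qed.

Lemma schur_eval_spec m (nu : intpart m) (ys : seq Qqt) : (m <= N)%N ->
  schur_eval nu ys = spec idfun (fun k => \sum_(y <- ys) y ^+ k) (sA nu).
Proof.
move=> le_mN; apply: etrans (esym (phi_ssyt K0 idfun (fun i => ys`_i) (size ys) nu le_mN)) _.
by apply: eq_spec => k _; rewrite (big_nth 0) big_mkord.
Qed.

(** At t = 0 only the cells of the first column survive, and the corner is excluded. *)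
Lemma sp_cell_power (n : nat) (mu : intpart n) k : (0 < k)%N ->
  sp (\sum_(y <- cell_weights mu) y ^+ k)
     (\sum_(i < n | (0 < i)%N && (i < plen mu)%N) qq ^+ (i * k)).
Proof.
move=> k_gt0; rewrite big_map big_filter big_mkcond big_allpairs_dep /=.
rewrite [X in sp _ X]big_mkcond -(big_mkord predT (fun i => if (0 < i)%N && (i < plen mu)%N then qq ^+ (i * k) else 0)).
rewrite /index_iota subn0; apply: sp_sum => i _.
have -> : (if (0 < i)%N && (i < plen mu)%N then qq ^+ (i * k) else 0) =
    \sum_(j <- iota 0 (part mu i)) if (0 < i)%N && (j == 0%N) then qq ^+ (i * k) else 0.
  rewrite -part_gt0; case: (part mu i) => [|p] /=; first by rewrite big_nil andbF.
  rewrite big_cons eqxx andbT big1_seq ?addr0 // => j /andP[_].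
  by rewrite mem_iota => /andP[j_gt0 _]; rewrite (gtn_eqF j_gt0) andbF.
apply: sp_sum => j _; rewrite xpair_eqE negb_and.
have sp_mono : sp ((qq ^+ i * tt ^+ j) ^+ k) (if j == 0%N then qq ^+ (i * k) else 0).
  rewrite exprM; case: j => [|j] /=; first by rewrite expr0 mulr1; apply/spX/spX/sp_qq.
  have := spX k (spM (spX i sp_qq) (spX j.+1 sp_tt)).
  by rewrite expr0n mulr0 expr0n eqn0Ngt k_gt0.
move: ((qq ^+ i * tt ^+ j) ^+ k) (qq ^+ (i * k)) sp_mono => a b.
by case: i => [|i]; case: j => [|j] //= _; apply: sp0.
Qed.

(** The surviving weights q, ..., q^(l - 1) form the alphabet q (1 - q^(l - 1)) / (1 - q), a
    rescaled principal specialization at u = q^l / q. *)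
Lemma schur_eval_limit m (nu : intpart m) n (mu : intpart n) : (m <= N)%N -> (0 < n)%N ->
  sp (schur_eval nu (cell_weights mu)) (qq ^+ m * pspec qq (qq ^+ plen mu / qq) (sA nu)).
Proof.
move=> le_mN n_gt0; rewrite schur_eval_spec //.
rewrite /pspec -(spec_homog K0 _ _ le_mN (hspan_sA _ _ nu)).
have l_gt0 : (0 < plen mu)%N.
  by rewrite ltnNge leq_plen; apply/negP => /eqP p0; have := sum_part mu (leqnn n); 
    rewrite big1 => [n0|i _]; [rewrite -n0 in n_gt0 | apply/eqP; rewrite -leqn0 -p0 part_mono].
rewrite [X in sp _ X](eq_spec idfun (pi' := fun k => \sum_(i < n | (0 < i)%N && (i < plen mu)%N) qq ^+ (i * k))).
  by apply: sp_spec; [exact: spA_sA | move=> k; apply: sp_cell_power].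
have ln : (0 < plen mu <= n)%N by rewrite l_gt0 plen_le.
by move=> k /andP[k_gt0 _]; rewrite (geometric_tail qq_neq0 (generic_qq k_gt0) ln).
Qed.

End Limits.

(** * The left-hand side *)

Section FieldAux.
Variable F : fieldType.
Implicit Types a b c d x y : F.

Lemma dual_scale a b c d : a / c * (b * d) = d / c * (b * a).
Proof. by ring. Qed.

Lemma limit_cancel a b c d : c != 0 -> (a * c) * b * (d / c) = a * b * d.
Proof. by move=> c0; field. Qed.

End FieldAux.

Section LeftSide.
Variables (N n : nat).
Hypothesis le_N : (n + n.+1 <= N)%N.
Notation A := {mpoly Qqt[N]}.
Notation hspan := (fun d => lspan predT (@hp Qqt N d)).
Notation hp := (@hp Qqt N _).
Notation pr := (@pr Qqt N _).
Notation sA := (@sA Qqt N _).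
Notation hl := (@hl Qqt N qq^-1 n).
Notation hld := (@hld Qqt N qq^-1 n).
Notation hn := (hgen Qqt N n).
Notation omegaA := (@omegaA Qqt N).
Let K0 := Qqt0.
Let le_N' : (n + n <= N)%N. Proof. by apply: leq_trans le_N; rewrite addnS. Qed.
Let le_nN : (n <= N)%N. Proof. by apply: leq_trans le_N'; apply: leq_addr. Qed.
Let hldn (mu : intpart n) : pr (hld mu) hn != 0 :=
  hld_hgen_neq0 K0 qqV_neq0 generic_qqV le_N mu.

Lemma pr_omegaA (v : sym n) f : hspan n f -> pr (omega v) f = pr v (omegaA f).
Proof.
move=> hf; rewrite (hspanS K0 le_N' hf) /(omegaA _) rmorph_sum !pr_sum.
apply: eq_bigr => la _; rewrite /= dopZ !prZ; congr (_ * _).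
by rewrite (pr_omega le_N) -(omegaA_sA K0 la le_N).
Qed.

Lemma spA_omegaA (f : A) : spA f f -> spA (omegaA f) (omegaA f).
Proof. by move=> hf; apply: spA_dop hf => k _; apply: spX; apply: spN; apply: sp1. Qed.

Lemma spec_hspanS pi (f : A) : hspan n f ->
  spec idfun pi f = \sum_(la : intpart n) form n (sA la) f * spec idfun pi (sA la).
Proof.
move=> hf; rewrite {1}(hspanS K0 le_N' hf) rmorph_sum; apply: eq_bigr => la _.
exact: (specZ idfun pi).
Qed.

Lemma coords_elem_limit (mu : intpart n) :
  sp (coords (@Htilde n) (elem n) mu) (ev_elem (hl mu) * pr (hld mu) hn).
Proof.
have hh la : hspan n (hl la) := hspan_hl K0 qqV_neq0 generic_qqV le_N la.
pose M (ka la : intpart n) := pr (Htilde ka) (sA la).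
pose Mb (ka la : intpart n) := pr (hld ka) (sA la) / pr (hld ka) hn.
(* The inverse of the limit matrix [Mb], because the [hld] are dual to the [hl]. *)
pose B (la ka : intpart n) := form n (sA la) (hl ka) * pr (hld ka) hn.
pose r (la : intpart n) := ev_elem (sA la).
have hM ka la : sp (M ka la) (Mb ka la).
  by apply: (Htilde_limit le_N); [exact: hspan_sA | exact: hspan_sA | exact: spA_sA].
have hr la : sp (r la) (r la).
  by apply: sp_spec; [exact: spA_sA | move=> k _; apply: spX; apply: spN; apply: sp1].
have hB ka la : \sum_j Mb ka j * B j la = (ka == la)%:R.
  transitivity (pr (hld la) hn / pr (hld ka) hn * pr (hld ka) (hl la)).
    rewrite (pr_sA le_N _ (hh la)) mulr_sumr; apply: eq_bigr => j _; exact: dual_scale.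
  rewrite (hld_hl K0 qqV_neq0 generic_qqV le_N).
  by case: eqP => [->|_]; rewrite ?mulr0 // mulr1 divff.
have [[c Ec] lim] := lim_system sp0 sp1 (fun x y x' y' => @spD x y x' y') spN
  (fun x y x' y' => @spM x y x' y') spV sp_neq0 hM hr hB.
have Er la : pr (elem n) (sA la) = r la by rewrite (pr_elem le_N) //; apply: hspan_sA.
have prC (a : intpart n -> Qqt) la :
    pr (\sum_ka a ka *: Htilde ka : sym n) (sA la) = \sum_ka a ka * M ka la by rewrite pr_comb.
have Ee : elem n = \sum_ka c ka *: Htilde ka.
  apply: (sym_pr_inj le_N) => f hf; rewrite !(pr_sA le_N _ hf).
  by apply: eq_bigr => la _; rewrite prC Ec Er.
have := lim (coords (@Htilde n) (elem n)) _ mu.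
have -> : \sum_j r j * B j mu = ev_elem (hl mu) * pr (hld mu) hn.
  rewrite /ev_elem (spec_hspanS _ (hh mu)) mulr_suml; apply: eq_bigr => j _.
  by rewrite mulrA [r j * _]mulrC.
by apply=> la; rewrite -prC -Er -(coordsP Ee).
Qed.

(** The unknown value of [hld mu] at h_n occurs in the limit of the coefficient and inversely in
    that of [Htilde mu], so it cancels. *)
Lemma left_limit m (nu : intpart m) (la : intpart n) : (m <= N)%N -> (0 < n)%N ->
  sp (omega (DeltaP nu (elem n)) la)
     (\sum_(mu : intpart n) ev_elem (hl mu) * (qq ^+ m * pspec qq (qq ^+ plen mu / qq) (sA nu))
        * pr (hld mu) (omegaA (hp la))).
Proof.
move=> le_mN n_gt0; have hl' : hspan n (hp la) by apply: lspan_mem.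
have ho : hspan n (omegaA (hp la)) by apply: hspan_dop.
rewrite -(pr_hp K0 (omega _) la le_nN) (pr_omegaA _ hl') pr_comb; apply: sp_sum => mu _.
have := spM (spM (coords_elem_limit mu) (schur_eval_limit nu mu le_mN n_gt0))
  (Htilde_limit le_N mu ho ho (spA_omegaA (@spA_hp N n la))).
by rewrite (limit_cancel _ _ _ (hldn mu)).
Qed.

End LeftSide.

(** * The right-hand side *)

Section PartitionStatistics.
Variables (d : nat).
Implicit Types la mu : intpart d.

Lemma plen_sum la : plen la = (\sum_(i < d) (0 < part la i))%N.
Proof.
have := sum_ord_lt (fun=> 1%N) (plen_le la); rewrite [RHS]sum_nat_const card_ord muln1 => <-.
by rewrite big_mkcond; apply: eq_bigr => i _; rewrite part_gt0; case: ifP.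
Qed.

Lemma sum_mult la : (\sum_(i < d) mult la i.+1)%N = plen la.
Proof.
transitivity (\sum_(i < d) \sum_(j < d) (part la j == i.+1))%N.
  by apply: eq_bigr => i _; rewrite mult_sum.
rewrite plen_sum exchange_big.
apply: eq_bigr => j _; have [->|gt0] := posnP (part la j); first by rewrite big1.
have lt_d : ((part la j).-1 < d)%N by rewrite prednK ?part_le.
rewrite (bigD1 (Ordinal lt_d)) //= prednK // eqxx big1 // => i.
by rewrite -val_eqE /= => ne; apply/eqP; rewrite eqb0; apply: contra ne => /eqP ->.
Qed.

Lemma bstat_bbar la : bstat la = (bbar la + 'C(plen la, 2))%N.
Proof.
rewrite -bin2_sum big_mkord -(sum_ord_lt id (plen_le la)) big_mkcond -big_split.
apply: eq_bigr => i _ /=; rewrite -part_gt0; case: (part la i) => [|p] /=; first by rewrite muln0.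
by rewrite mulnS mulnC addnC.
Qed.

End PartitionStatistics.

Section RightAux.
Variable F : fieldType.
Implicit Types a b c d e p z : F.

Lemma mul_geometric z k : (\sum_(i < k) z ^+ i) * (1 - z) = 1 - z ^+ k.
Proof. by rewrite -[1 - _ ^+ k]opprB subrX1 mulrC -mulNr opprB. Qed.

Lemma div_cancel a b c : c != 0 -> (a * c) / (b * c) = a / b.
Proof. by move=> c0; rewrite -mulf_div divff ?mulr1. Qed.

Lemma right_term a c p p' d e :
  a / c * (p * d) * (p' / c * e) = a / (c * c) * p * p' * d * e.
Proof. by rewrite invfM; ring. Qed.

Lemma inner_term a c p v x : c != 0 -> a * (p / v) * x = p / c * (a * c / v * x).
Proof. move=> c0; transitivity (c / c * (a * (p / v) * x)); last by ring.
by rewrite divff // mul1r. Qed.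

Lemma outer_term a p v x : a * (p / v) * x = p * (a / v * x).
Proof. by ring. Qed.

End RightAux.

Lemma qfact_qpoch k : qfact k * (1 - qq) ^+ k = qpoch qq k.
Proof.
elim: k => [|k IHk]; first by rewrite /qfact /qpoch !big_ord0 mulr1.
rewrite /qfact /qpoch !big_ord_recr /= -/(qfact k) -/(qpoch qq k) -IHk exprSr mulrACA.
by rewrite /qint mul_geometric.
Qed.

Lemma qmultinom_qpoch d (la : intpart d) : qmultinom la = qpoch qq (plen la) / vfac qq la.
Proof.
have q1 : (1 - qq) ^+ plen la != 0 by rewrite expf_neq0 // (generic_qq (ltn0Sn 0)).
rewrite /qmultinom -[LHS](div_cancel _ _ q1) qfact_qpoch; congr (_ / _).
rewrite big_add1 big_mkord -(sum_mult la) -prodrXr -big_split; apply: eq_bigr => i _.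
exact: qfact_qpoch.
Qed.

Section RightSide.
Variables (N n : nat).
Hypothesis le_N : (n + n.+1 <= N)%N.
Notation hspan := (fun d => lspan predT (@hp Qqt N d)).
Notation pr := (@pr Qqt N _).
Notation sA := (@sA Qqt N _).
Notation hld := (@hld Qqt N qq n).
Let K0 := Qqt0.
Let le_nN : (n <= N)%N. Proof. by apply: leq_trans le_N; apply: leq_addr. Qed.

Lemma QprimeP (mu : intpart n) : is_Qprime mu (Qprime mu).
Proof.
apply: epsilon_spec; pose Q : sym n := [ffun ka => hld mu ka].
have QE f : pr Q f = pr (hld mu) f by apply: eq_pr => ka; rewrite ffunE.
exists Q; split; apply/(in_schur_spanP le_N) => la.
  rewrite pr_add pr_opp QE (schur_sA le_N) negb_and negbK => /orP[nd|/eqP ->].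
    rewrite (hld_sA K0 qq_neq0 generic_qq le_N nd).
    by case: eqP nd => [->|_]; rewrite ?dom_refl // oppr0 addr0.
  by rewrite (hld_sAmu K0 qq_neq0 generic_qq le_N) eqxx subrr.
move=> nd; rewrite (pr_pleth1m le_N); last exact: hspan_sA.
by rewrite QE (hld_theta_sA K0 qq_neq0 generic_qq le_N nd).
Qed.

(** [hld_uniq] makes the defining conditions determine the functional up to a scalar, which the unit
    coefficient at s_mu fixes. *)
Lemma pr_Qprime (mu : intpart n) f : hspan n f -> pr (Qprime mu) f = pr (hld mu) f.
Proof.
have [/(in_schur_spanP le_N) h1 /(in_schur_spanP le_N) h2] := QprimeP mu => hf.
have pS la : ~~ (dom la mu && (la != mu)) -> pr (Qprime mu) (sA la) = (mu == la)%:R.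
  by move=> /h1; rewrite pr_add pr_opp (schur_sA le_N) => /subr0_eq.
have w1 la : ~~ dom la mu -> pr (Qprime mu) (sA la) = 0.
  move=> nd; rewrite pS ?negb_and ?nd //.
  by case: eqP nd => [->|//]; rewrite dom_refl.
have w2 la : ~~ dom mu la -> pr (Qprime mu) (theta qq (sA la)) = 0.
  by move=> /h2; rewrite (pr_pleth1m le_N) //; apply: hspan_sA.
have := hld_uniq K0 qq_neq0 generic_qq le_N w1 w2 hf.
by rewrite pS ?eqxx ?andbF // mul1r.
Qed.

Lemma kostka_foulkes_hld (la mu : intpart n) : kostka_foulkes la mu = pr (hld mu) (sA la).
Proof. by rewrite /kostka_foulkes (coords_schur le_N) pr_Qprime //; apply: hspan_sA. Qed.

Lemma Pcoef_hlcoef (nu : intpart n) j :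
  Pcoef nu j = qq ^+ n / qq ^+ 'C(j.+1, 2) * (qpoch qq j * hlcoef qq n (sA nu) j).
Proof.
rewrite /Pcoef expfzDr ?qq_neq0 // -invr_expz -!exprnP; congr (_ * _).
rewrite /hlcoef mulr_sumr; apply: eq_bigr => rho /eqP <-.
by rewrite qmultinom_qpoch kostka_foulkes_hld; apply: outer_term.
Qed.

(** The Kostka-Foulkes polynomial of nu and rho vanishes unless nu dominates rho, which then has at
    least as many parts. This accounts for the lower bound of the sum over k. *)
Lemma hlcoef_small (nu : intpart n) j : (j < plen nu)%N -> hlcoef qq n (sA nu) j = 0.
Proof.
move=> lt_j; apply: big1 => rho /eqP rho_j.
rewrite (hld_sA K0 qq_neq0 generic_qq le_N) ?mulr0 //.
by apply: contraL lt_j => /dom_plen; rewrite rho_j -leqNgt.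
Qed.

Lemma pr_Qprime_sum k f : hspan n f ->
  pr (\sum_(mu : intpart n | plen mu == k) (qq ^+ bbar mu * qmultinom mu) *: Qprime mu : sym n) f =
  qpoch qq k / qq ^+ 'C(k, 2) * hlcoef qq n f k.
Proof.
move=> hf; rewrite pr_comb /hlcoef mulr_sumr; apply: eq_bigr => mu /eqP <-.
rewrite pr_Qprime // qmultinom_qpoch bstat_bbar exprD.
by apply: inner_term; apply: expf_neq0 qq_neq0.
Qed.

End RightSide.

Lemma right_side N n m (nu : intpart m) (la : intpart n) :
  (n + n.+1 <= N)%N -> (m + m.+1 <= N)%N ->
  rhs nu n la = \sum_(j < m.+1)
    qq ^+ m / qq ^+ (j * j.+1) * qpoch qq j * qpoch qq j.+1 *
    hlcoef qq m (sA Qqt N nu) j * hlcoef qq n (hp Qqt N la) j.+1.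
Proof.
move=> le_n le_m; have le_nN : (n <= N)%N by apply: leq_trans le_n; apply: leq_addr.
rewrite -(pr_hp Qqt0 (rhs nu n) la le_nN) pr_comb big_add1 /=.
rewrite -(big_mkord predT (fun j => qq ^+ m / qq ^+ (j * j.+1) * qpoch qq j * qpoch qq j.+1 *
    hlcoef qq m (sA Qqt N nu) j * hlcoef qq n (hp Qqt N la) j.+1)).
rewrite [RHS](@big_cat_nat _ _ _ (plen nu)) ?(leqW (plen_le nu)) //= [X in _ = X + _]big_nat_cond.
rewrite [X in _ = X + _]big1 ?add0r => [|j /andP[/andP[_ lt_j] _]]; last first.
  by rewrite (hlcoef_small le_m lt_j) mulr0 mul0r.
apply: eq_bigr => j _; rewrite (Pcoef_hlcoef le_m) (pr_Qprime_sum le_n); last exact: lspan_mem.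
(* With k = j + 1, the binomial exponent of P and that of b - bbar are both binomial(j + 1, 2), and
   together give j (j + 1). *)
rewrite right_term -exprD addnn -mul2n -mul_bin_diag bin1 mulnC.
by [].
Qed.

Theorem theorem1p2 (m : nat) (nu : intpart m) (n : nat) :
  (0 < n)%N ->
  forall la : intpart n, at_t0_eq (omega (DeltaP nu (elem n)) la) (rhs nu n la).
Proof.
(* Enough power sums for both degrees, n for the functions Q' and m for s_nu. *)
move=> n_gt0 la; pose N := ((n + n.+1) + (m + m.+1))%N.
have le_n : (n + n.+1 <= N)%N by apply: leq_addr.
have le_m : (m + m.+1 <= N)%N by apply: leq_addl.
have le_mN : (m <= N)%N by apply: leq_trans le_m; apply: leq_addr.
have hf : lspan predT (@hp Qqt N n) (hp Qqt N la) by apply: lspan_mem.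
rewrite (right_side nu la le_n le_m).
rewrite -(hl_identity Qqt0 qq_neq0 generic_qq n_gt0 le_n hf nu le_m).
exact: left_limit.
Qed.
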